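(* Let $X$ be a coded shift with unique representation $\mathcal{G}$. Suppose that the language and the generating set $\mathcal{G}$ of $X$ are given by oracles. If the zero potential on $X$ is in $FSSP(X)$, then the topological entropy of $X$ is computable.
   Context: $\Sigma=\mathcal{A}^{\mathbb{Z}}$ is the full two-sided shift over a finite alphabet $\mathcal{A}$ with left shift $f$. For a countable set $\mathcal{G}=\{g_i\}_{i\in\mathbb{N}}$ of finite words over $\mathcal{A}$, let $X_{\rm seq}$ be the set of all bi-infinite concatenations $\cdots g_{i_{-1}}g_{i_0}g_{i_1}\cdots$ (arbitrary position of the origin). The coded shift with generating set $\mathcal{G}$ is $X=X(\mathcal{G})=\overline{X_{\rm seq}}$. $\mathcal{G}$ is a unique representation of $X$ if every $x\in X_{\rm seq}$ can be uniquely written as a bi-infinite concatenation of elements of $\mathcal{G}$. $\mathcal{M}_X$ is the set of $f$-invariant Borel probability measures on $X$; $P_\mu(\phi)=h_\mu(f)+\int\phi\,d\mu$ for $\phi\in C(X,\mathbb{R})$. A potential $\phi$ has strict full sequential pressure if $\sup\{P_\mu(\phi):\mu\in\mathcal{M}_X,\mu(X_{\rm seq})=1\}>\sup\{P_\mu(\phi):\mu\in\mathcal{M}_X,\mu(X\setminus X_{\rm seq})=1\}$ (with $\sup\emptyset=-\infty$). $FSSP(X)$ is the closure in $C(X,\mathbb{R})$ (supremum norm) of the set of potentials with strict full sequential pressure. An oracle for the language of $X$ returns, on input $n$, the finite list of all words of length $2n+1$ occurring in points of $X$. An oracle for $\mathcal{G}$ lists the generators in order: on input $n$ it returns the first $n$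 generators (all of them if there are fewer than $n$). The entropy of $X$ being computable means that there is a Turing machine which, with access to these oracles, on input $n\in\mathbb{N}$ outputs a rational $q$ with $|q-h_{\rm top}(X)|<2^{-n}$. *)

(* Defs.v *)
From HB Require Import structures.
From mathcomp Require Import all_boot all_order all_algebra.
From mathcomp Require Import all_classical all_reals all_analysis.

Set Implicit Arguments.
Unset Strict Implicit.
Unset Printing Implicit Defensive.

Import Order.TTheory GRing.Theory Num.Theory.
Import numFieldNormedType.Exports.

Local Open Scope classical_set_scope.
Local Open Scope ring_scope.

(* Nonempty finite types: the library's measurable types are pointed, so the
   alphabet must be pointed for [full_shift] to be one. *)
#[short(type="alphabetType")]
HB.structure Definition Alphabet := {A of Finite A & Pointed A}.

Definition full_shift (A : Type) : Type := int -> A.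

(* The product of the discrete topologies, and its Borel sigma-algebra. *)
HB.instance Definition _ (A : alphabetType) :=
  Uniform.copy (full_shift A) (prod_topology (fun _ : int => discrete_topology A)).
HB.instance Definition _ (A : alphabetType) := Pointed.copy (full_shift A) (int -> A).
HB.instance Definition _ (A : alphabetType) :=
  Measurable.copy (full_shift A) (g_sigma_algebraType (@open (full_shift A))).

Definition left_shift (A : Type) (x : full_shift A) : full_shift A :=
  fun i => x (i + 1).

Section CodedShifts.
Context {A : alphabetType}.
Implicit Types (X : set (full_shift A)) (G : set (seq A)) (x : full_shift A).

Definition subword x (i : int) (n : nat) : seq A :=
  [seq x (i + Posz j) | j <- iota 0 n].

Definition language X : set (seq A) :=
  [set w | exists2 x, X x & exists i, subword x i (size w) = w].

(* [x] is the concatenation of the words [u i], with [u i] starting at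
   coordinate [c i].  When no [u i] is empty these words cover all of [int]. *)
Definition concatenation (u : int -> seq A) (c : int -> int) x : Prop :=
  forall i, subword x (c i) (size (u i)) = u i /\
            c (i + 1) = c i + Posz (size (u i)).

Definition written_as G x (u : int -> seq A) (c : int -> int) : Prop :=
  (forall i, G (u i)) /\ concatenation u c x.

Definition concatenations G : set (full_shift A) :=
  [set x | exists u c, written_as G x u c].

Definition coded_shift G : set (full_shift A) := closure (concatenations G).

(* Two ways of writing [x] that differ only in the numbering of the words,
   that is in the choice of the word numbered 0, are the same. *)
Definition unique_representation G : Prop :=
  forall x u c u' c', written_as G x u c -> written_as G x u' c' ->
  exists k, forall i, u' i = u (i + k) /\ c' i = c (i + k).

End CodedShifts.

Section Entropy.
Context {R : realType}.

Definition topological_entropy (A : alphabetType) (X : set (full_shift A)) : R :=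
  lim ((ln #|[pred w : n.-tuple A | `[< language X w >]]|%:R / n%:R : R)
         @[n --> \oo]).

(* Kolmogorov-Sinai entropy.  A partition into [k] (possibly empty) measurable
   pieces is given by the map [p] sending a point to the number of its piece;
   the pieces of the [n]-th refinement are the fibres of [itinerary f p n].
   The convention 0 ln 0 = 0 holds as the library sets [ln 0 = 0]. *)
Context {d : measure_display} {T : measurableType d}.
Variables (f : T -> T) (mu : probability T R).

Definition itinerary (k : nat) (p : T -> 'I_k) (n : nat) (x : T) : n.-tuple 'I_k :=
  [tuple p (iter i f x) | i < n].

Definition partition_entropy (k : nat) (p : T -> 'I_k) (n : nat) : R :=
  - \sum_(w : n.-tuple 'I_k)
      let m := fine (mu (itinerary p n @^-1` [set w])) in m * ln m.

Definition metric_entropy : \bar R :=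
  ereal_sup [set h | exists k (p : T -> 'I_k),
    (forall i, measurable (p @^-1` [set i])) /\
    h = (lim ((partition_entropy p n / n%:R : R) @[n --> \oo]))%:E].

End Entropy.

Section Pressure.
Context {R : realType} {A : alphabetType}.
Implicit Types (X : set (full_shift A)) (G : set (seq A)).
Implicit Types (phi : full_shift A -> R).

(* Measures and potentials on [X] are represented on the whole full shift:
   a measure on [X] is one giving [X] full mass, and only the restriction to
   [X] of a potential matters. *)
Definition invariant_measures X : set (probability (full_shift A) R) :=
  [set mu | mu X = 1%E /\
            forall B, measurable B -> mu (@left_shift A @^-1` B) = mu B].

Definition pressure X phi (mu : probability (full_shift A) R) : \bar R :=
  (metric_entropy (@left_shift A) mu + \int[mu]_(x in X) (phi x)%:E)%E.

Definition strict_full_sequential_pressure G phi : Prop :=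
  let X := coded_shift G in let Xseq := concatenations G in
  (ereal_sup [set pressure X phi mu | mu in
     [set mu | invariant_measures X mu /\ mu (X `\` Xseq) = 1]] <
   ereal_sup [set pressure X phi mu | mu in
     [set mu | invariant_measures X mu /\ mu Xseq = 1]])%E.

Definition FSSP G : set (full_shift A -> R) :=
  let X := coded_shift G in
  [set phi | {within X, continuous phi} /\
     closure ([set psi | {within X, continuous psi} /\
                         strict_full_sequential_pressure G psi]
              : set {uniform` X -> R}) phi].

End Pressure.

(* Deterministic multitape Turing machines with two oracles.  The tape alphabet
   is the alphabet [A], four fixed symbols and a finite set [W]. *)
Inductive symbol (A W : Type) : Type :=
  Blank | One | Minus | Sep | Letter of A | Work of W.
Arguments Blank {A W}.
Arguments One {A W}.
Arguments Minus {A W}.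
Arguments Sep {A W}.
Arguments Letter {A W}.
Arguments Work {A W}.

Variant move : Type := MoveLeft | Stay | MoveRight.

Variant oracle_name : Type := Language | Generators.

(* In a state of mode [Query o s] the machine consults the oracle [o] and
   resumes in state [s]. *)
Variant mode (Q : Type) : Type := Running | Halted | Query of oracle_name & Q.
Arguments Running {Q}.
Arguments Halted {Q}.

(* The first of the [extra_tapes + 2] tapes is the input and output tape, the
   last one is the oracle tape. *)
Record oracle_machine (A : Type) : Type := OracleMachine {
  work_symbol : finType;
  state : finType;
  extra_tapes : nat;
  initial : state;
  mode_of : state -> mode state;
  transition : state -> {ffun 'I_extra_tapes.+2 -> symbol A work_symbol} ->
    state * {ffun 'I_extra_tapes.+2 -> symbol A work_symbol * move} }.

(* A two-way infinite tape: [before] lists the cells to the left of the head,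
   nearest first, [after] the scanned cell and those to its right; all cells
   not listed are blank. *)
Record tape (S : Type) : Type := Tape { before : seq S; after : seq S }.

Section Machines.
Context {A : eqType}.

Section Tapes.
Context {W : Type}.
Local Notation S := (symbol A W).

Definition scanned (t : tape S) : S := head Blank (after t).

Definition write_move (s : S) (m : move) (t : tape S) : tape S :=
  match m with
  | MoveLeft => Tape (behead (before t))
                     (head Blank (before t) :: s :: behead (after t))
  | Stay => Tape (before t) (s :: behead (after t))
  | MoveRight => Tape (s :: before t) (behead (after t))
  end.

Definition is_one (s : S) : bool := if s is One then true else false.

(* The number of consecutive [One]s from the scanned cell rightwards. *)
Definition read_unary (t : tape S) : nat := find (predC is_one) (after t).

Definition unary (n : nat) : seq S := nseq n One.

Definition code_words (ws : seq (seq A)) : seq S :=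
  flatten [seq rcons [seq Letter a | a <- w] Sep | w <- ws].

(* Fractions need not be in lowest terms. *)
Definition codes_rat (s : seq S) (q : rat) : Prop :=
  exists (b : bool) (p m : nat),
    s = nseq b Minus ++ unary p ++ Sep :: unary m.+1 /\
    q = (-1) ^+ b * p%:R / m.+1%:R.

End Tapes.

Variables (M : oracle_machine A) (OL OG : nat -> seq (seq A)).
Local Notation S := (symbol A (work_symbol M)).
Local Notation tapes := {ffun 'I_(extra_tapes M).+2 -> tape S}.

Definition oracle_answer (o : oracle_name) : nat -> seq (seq A) :=
  match o with Language => OL | Generators => OG end.

(* A query to an oracle, whose argument is read in unary on the oracle tape,
   replaces the contents of that tape by the answer. *)
Definition step (c : state M * tapes) : state M * tapes :=
  let: (q, t) := c in
  match mode_of q with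
  | Halted => c
  | Query o q' =>
      (q', [ffun j => if j == ord_max
                      then Tape [::] (code_words (oracle_answer o (read_unary (t j))))
                      else t j])
  | Running =>
      let: (q', a) := transition q [ffun j => scanned (t j)] in
      (q', [ffun j => write_move (a j).1 (a j).2 (t j)])
  end.

Definition initial_configuration (n : nat) : state M * tapes :=
  (initial M, [ffun j => Tape [::] (if j == ord0 then unary n else [::])]).

(* The output is read from the head of the first tape rightwards, up to
   trailing blanks. *)
Definition outputs (n : nat) (q : rat) : Prop :=
  exists k, let: (s, t) := iter k step (initial_configuration n) in
    mode_of s = Halted /\
    exists w j, after (t ord0) = w ++ nseq j Blank /\ codes_rat w q.

Definition computes_real (R : realType) (h : R) : Prop :=
  forall n, exists q, outputs n q /\ `|ratr q - h| < 2 ^- n.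

End Machines.

Definition language_oracle (A : alphabetType) (X : set (full_shift A))
    (OL : nat -> seq (seq A)) : Prop :=
  forall n, uniq (OL n) /\
    forall w, w \in OL n <-> size w = (2 * n + 1)%N /\ language X w.

(* [OG n] lists the first [n] elements of [G], or all of them if there are
   fewer, in an order fixed once and for all: by the second condition, a list
   [OG n] of length less than [n] is never extended by a later one. *)
Definition generator_oracle (A : eqType) (G : set (seq A))
    (OG : nat -> seq (seq A)) : Prop :=
  [/\ forall n, uniq (OG n),
      forall m n, (m <= n)%N -> OG m = take m (OG n)
    & forall w, G w <-> exists n, w \in OG n].

(* Main.v *)
(* For s >= 0 let K(s) be the sum of e^(-s |g|) over the generators g.  Let h be
   the entropy of X.

   By unique representation different lists of k generators have different
   products, so a finite subsum of K(s) that is at least 1 gives h >= s.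
   Conversely, suppose that s < h and K(s) <= 1.  Then there are at most e^(s n)
   products of generators of length n.  For an invariant measure carried by
   X_seq, a long window is, up to a small probability, such a product between
   two ends of bounded length, so the measure has entropy at most s.  Some
   invariant measure on X, a limit of the frequencies of subwords in long words
   of the language, has entropy h.  It is a mixture of its conditionings on
   X_seq and on the complement of X_seq, and entropy is affine, so the latter
   has entropy b > s.  Then no potential of norm at most (b - s) / 2 has strict
   full sequential pressure, against 0 in FSSP(X).  So K(s) > 1 for
   all s in [0, h[.

   With s = j ln (1 + 1/k) this lower bound, and the upper bound obtained by
   counting the words of the language of one length, compare integers, and a
   machine can search for the j for which both are confirmed.

   The measurability of X_seq is an instance of the theorem of Lusin and Souslin
   on injective continuous images. *)

Require Import Defs.
From HB Require Import structures.
From mathcomp Require Import all_boot all_order all_algebra.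
From mathcomp Require Import all_classical all_reals all_analysis.
From mathcomp Require Import ring lra zify.

Set Implicit Arguments.
Unset Strict Implicit.
Unset Printing Implicit Defensive.

Import Order.TTheory GRing.Theory Num.Theory.
Import numFieldNormedType.Exports.

(** * Compiling counter programs into oracle machines *)

(** The machine is chosen knowing whether h = 0 and knowing an integer [B] above max(2, h); only the
    approximation of h is left to the oracles. For h = 0 a constant machine serves, as an empty [G]
    would leave the search without end. For h > 0 the step is ln (1 + 1/k) with k = B 2^n: its
    exponential is rational, which is why both bounds compare integers. The upper test allows j + 2
    steps while h <= (j + 1) steps; the spare room absorbs the strictness of the limit defining h
    and the factor by which the size of an oracle answer exceeds the number of words.

    The measure of entropy h is built from numbers: a cluster point of word frequencies in a compact
    product of intervals gives consistent cylinder masses, and Lebesgue measure on [0, 1[, cut into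
    nested intervals of these lengths, is transported to the shift. That entropy is affine is used
    for block entropies only: the entropy of a mixture exceeds the weighted mean by at most that of
    one coin toss, which vanishes after division by the length. *)

Section Compiler.
Variable A : eqType.
Local Notation sym := (symbol A void).

Variant tape_name : Type := Io | Ora | Reg of nat.

(* [Rep tau f c] reads a symbol of the tape [tau], writes and moves as told by
   [f] and then, if the boolean in the value of [f] is [true], runs [c] and
   starts again. *)
Inductive cmd : Type :=
| Skip
| Do of tape_name & (sym -> sym * move)
| Ask of oracle_name
| Seq of cmd & cmd
| Rep of tape_name & (sym -> sym * move * bool) & cmd.

(** Flat code: every instruction gives its successor line, so that line numbers can serve as states
    of the machine. *)
Inductive instr : Type :=
| Act of tape_name & (sym -> sym * move * nat)
| Query_instr of oracle_name & nat
| Stop.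

Fixpoint csize (c : cmd) : nat :=
  match c with
  | Skip => 0
  | Do _ _ | Ask _ => 1
  | Seq c1 c2 => csize c1 + csize c2
  | Rep _ _ c => (csize c).+2
  end.

(** Jumps are absolute, hence the starting line [p]. The body of a loop ends with an idle action on
    [Io] that jumps back to the test at [p]. *)
Fixpoint compile (c : cmd) (p : nat) : seq instr :=
  match c with
  | Skip => [::]
  | Do tau f => [:: Act tau (fun x => (f x, p.+1))]
  | Ask o => [:: Query_instr o p.+1]
  | Seq c1 c2 => compile c1 p ++ compile c2 (p + csize c1)
  | Rep tau f c =>
      Act tau (fun x => ((f x).1, if (f x).2 then p.+1 else p + (csize c).+2))
      :: compile c p.+1 ++ [:: Act Io (fun x => (x, Stay, p))]
  end.

Lemma size_compile c p : size (compile c p) = csize c.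
Proof.
elim: c p => //= [c1 IH1 c2 IH2 p|tau f c IH p]; first by rewrite size_cat IH1 IH2.
by rewrite size_cat IH addn1.
Qed.

Definition reg_bound (tau : tape_name) : nat := if tau is Reg r then r.+1 else 0.

Fixpoint cwidth (c : cmd) : nat :=
  match c with
  | Skip | Ask _ => 0
  | Do tau _ => reg_bound tau
  | Seq c1 c2 => maxn (cwidth c1) (cwidth c2)
  | Rep tau _ c => maxn (reg_bound tau) (cwidth c)
  end.

Section MachineOf.
Variables (P : seq instr) (K : nat).

Definition tape_index (tau : tape_name) : 'I_K.+2 :=
  match tau with Io => ord0 | Ora => ord_max | Reg r => inord r.+1 end.

Local Notation st := (option 'I_(size P).+1).

(** There is one line more than instructions, so the exit line [size P] is a genuine state, at which
    [nth Stop] reads a halt. *)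
Definition at_line (p : nat) : st := Some (inord p).

Definition mode_at (q : st) : mode st :=
  if q is Some p then
    match nth Stop P p with
    | Act _ _ => Running
    | Query_instr o p' => Query o (at_line p')
    | Stop => Halted
    end
  else Running.

(* The initial state [None] marks the zero cell of every counter tape. *)
Definition transition_at (q : st) (a : {ffun 'I_K.+2 -> sym}) :
    st * {ffun 'I_K.+2 -> sym * move} :=
  if q is Some p then
    if nth Stop P p is Act tau f then
      let: (s, m, p') := f (a (tape_index tau)) in
      (at_line p', [ffun j => if j == tape_index tau then (s, m) else (a j, Stay)])
    else (q, [ffun j => (a j, Stay)])
  else (at_line 0, [ffun j => (if (j == ord0) || (j == ord_max) then a j else Sep, Stay)]).

Definition machine_of : oracle_machine A :=
  @OracleMachine A void st K None mode_at transition_at.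

End MachineOf.

(** Cells are compared instead of lists, because writing and moving leave varying numbers of
    explicit blanks. *)
Definition tape_eq (t t' : tape sym) : Prop :=
  (nth Blank (before t) =1 nth Blank (before t')) /\
  (nth Blank (after t) =1 nth Blank (after t')).

Lemma tape_eq_trans t t' t'' : tape_eq t t' -> tape_eq t' t'' -> tape_eq t t''.
Proof. by case=> h1 h2 [h3 h4]; split=> i; rewrite ?h1 ?h2 ?h3 ?h4. Qed.

Lemma scannedE (t : tape sym) : scanned t = nth Blank (after t) 0.
Proof. by rewrite /scanned; case: (after t). Qed.

Lemma write_move_eq s m t t' : tape_eq t t' ->
  tape_eq (write_move s m t) (write_move s m t').
Proof.
case=> hb ha; case: m; split=> -[|i] //=; rewrite ?nth_behead ?hb ?ha //.
  by have := hb 0; rewrite -!nth0.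
by case: i => [|i] //=; rewrite ?nth_behead ?ha.
Qed.

Lemma write_scanned (t : tape sym) : tape_eq (write_move (scanned t) Stay t) t.
Proof. by split=> -[|i] //=; rewrite ?nth_behead // /scanned -nth0. Qed.

(* A counter is stored as the position of the head, the only nonblank cell of
   its tape being the one at position 0. *)
Record store : Type := Store { regs : nat -> nat; io : seq sym; ora : seq sym }.

Definition counter_tape (v : nat) : tape sym :=
  if v is v'.+1 then Tape (rcons (nseq v' Blank) Sep) [::] else Tape [::] [:: Sep].

Definition view (s : store) (tau : tape_name) : tape sym :=
  match tau with
  | Io => Tape [::] (io s)
  | Ora => Tape [::] (ora s)
  | Reg r => counter_tape (regs s r)
  end.

Definition represents K (s : store) (t : {ffun 'I_K.+2 -> tape sym}) : Prop :=
  forall tau, reg_bound tau <= K -> tape_eq (t (tape_index K tau)) (view s tau).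

Definition writes (tau : tape_name) (a : sym * move) (s s' : store) : Prop :=
  tape_eq (write_move a.1 a.2 (view s tau)) (view s' tau) /\
  forall tau', tau' <> tau -> view s' tau' = view s tau'.

Lemma tape_index_inj K tau tau' : reg_bound tau <= K -> reg_bound tau' <= K ->
  tape_index K tau = tape_index K tau' -> tau = tau'.
Proof.
case: tau => [||r]; case: tau' => [||r'] //= h h' /(congr1 val) /=; rewrite ?inordK //; try lia.
by case=> ->.
Qed.

Section Run.
Variables (OL OG : nat -> seq (seq A)).

Definition reach P K (p : nat) (s : store) (p' : nat) (s' : store) : Prop :=
  forall t, represents (K := K) s t -> exists k t',
    iter k (@step A (machine_of P K) OL OG) (at_line P p, t) = (at_line P p', t') /\
    represents (K := K) s' t'.

Lemma reach_refl P K p s : reach P K p s p s.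
Proof. by move=> t h; exists 0, t. Qed.

Lemma reach_trans P K p s p' s' p'' s'' :
  reach P K p s p' s' -> reach P K p' s' p'' s'' -> reach P K p s p'' s''.
Proof.
move=> h1 h2 t /h1 [k [t' [e /h2 [k' [t'' [e' h]]]]]].
by exists (k' + k), t''; rewrite iterD e.
Qed.

Lemma reach_act P K p tau f s s' : p <= size P -> reg_bound tau <= K ->
  nth Stop P p = Act tau f -> writes tau (f (scanned (view s tau))).1 s s' ->
  reach P K p s (f (scanned (view s tau))).2 s'.
Proof.
move=> pP tK eP [w1 w2] t rep; exists 1; rewrite /=.
have e0 : scanned (t (tape_index K tau)) = scanned (view s tau).
  by rewrite !scannedE; case: (rep _ tK).
rewrite inordK // eP; set y := (X in f X).
have -> : y = scanned (view s tau) by rewrite -e0 /y; apply: (ffunE _ (tape_index K tau)).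
case E : (f (scanned (view s tau))) w1 => [[x m] p'] /= w1.
eexists; split; first by [].
move=> tau' tK'; rewrite !ffunE.
have [e|ne] := eqVneq.
  have -> : tau' = tau by exact: tape_index_inj e.
  by apply: tape_eq_trans w1; apply: write_move_eq; apply: rep.
rewrite /= w2; last by move=> e; rewrite e eqxx in ne.
exact: tape_eq_trans (write_scanned _) (rep _ tK').
Qed.

Lemma find_not_one (a : seq sym) n : (forall i, i < n -> is_one (nth Blank a i)) ->
  ~~ is_one (nth Blank a n) -> find (predC (@is_one A void)) a = n.
Proof.
elim: n a => [|n IH] [|x a] //= h1 h2; first by rewrite h2.
  by have := h1 0 isT.
rewrite (h1 0 isT) /= IH // => i; exact: (h1 i.+1).
Qed.

Local Notation answer := (@oracle_answer A OL OG).

Lemma reach_query P K p o p' f b n : p <= size P ->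
  nth Stop P p = Query_instr o p' ->
  reach P K p (Store f b (nseq n One)) p' (Store f b (code_words (answer o n))).
Proof.
move=> pP eP t rep; exists 1; rewrite /= inordK // eP.
eexists; split; first by [].
move=> tau tK; rewrite ffunE.
have [e|ne] := eqVneq.
  have -> : tau = Ora by apply: (@tape_index_inj K).
  rewrite /= /read_unary (@find_not_one _ n) /=; first by case: o {eP}.
    move=> i ni; have [_ ->] := rep Ora isT; by rewrite /= nth_nseq ni.
  have [_ ->] := rep Ora isT; by rewrite /= nth_nseq ltnn.
by have := rep _ tK; case: tau tK ne => //=; rewrite eqxx.
Qed.

(** Quantifying over the surrounding code and over every sufficient width [K] lets these triples
    compose. *)
Definition does (c : cmd) (s s' : store) : Prop :=
  forall P K pre post, P = pre ++ compile c (size pre) ++ post -> cwidth c <= K ->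
    reach P K (size pre) s (size pre + csize c) s'.

Lemma does_skip s : does Skip s s.
Proof. by move=> P K pre post _ _; rewrite addn0; apply: reach_refl. Qed.

Lemma does_seq c1 c2 s1 s2 s3 : does c1 s1 s2 -> does c2 s2 s3 -> does (Seq c1 c2) s1 s3.
Proof.
move=> h1 h2 P K pre post eP; rewrite /= geq_max => /andP[k1 k2].
apply: reach_trans (h1 P K pre (compile c2 (size pre + csize c1) ++ post) _ k1) _.
  by rewrite eP /= -catA.
have := h2 P K (pre ++ compile c1 (size pre)) post.
rewrite size_cat size_compile addnA; apply=> //.
by rewrite eP /= -!catA.
Qed.

Lemma does_ask o f b n :
  does (Ask o) (Store f b (nseq n One)) (Store f b (code_words (answer o n))).
Proof.
move=> P K pre post eP _; rewrite addn1; apply: reach_query.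
  by rewrite eP size_cat; lia.
by rewrite eP nth_cat ltnn subnn.
Qed.

Lemma does_do tau f s s' : writes tau (f (scanned (view s tau))) s s' ->
  does (Do tau f) s s'.
Proof.
move=> w P K pre post eP /= tK; rewrite addn1.
apply: (@reach_act P K _ tau (fun x => (f x, (size pre).+1))) => //.
  by rewrite eP size_cat; lia.
by rewrite eP nth_cat ltnn subnn.
Qed.

Lemma does_rep_stop tau f c s s' : (f (scanned (view s tau))).2 = false ->
  writes tau (f (scanned (view s tau))).1 s s' -> does (Rep tau f c) s s'.
Proof.
move=> e w P K pre post eP /=; rewrite geq_max => /andP[tK _].
set g := fun x => ((f x).1, if (f x).2 then (size pre).+1 else size pre + (csize c).+2).
have -> : size pre + (csize c).+2 = (g (scanned (view s tau))).2 by rewrite /g e.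
apply: reach_act => //; first by rewrite eP size_cat; lia.
by rewrite eP nth_cat ltnn subnn.
Qed.

Lemma writes_nothing tau s : writes tau (scanned (view s tau), Stay) s s.
Proof. by split=> //; apply: write_scanned. Qed.

Lemma does_rep_go tau f c s s1 s2 s3 : (f (scanned (view s tau))).2 = true ->
  writes tau (f (scanned (view s tau))).1 s s1 -> does c s1 s2 ->
  does (Rep tau f c) s2 s3 -> does (Rep tau f c) s s3.
Proof.
move=> e w h1 h2 P K pre post eP k; have := h2 P K pre post eP k.
move: k => /=; rewrite geq_max => /andP[tK cK]; apply: reach_trans.
set g := fun x => ((f x).1, if (f x).2 then (size pre).+1 else size pre + (csize c).+2).
set j := Act Io (fun x => (x, Stay, size pre)).
have eP' : P = (pre ++ [:: Act tau g]) ++ compile c (size pre).+1 ++ j :: post.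
  by rewrite eP /= -!catA.
apply: (@reach_trans P K _ _ (size pre).+1 s1).
  have -> : (size pre).+1 = (g (scanned (view s tau))).2 by rewrite /g e.
  apply: reach_act => //; first by rewrite eP size_cat; lia.
  by rewrite eP nth_cat ltnn subnn.
apply: (@reach_trans P K _ _ ((size pre).+1 + csize c) s2).
  have := h1 P K (pre ++ [:: Act tau g]) (j :: post).
  by rewrite size_cat addn1; apply.
apply: (@reach_act P K _ Io (fun x => (x, Stay, size pre))) => //.
- by rewrite eP' !size_cat size_compile /=; lia.
- rewrite eP' nth_cat size_cat /= ifF; last lia.
  rewrite nth_cat size_compile ifF; last lia.
  by rewrite (_ : _ - _ - _ = 0) //; lia.
- exact: writes_nothing.
Qed.

End Run.
End Compiler.

(** * Counters, stacks and word reading on the tapes *)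

Section Commands.
Variable A : eqType.
Local Notation sym := (symbol A void).
Local Notation cmd := (cmd A).
Variables (OL OG : nat -> seq (seq A)).
Local Notation does := (@does A OL OG).
Local Notation answer := (@oracle_answer A OL OG).

Definition upd (f : nat -> nat) (r v : nat) : nat -> nat :=
  fun i => if i == r then v else f i.

Definition inc (r : nat) : cmd := Do (Reg r) (fun x => (x, MoveRight)).

Definition dec (r : nat) : cmd :=
  Do (Reg r) (fun x => (x, if x is Sep then Stay else MoveLeft)).

(** The mark [Sep] is scanned exactly when the counter is 0; otherwise the counter is decremented
    before the body runs. *)
Definition loop (r : nat) (c : cmd) : cmd :=
  Rep (Reg r) (fun x => if x is Sep then (x, Stay, false) else (x, MoveLeft, true)) c.

Definition whilez (r : nat) (c : cmd) : cmd :=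
  Rep (Reg r) (fun x => (x, Stay, if x is Sep then true else false)) c.

Definition stack (b : bool) : tape_name := if b then Io else Ora.

(** Both stacks grow leftwards with the top under the head, since outputs and queries are read from
    the head rightwards. *)
Definition push (b : bool) (s : sym) : cmd :=
  Seq (Do (stack b) (fun x => (x, MoveLeft))) (Do (stack b) (fun _ => (s, Stay))).

Definition flush (b : bool) (c : cmd) : cmd :=
  Rep (stack b) (fun x => if x is Blank then (x, Stay, false)
                          else (Blank, MoveRight, true)) c.

(** Consumes one word with its separator, running [c] once per letter. On an exhausted answer it
    stops at a blank, so that a missing word counts as empty. *)
Definition read_word (c : cmd) : cmd :=
  Rep Ora (fun x => match x with
                    | Letter _ => (Blank, MoveRight, true)
                    | Sep => (Blank, MoveRight, false)
                    | _ => (x, Stay, false)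
                    end) c.

Definition stack_store (b : bool) f (w o : seq sym) : store A :=
  if b then Store f w o else Store f o w.

Lemma writes_reg r a f g w o :
  tape_eq (write_move a.1 a.2 (counter_tape A (f r))) (counter_tape A (g r)) ->
  (forall i, i <> r -> g i = f i) ->
  writes (Reg r) a (Store f w o) (Store g w o).
Proof.
move=> h1 h2; split=> //; case=> //= i ne; rewrite h2 // => e.
by apply: ne; rewrite e.
Qed.

Lemma writes_stack b a f w w' o :
  tape_eq (write_move a.1 a.2 (Tape [::] w)) (Tape [::] w') ->
  writes (stack b) a (stack_store b f w o) (stack_store b f w' o).
Proof. by move=> h; case: b; split=> //; case=> // h'; case: h'. Qed.

Lemma scanned_counter v :
  scanned (counter_tape A v) = if v is _.+1 then Blank else Sep.
Proof. by case: v. Qed.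

Lemma counter_left v :
  tape_eq (write_move Blank MoveLeft (counter_tape A v.+1)) (counter_tape A v).
Proof.
by case: v => [|v]; split=> //= -[|[|i]] //=; rewrite nth_nil.
Qed.

Lemma does_inc r f w o :
  does (inc r) (Store f w o) (Store (upd f r (f r).+1) w o).
Proof.
apply: does_do; apply: writes_reg => [|i ne] /=; last by rewrite /upd; case: eqP.
by rewrite /upd eqxx; case: (f r) => [|v]; split.
Qed.

Lemma does_dec r f w o :
  does (dec r) (Store f w o) (Store (upd f r (f r).-1) w o).
Proof.
apply: does_do; apply: writes_reg => [|i ne] /=; last by rewrite /upd; case: eqP.
rewrite scanned_counter /upd eqxx; case E : (f r) => [|v] //=.
exact: counter_left.
Qed.

(** [F k] is the register file when [k] turns remain; the body starts after the counter has gone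
    from [k.+1] to [k]. *)
Lemma does_loop r c (F : nat -> nat -> nat) w o (n : nat) :
  (forall k, k <= n -> F k r = k) ->
  (forall k, k < n -> does c (Store (upd (F k.+1) r k) w o) (Store (F k) w o)) ->
  does (loop r c) (Store (F n) w o) (Store (F 0) w o).
Proof.
elim: n => [|n IH] hr hc.
  have E : scanned (view (Store (F 0) w o) (Reg r)) = Sep by rewrite /= hr.
  apply: does_rep_stop; rewrite E //; apply: writes_reg => //.
  by rewrite hr //; split=> -[].
apply: (does_rep_go (s1 := Store (upd (F n.+1) r n) w o) (s2 := Store (F n) w o)).
- by rewrite /= hr.
- rewrite /= hr //; apply: writes_reg => [|i ne]; last by rewrite /upd; case: eqP.
  by rewrite /upd eqxx hr //; apply: counter_left.
- exact: hc.
- by apply: IH => k kn; [apply: hr|apply: hc]; lia.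
Qed.

Lemma does_whilez r c (F : nat -> nat -> nat) w o (n : nat) :
  (forall k, k < n -> F k r = 0) -> F n r != 0 ->
  (forall k, k < n -> does c (Store (F k) w o) (Store (F k.+1) w o)) ->
  does (whilez r c) (Store (F 0) w o) (Store (F n) w o).
Proof.
elim: n F => [|n IH] F h0 hn hc.
  apply: does_rep_stop; first by rewrite /= scanned_counter; case: (F 0 r) hn.
  exact: writes_nothing.
apply: (does_rep_go (s1 := Store (F 0) w o) (s2 := Store (F 1) w o)).
- by rewrite /= h0.
- exact: writes_nothing.
- exact: hc.
- by apply: (IH (fun k => F k.+1)) => // k kn; [apply: h0|apply: hc].
Qed.

Lemma does_push b s f w o :
  does (push b s) (stack_store b f w o) (stack_store b f (s :: w) o).
Proof.
apply: (does_seq (s2 := stack_store b f (Blank :: w) o)); apply: does_do;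
  apply: writes_stack; split=> //=.
case: b => -[|[|i]] //=; rewrite /scanned /= ?nth_behead //; by case: w.
Qed.

Lemma does_flush b c (F : nat -> nat -> nat) w o :
  (forall i, i < size w -> nth Blank w i <> Blank) ->
  (forall k w', does c (stack_store b (F k) w' o) (stack_store b (F k.+1) w' o)) ->
  does (flush b c) (stack_store b (F 0) w o) (stack_store b (F (size w)) [::] o).
Proof.
elim: w F => [|x w IH] F hw hc.
  by apply: does_rep_stop; case: (b) => //=; apply: writes_nothing.
have nx : x <> Blank by apply: (hw 0).
have E : scanned (view (stack_store b (F 0) (x :: w) o) (stack b)) = x by case: (b).
apply: (does_rep_go (s1 := stack_store b (F 0) w o) (s2 := stack_store b (F 1) w o)).
- by rewrite E; case: x {hw E} nx.
- rewrite E; apply: writes_stack.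
  by case: x {hw E} nx => //= *; split=> -[|[|i]].
- exact: hc.
- by apply: (IH (fun k => F k.+1)) => // i iw; apply: (hw i.+1).
Qed.

Lemma does_read_word c (F : nat -> nat -> nat) a w ws :
  (forall k o, does c (Store (F k) a o) (Store (F k.+1) a o)) ->
  does (read_word c) (Store (F 0) a (code_words (w :: ws)))
       (Store (F (size w)) a (code_words ws)).
Proof.
elim: w F => [|x w IH] F hc.
  apply: does_rep_stop => //.
  apply: (writes_stack false); by split=> -[|[|i]].
apply: (does_rep_go (s1 := Store (F 0) a (code_words (w :: ws)))
                    (s2 := Store (F 1) a (code_words (w :: ws)))) => //.
- by apply: (writes_stack false); by split=> -[|[|i]].
- exact: (IH (fun k => F k.+1)).
Qed.

Lemma does_read_word_nil c f a :
  does (read_word c) (Store f a [::]) (Store f a [::]).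
Proof. by apply: does_rep_stop => //; apply: writes_nothing. Qed.

Lemma code_words_not_blank (ws : seq (seq A)) i : i < size (code_words (W := void) ws) ->
  nth Blank (code_words (W := void) ws) i <> Blank.
Proof.
elim: ws i => [|w ws IH] i //=.
rewrite /code_words /= size_cat nth_cat => h.
case: ltnP => [lt|le]; last by apply: IH; rewrite /code_words; lia.
rewrite nth_rcons size_map; case: ltnP => [lt'|le'].
  case: w lt' {h lt} => // a w lt'; by rewrite (nth_map a).
by case: eqP => // ne; move: lt; rewrite size_rcons size_map; lia.
Qed.

End Commands.

(** * Functions of the oracle answers computed by programs *)

Ltac upd_ext := apply/funext => ?; rewrite /upd; do ![case: eqP => ?]; subst; lia.

Section Programs.
Variable A : eqType.
Local Notation sym := (symbol A void).
Local Notation cmd := (cmd A).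
Variables (OL OG : nat -> seq (seq A)).
Local Notation does := (@does A OL OG).
Local Notation answer := (@oracle_answer A OL OG).
Local Notation Skip := (@Skip A).
Local Notation inc := (@inc A).
Implicit Types (f g : nat -> nat) (t : nat -> cmd) (phi : (nat -> nat) -> nat).

(** Values that ignore the scratch registers, so that evaluating one subterm does not disturb
    another. *)
Definition local (d0 : nat) phi : Prop :=
  forall f g, (forall r, r < d0 -> f r = g r) -> phi f = phi g.

(* [t d] leaves the value of [phi] in register [d], the registers from [d] on
   being free. *)
Definition computes (d0 : nat) t phi : Prop := local d0 phi /\
  forall d f w, d0 <= d -> (forall r, d <= r -> f r = 0) ->
    does (t d) (Store f w [::]) (Store (upd f d (phi f)) w [::]).

Lemma upd_id f d v : f d = v -> upd f d v = f.
Proof. by move=> e; apply/funext => i; rewrite /upd; case: eqP => // ->. Qed.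

Lemma local_upd d0 phi d f v : local d0 phi -> d0 <= d -> phi (upd f d v) = phi f.
Proof. by move=> h dd; apply: h => r rd; rewrite /upd; case: eqP => // e; lia. Qed.

Lemma does_move a b f w o : a != b ->
  does (loop a (inc b)) (Store f w o) (Store (upd (upd f b (f b + f a)) a 0) w o).
Proof.
move=> ab; pose F k := upd (upd f b (f b + (f a - k))) a k.
have -> : f = F (f a) by rewrite /F subnn; upd_ext.
have -> : upd (upd (F (f a)) b (F (f a) b + F (f a) a)) a 0 = F 0.
  by rewrite /F; upd_ext.
apply: does_loop => k kn; first by rewrite /F /upd eqxx.
set s := upd (F k.+1) a k.
have -> : F k = upd s b (s b).+1 by rewrite /s /F; upd_ext.
exact: does_inc.
Qed.

Lemma does_clear a f w o :
  does (loop a Skip) (Store f w o) (Store (upd f a 0) w o).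
Proof.
pose F k := upd f a k.
have -> : Store f w o = Store (F (f a)) w o by rewrite /F upd_id.
rewrite -/(F 0); apply: does_loop => k kn; first by rewrite /F /upd eqxx.
have -> : upd (F k.+1) a k = F k by rewrite /F; upd_ext.
exact: does_skip.
Qed.

(** Reading a counter empties it: it is moved into both [d] and [d.+1], then restored from the
    second copy. *)
Definition t_var (i : nat) : nat -> cmd := fun d =>
  Seq (loop i (Seq (inc d) (inc d.+1))) (loop d.+1 (inc i)).

Lemma computes_var d0 i : i < d0 -> computes d0 (t_var i) (fun f => f i).
Proof.
move=> id0; split=> [f g|d f w dd fz]; first exact.
pose F k := upd (upd (upd f i k) d (f i - k)) d.+1 (f i - k).
have fd := fz d (leqnn _); have fd1 := fz d.+1 (leqnSn _).
apply: (does_seq (s2 := Store (F 0) w [::])).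
  have -> : Store f w [::] = Store (F (f i)) w [::].
    by congr Store; rewrite /F subnn; upd_ext.
  apply: does_loop => k kn; first by rewrite /F /upd; do ![case: eqP => ?]; lia.
  set s := upd (F k.+1) i k.
  apply: (does_seq (s2 := Store (upd s d (s d).+1) w [::])); first exact: does_inc.
  set s' := upd s _ _.
  have -> : F k = upd s' d.+1 (s' d.+1).+1 by rewrite /s' /s /F; upd_ext.
  exact: does_inc.
have -> : upd f d (f i) = upd (upd (F 0) i (F 0 i + F 0 d.+1)) d.+1 0.
  by rewrite /F; upd_ext.
by apply: does_move; lia.
Qed.

Definition t_zero : nat -> cmd := fun _ => Skip.

Lemma computes_zero d0 : computes d0 t_zero (fun=> 0).
Proof.
split=> [//|d f w dd fz]; rewrite upd_id ?fz //; exact: does_skip.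
Qed.

Definition t_succ t : nat -> cmd := fun d => Seq (t d) (inc d).

Lemma computes_succ d0 t phi : computes d0 t phi ->
  computes d0 (t_succ t) (fun f => (phi f).+1).
Proof.
move=> [h1 h2]; split=> [f g /h1 -> //|d f w dd fz].
apply: does_seq (h2 _ _ _ dd fz) _.
set s := upd _ _ _; have -> : upd f d (phi f).+1 = upd s d (s d).+1.
  by rewrite /s; upd_ext.
exact: does_inc.
Qed.

Definition t_pred t : nat -> cmd := fun d => Seq (t d) (dec A d).

Lemma computes_pred d0 t phi : computes d0 t phi ->
  computes d0 (t_pred t) (fun f => (phi f).-1).
Proof.
move=> [h1 h2]; split=> [f g /h1 -> //|d f w dd fz].
apply: does_seq (h2 _ _ _ dd fz) _.
set s := upd _ _ _; have -> : upd f d (phi f).-1 = upd s d (s d).-1.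
  by rewrite /s; upd_ext.
exact: does_dec.
Qed.

(** Primitive recursion with the index running from [N.-1] down to 0, the order in which a loop
    consumes its counter. *)
Fixpoint downto (F : nat -> nat -> nat) (N acc : nat) : nat :=
  if N is N'.+1 then downto F N' (F N' acc) else acc.

(** Register [d] holds the index, [d.+1] the accumulator, and [d.+2] receives the next value before
    it replaces the old one. *)
Definition t_rec (tn tb : nat -> cmd) (ts : nat -> nat -> cmd) : nat -> cmd := fun d =>
  Seq (tn d) (Seq (tb d.+1)
    (Seq (loop d (Seq (ts d d.+2) (Seq (loop d.+1 Skip) (loop d.+2 (inc d.+1)))))
         (loop d.+1 (inc d)))).

Lemma computes_rec d0 tn tb ts phin phib (psi : (nat -> nat) -> nat -> nat -> nat) :
  computes d0 tn phin -> computes d0 tb phib ->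
  (forall k a, local d0 (fun f => psi f k a)) ->
  (forall i, d0 <= i -> computes i.+2 (ts i) (fun f => psi f (f i) (f i.+1))) ->
  computes d0 (t_rec tn tb ts) (fun f => downto (psi f) (phin f) (phib f)).
Proof.
move=> [ln hn] [lb hb] ls hs; split=> [f g fg|d f w dd fz].
  rewrite (ln _ _ fg) (lb _ _ fg).
  have -> // : psi f = psi g.
  by apply/funext => k; apply/funext => a; apply: ls.
have fd := fz d (leqnn _); have fd1 := fz d.+1 (leqnSn _).
have fd2 : f d.+2 = 0 by apply: fz; lia.
apply: does_seq (hn _ _ _ dd fz) _.
set f1 := upd f d _.
have f1z r : d.+1 <= r -> f1 r = 0.
  by move=> dr; rewrite /f1 /upd ifF; [apply: fz|]; lia.
have h := hb d.+1 f1 w (leqW dd) f1z.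
apply: does_seq h _.
rewrite [phib f1](local_upd _ _ lb) //.
set N := phin f; set a0 := phib f.
(* [downto] unfolds at its first step, of largest index; the loop invariant needs its last one, of
   least index. *)
have shift k n a : downto (fun k' a => psi f (k + k') a) n.+1 a =
    psi f k (downto (fun k' a => psi f (k.+1 + k') a) n a).
  elim: n a => [|n IH] a; first by rewrite /= addn0.
  by rewrite -[LHS]/(downto _ n.+1 _) IH /= addnS.
pose acc k := downto (fun k' a => psi f (k + k') a) (N - k) a0.
have accS k : k < N -> acc k = psi f k (acc k.+1).
  rewrite /acc => kN; have -> : N - k = (N - k.+1).+1 by lia.
  exact: shift.
pose F k := upd (upd f d k) d.+1 (acc k).
apply: (does_seq (s2 := Store (F 0) w [::])).
  have -> : upd f1 d.+1 a0 = F N by rewrite /F /acc subnn /= /f1.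
  apply: does_loop => k kN; first by rewrite /F /upd; do ![case: eqP => ?]; lia.
  set s := upd (F k.+1) d k.
  have sz r : d.+2 <= r -> s r = 0.
    by move=> dr; rewrite /s /F /upd !ifF; [apply: fz| | |]; lia.
  apply: does_seq ((hs _ dd).2 d.+2 s w (leqnn _) sz) _.
  have -> : psi s (s d) (s d.+1) = acc k.
    rewrite accS // (ls _ _ s f); last first.
      by move=> r rd; rewrite /s /F /upd !ifF //; lia.
    congr psi; rewrite /s /F /upd; do ![case: eqP => ?]; subst; try lia.
  apply: (does_seq (s2 := Store (upd (upd s d.+2 (acc k)) d.+1 0) w [::])).
    exact: does_clear.
  set s' := upd (upd s d.+2 _) _ _.
  have -> : F k = upd (upd s' d.+1 (s' d.+1 + s' d.+2)) d.+2 0.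
    rewrite /s' /s /F; upd_ext.
  by apply: does_move; lia.
have -> : upd f d (downto (psi f) N a0) = upd (upd (F 0) d (F 0 d + F 0 d.+1)) d.+1 0.
  have -> : downto (psi f) N a0 = acc 0 by rewrite /acc subn0.
  rewrite /F; upd_ext.
by apply: does_move; lia.
Qed.

Definition total_size (ws : seq (seq A)) : nat := sumn [seq (size w).+1 | w <- ws].

Lemma size_code_words ws : size (code_words (W := void) ws) = total_size ws.
Proof.
rewrite /code_words /total_size; elim: ws => //= w ws IH.
by rewrite size_cat IH size_rcons size_map.
Qed.

Lemma does_write_ones b d f w o :
  does (loop d (push b One)) (stack_store b f w o)
       (stack_store b (upd f d 0) (nseq (f d) One ++ w) o).
Proof.
suff H n f' k : f' d = n -> does (loop d (push b One)) (stack_store b f' (nseq k One ++ w) o)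
    (stack_store b (upd f' d 0) (nseq (k + n) One ++ w) o) by apply: (H _ _ 0).
have wr a f1 f2 w' : tape_eq (write_move a.1 a.2 (counter_tape A (f1 d))) (counter_tape A (f2 d)) ->
    (forall i, i <> d -> f2 i = f1 i) ->
    writes (Reg d) a (stack_store b f1 w' o) (stack_store b f2 w' o).
  by move=> h1 h2; case: b; apply: writes_reg.
elim: n f' k => [|n IH] f' k e.
  have E v : scanned (view (stack_store b f' v o) (Reg d)) = Sep by case: (b); rewrite /= e.
  rewrite addn0 upd_id //; apply: does_rep_stop; rewrite E //.
  by apply: wr => //; rewrite e; split=> -[].
have E v : scanned (view (stack_store b f' v o) (Reg d)) = Blank by case: (b); rewrite /= e.
apply: (does_rep_go (s1 := stack_store b (upd f' d n) (nseq k One ++ w) o)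
                    (s2 := stack_store b (upd f' d n) (nseq k.+1 One ++ w) o)).
- by rewrite E.
- rewrite E; apply: wr => [|i ne]; last by rewrite /upd; case: eqP.
  by rewrite /upd eqxx e; apply: counter_left.
- exact: does_push.
- have -> : upd f' d 0 = upd (upd f' d n) d 0 by upd_ext.
  by rewrite addnS -addSn; apply: IH; rewrite /upd eqxx.
Qed.

Lemma does_write_query d f w : does (loop d (push false One)) (Store f w [::])
  (Store (upd f d 0) w (nseq (f d) One)).
Proof. by have := @does_write_ones false d f [::] w; rewrite cats0. Qed.

Definition t_total (o : oracle_name) t : nat -> cmd := fun d =>
  Seq (t d) (Seq (loop d (push false One)) (Seq (Ask A o) (flush false (inc d)))).

Lemma computes_total d0 o t phi : computes d0 t phi ->
  computes d0 (t_total o t) (fun f => total_size (answer o (phi f))).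
Proof.
move=> [h1 h2]; split=> [f g /h1 -> //|d f w dd fz].
apply: does_seq (h2 _ _ _ dd fz) _.
set f1 := upd _ _ _; set f2 := upd f1 d 0.
apply: (does_seq (s2 := Store f2 w (nseq (f1 d) One))); first exact: does_write_query.
have -> : f1 d = phi f by rewrite /f1 /upd eqxx.
apply: does_seq (@does_ask A OL OG _ _ _ _) _.
pose F k := upd f d k.
have -> : f2 = F 0 by rewrite /f2 /f1 /F; upd_ext.
rewrite -size_code_words.
apply: (does_flush (b := false)) => [|k w'] /=; first exact: code_words_not_blank.
have -> : F k.+1 = upd (F k) d (F k d).+1 by rewrite /F; upd_ext.
exact: does_inc.
Qed.

(** Skips words, measures the next one, and erases the rest so that the oracle tape is empty
    again. *)
Definition t_word (o : oracle_name) t ti : nat -> cmd := fun d =>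
  Seq (t d) (Seq (ti d.+1) (Seq (loop d (push false One)) (Seq (Ask A o)
    (Seq (loop d.+1 (read_word Skip)) (Seq (read_word (inc d)) (flush false Skip)))))).

Lemma computes_word d0 o t ti phi phii : computes d0 t phi -> computes d0 ti phii ->
  computes d0 (t_word o t ti)
    (fun f => size (nth [::] (answer o (phi f)) (phii f))).
Proof.
move=> [h1 h2] [h3 h4]; split=> [f g fg|d f w dd fz].
  by rewrite (h1 _ _ fg) (h3 _ _ fg).
apply: does_seq (h2 _ _ _ dd fz) _.
set f1 := upd _ _ _.
have f1z r : d.+1 <= r -> f1 r = 0.
  by move=> dr; rewrite /f1 /upd ifF; [apply: fz|]; lia.
apply: does_seq (h4 d.+1 f1 w (leqW dd) f1z) _.
rewrite [phii f1](local_upd _ _ h3) //.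
set f2 := upd f1 d.+1 _.
apply: (does_seq (s2 := Store (upd f2 d 0) w (nseq (f2 d) One))).
  exact: does_write_query.
rewrite /f2.
have -> : upd f1 d.+1 (phii f) d = phi f.
  by rewrite /f1 /upd; do ![case: eqP => ?]; lia.
apply: does_seq (@does_ask A OL OG _ _ _ _) _.
set ws := answer _ _; set i := phii f.
have fd := fz d (leqnn _); have fd1 := fz d.+1 (leqnSn _).
have -> : upd (upd f1 d.+1 i) d 0 = upd f d.+1 i by rewrite /f1; upd_ext.
apply: (does_seq (s2 := Store f w (code_words (drop i ws)))).
  elim: i ws => [|i IH] ws.
    have E : scanned (view (Store (upd f d.+1 0) w (code_words ws)) (Reg d.+1)) = Sep.
      by rewrite /= /upd eqxx.
    rewrite drop0; apply: does_rep_stop; rewrite E //.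
    by apply: writes_reg => [|r ne]; rewrite /upd ?fd1 ?eqxx; [split=> -[]|case: eqP].
  have E : scanned (view (Store (upd f d.+1 i.+1) w (code_words ws)) (Reg d.+1)) = Blank.
    by rewrite /= /upd eqxx.
  apply: (does_rep_go (s1 := Store (upd f d.+1 i) w (code_words ws))
                      (s2 := Store (upd f d.+1 i) w (code_words (behead ws)))).
  - by rewrite E.
  - rewrite E; apply: writes_reg => [|r ne]; last by rewrite /upd; case: eqP.
    by rewrite /upd !eqxx; apply: counter_left.
  - case: ws {IH E} => [|u ws]; first exact: does_read_word_nil.
    apply: (does_read_word (F := fun=> upd f d.+1 i)) => k o'; exact: does_skip.
  - have -> : drop i.+1 ws = drop i (behead ws) by case: ws {IH E}.
    exact: IH.
pose F k := upd f d k.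
have -> : Store f w (code_words (drop i ws)) = Store (F 0) w (code_words (drop i ws)).
  by rewrite /F upd_id.
apply: (does_seq (s2 := Store (F (size (nth [::] ws i))) w (code_words (drop i.+1 ws)))).
  case: (ltnP i (size ws)) => iws.
    rewrite (drop_nth [::] iws).
    apply: does_read_word => k o'.
    have -> : F k.+1 = upd (F k) d (F k d).+1 by rewrite /F; upd_ext.
    exact: does_inc.
  rewrite !drop_oversize ?nth_default //; last by lia.
  exact: does_read_word_nil.
set F' := F _.
apply: (does_flush (b := false) (F := fun=> F')) => [|k w'].
  exact: code_words_not_blank.
exact: does_skip.
Qed.

End Programs.

(** * Arithmetic and bounded search on counters *)

Section Arithmetic.
Variable A : eqType.
Variables (OL OG : nat -> seq (seq A)).
Local Notation computes := (@computes A OL OG).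
Implicit Types (f : nat -> nat) (t : nat -> cmd A) (phi : (nat -> nat) -> nat).

Lemma computes_widen d0 d1 t phi : d0 <= d1 -> computes d0 t phi -> computes d1 t phi.
Proof.
move=> dd [h1 h2]; split=> [f g fg|d f w d1d].
  by apply: h1 => r rd; apply: fg; lia.
by apply: h2; lia.
Qed.

Fixpoint t_const (n : nat) : nat -> cmd A :=
  if n is n'.+1 then t_succ (t_const n') else @t_zero A.

Lemma computes_const d0 n : computes d0 (t_const n) (fun=> n).
Proof. by elim: n => [|n IH]; [apply: computes_zero|apply: computes_succ IH]. Qed.

Definition t_add t1 t2 := t_rec t1 t2 (fun i => t_succ (t_var A i.+1)).

Lemma computes_add d0 t1 t2 phi1 phi2 : computes d0 t1 phi1 -> computes d0 t2 phi2 ->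
  computes d0 (t_add t1 t2) (fun f => phi1 f + phi2 f).
Proof.
move=> h1 h2.
have := computes_rec h1 h2 (psi := fun _ _ a => a.+1) (fun _ _ _ _ _ => erefl)
  (fun i _ => computes_succ (computes_var OL OG (ltnSn i.+1))).
have E N a : downto (fun _ a => a.+1) N a = N + a.
  by elim: N a => //= N IH a; rewrite IH; lia.
by under [X in computes _ _ X -> _]eq_fun do rewrite E.
Qed.

Definition t_mul t1 t2 :=
  t_rec t1 (@t_zero A) (fun i => t_add (t_var A i.+1) t2).

Lemma computes_mul d0 t1 t2 phi1 phi2 : computes d0 t1 phi1 -> computes d0 t2 phi2 ->
  computes d0 (t_mul t1 t2) (fun f => phi1 f * phi2 f).
Proof.
move=> h1 h2.
have hs i : d0 <= i -> computes i.+2 (t_add (t_var A i.+1) t2) (fun f => f i.+1 + phi2 f).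
  move=> di; apply: computes_add; first exact: computes_var.
  by apply: computes_widen h2; lia.
have := computes_rec h1 (computes_zero OL OG d0) (psi := fun f _ a => a + phi2 f)
  (fun _ _ f g fg => congr1 _ (h2.1 _ _ fg)) hs.
have E N v a : downto (fun _ a => a + v) N a = N * v + a.
  by elim: N a => //= N IH a; rewrite IH; lia.
by under [X in computes _ _ X -> _]eq_fun do rewrite E addn0.
Qed.

Definition t_exp t1 t2 :=
  t_rec t2 (t_const 1) (fun i => t_mul t1 (t_var A i.+1)).

Lemma computes_exp d0 t1 t2 phi1 phi2 : computes d0 t1 phi1 -> computes d0 t2 phi2 ->
  computes d0 (t_exp t1 t2) (fun f => phi1 f ^ phi2 f).
Proof.
move=> h1 h2.
have hs i : d0 <= i -> computes i.+2 (t_mul t1 (t_var A i.+1)) (fun f => phi1 f * f i.+1).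
  move=> di; apply: computes_mul; last exact: computes_var.
  by apply: computes_widen h1; lia.
have := computes_rec h2 (computes_const d0 1) (psi := fun f _ a => phi1 f * a)
  (fun _ a f g fg => congr1 (muln^~ a) (h1.1 _ _ fg)) hs.
have E N v a : downto (fun _ a => v * a) N a = v ^ N * a.
  by elim: N a => [|N IH] a /=; rewrite ?mul1n // IH expnSr mulnA.
by under [X in computes _ _ X -> _]eq_fun do rewrite E muln1.
Qed.

Definition t_sub t1 t2 := t_rec t2 t1 (fun i => t_pred (t_var A i.+1)).

Lemma computes_sub d0 t1 t2 phi1 phi2 : computes d0 t1 phi1 -> computes d0 t2 phi2 ->
  computes d0 (t_sub t1 t2) (fun f => phi1 f - phi2 f).
Proof.
move=> h1 h2.
have := computes_rec h2 h1 (psi := fun _ _ a => a.-1) (fun _ _ _ _ _ => erefl)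
  (fun i _ => computes_pred (computes_var OL OG (ltnSn i.+1))).
have E N a : downto (fun _ a => a.-1) N a = a - N.
  by elim: N a => [|N IH] a /=; rewrite ?subn0 // IH; lia.
by under [X in computes _ _ X -> _]eq_fun do rewrite E.
Qed.

Definition t_leq t1 t2 := t_sub (t_const 1) (t_sub t1 t2).

Lemma computes_leq d0 t1 t2 phi1 phi2 : computes d0 t1 phi1 -> computes d0 t2 phi2 ->
  computes d0 (t_leq t1 t2) (fun f => (phi1 f <= phi2 f : nat)).
Proof.
move=> h1 h2; have := computes_sub (computes_const d0 1) (computes_sub h1 h2).
have E m n : 1 - (m - n) = (m <= n) by lia.
by under [X in computes _ _ X -> _]eq_fun do rewrite E.
Qed.

Definition t_sum tn (tb : nat -> nat -> cmd A) :=
  t_rec tn (@t_zero A) (fun i => t_add (tb i) (t_var A i.+1)).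

Lemma computes_sum d0 tn tb phin (psi : (nat -> nat) -> nat -> nat) :
  computes d0 tn phin -> (forall k, local d0 (psi^~ k)) ->
  (forall i, d0 <= i -> computes i.+2 (tb i) (fun f => psi f (f i))) ->
  computes d0 (t_sum tn tb) (fun f => \sum_(k < phin f) psi f k).
Proof.
move=> h1 hl hb.
have hs i : d0 <= i ->
    computes i.+2 (t_add (tb i) (t_var A i.+1)) (fun f => psi f (f i) + f i.+1).
  by move=> di; apply: computes_add (hb _ di) _; apply: computes_var.
have := computes_rec h1 (computes_zero OL OG d0) (psi := fun f k a => psi f k + a)
  (fun k a f g fg => congr1 (addn^~ a) (hl _ _ _ fg)) hs.
have E F N a : downto (fun k a => F k + a) N a = \sum_(k < N) F k + a.
  elim: N a => [|N IH] a /=; first by rewrite big_ord0.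
  by rewrite IH big_ord_recr /= addnA.
by under [X in computes _ _ X -> _]eq_fun do rewrite E addn0.
Qed.

(** Indices are visited downwards and each success overwrites the accumulator, so the least success
    survives. *)
Definition t_search tn (tb : nat -> nat -> cmd A) :=
  t_rec tn (@t_zero A) (fun i => t_add (t_mul (tb i) (t_succ (t_var A i)))
    (t_mul (t_sub (t_const 1) (tb i)) (t_var A i.+1))).

(* The value is 1 + the least [j < phin f] such that [psi f j], or 0. *)
Lemma computes_search d0 tn tb phin (psi : (nat -> nat) -> nat -> bool) :
  computes d0 tn phin -> (forall k, local d0 (psi^~ k)) ->
  (forall i, d0 <= i -> computes i.+2 (tb i) (fun f => psi f (f i) : nat)) ->
  exists2 phi, computes d0 (t_search tn tb) phi &
    forall f, (forall v, phi f = v.+1 -> psi f v) /\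
              ((exists2 j, j < phin f & psi f j) -> phi f != 0).
Proof.
move=> h1 hl hb.
have hs i : d0 <= i -> computes i.+2
    (t_add (t_mul (tb i) (t_succ (t_var A i)))
      (t_mul (t_sub (t_const 1) (tb i)) (t_var A i.+1)))
    (fun f => psi f (f i) * (f i).+1 + (1 - psi f (f i)) * f i.+1).
  move=> di; have hi := hb _ di; apply: computes_add; apply: computes_mul => //.
  - by apply/computes_succ/computes_var.
  - by apply: computes_sub hi; apply: computes_const.
  - exact: computes_var.
have := computes_rec h1 (computes_zero OL OG d0)
  (psi := fun f j a => psi f j * j.+1 + (1 - psi f j) * a)
  (fun k a f g fg => congr1 (fun b : nat => b * k.+1 + (1 - b) * a) (hl _ _ _ fg)) hs.
move=> h; eexists; first exact: h.
move=> f; pose T : nat -> bool := psi f.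
pose F j a := T j * j.+1 + (1 - T j) * a.
have F0 N a : downto F N a = 0 -> a = 0 /\ forall j, j < N -> ~~ T j.
  elim: N a => [|N IH] a //= /IH [].
  rewrite /F -/T; case E : (T N) => /=; first by lia.
  rewrite mul0n mul1n add0n => -> hT; split=> // j; rewrite ltnS leq_eqVlt.
  by case/orP => [/eqP ->|/hT //]; rewrite E.
have F1 N a v : downto F N a = v.+1 -> a = v.+1 \/ T v.
  elim: N a => [|N IH] a /=; first by left.
  case/IH => [|->]; last by right.
  rewrite /F -/T; case E : (T N) => /=; last by rewrite mul0n mul1n; left.
  by rewrite mul1n mul0n addn0 => -[<-]; right.
split=> [v e | [j jN Tj]].
  by have /F1 [] : downto F (phin f) 0 = v.+1 := e.
apply/eqP => e; have /F0 : downto F (phin f) 0 = 0 := e.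
by move=> [_ /(_ _ jN)]; rewrite /T Tj.
Qed.

End Arithmetic.

Section Main.
Variable A : eqType.
Local Notation Store := (@Store A).
Local Notation sym := (symbol A void).

(** Register 0 receives n, 1 the search bound t, 2 the outcome of the test, 3 the denominator. The
    denominator is pushed first because the output is read from the top of the stack; the outcome is
    one more than the numerator. *)
Definition main (tT tK : nat -> cmd A) : cmd A :=
  Seq (flush true (inc A 0)) (Seq (tT 2) (Seq (whilez 2 (Seq (inc A 1) (tT 2)))
  (Seq (tK 3) (Seq (loop 3 (push true One)) (Seq (push true Sep)
  (Seq (dec A 2) (loop 2 (push true One)))))))).

Definition search_machine tT tK : oracle_machine A :=
  machine_of (compile (main tT tK) 0 ++ [:: @Stop A]) (cwidth (main tT tK)).

Definition env2 (n t : nat) : nat -> nat := upd (upd (fun=> 0) 0 n) 1 t.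

Lemma nth_blank_cat (a w : seq sym) : nth Blank a =1 nth Blank w ->
  size w <= size a -> a = w ++ nseq (size a - size w) Blank.
Proof.
move=> e le; apply: (@eq_from_nth _ Blank) => [|i ia].
  by rewrite size_cat size_nseq subnKC.
rewrite e nth_cat; case: ltnP => // wi.
by rewrite nth_nseq if_same nth_default.
Qed.

Theorem search_machine_outputs (tT tK : nat -> cmd A) OL OG phiT phiK n :
  computes OL OG 2 tT phiT -> computes OL OG 3 tK phiK ->
  (forall f, 0 < phiK f) -> (exists t, phiT (env2 n t) != 0) ->
  exists t v, phiT (env2 n t) = v.+1 /\
    outputs (search_machine tT tK) OL OG n
      (v%:R / (phiK (upd (env2 n t) 2 v.+1))%:R).
Proof.
move=> [lT hT] [lK hK] K0 exT; case: (ex_minnP exT) => t Tt tmin.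
exists t; case ET : (phiT (env2 n t)) Tt => [//|v] _; exists v; split=> //.
set q := phiK _.
pose F k := upd (env2 n k) 2 (phiT (env2 n k)).
have F0 k : k < t -> phiT (env2 n k) = 0.
  by move=> kt; apply/eqP/negPn/negP => /tmin; lia.
have e0 k r : 2 <= r -> env2 n k r = 0.
  by move=> hr; rewrite /env2 /upd; do ![case: eqP => ?]; lia.
have D : does OL OG (main tT tK) (Store (fun=> 0) (nseq n One) [::])
    (Store (upd (upd (F t) 2 0) 3 0) (nseq v One ++ Sep :: nseq q One) [::]).
  apply: (does_seq (s2 := Store (env2 n 0) [::] [::])).
    have -> : env2 n 0 = upd (fun=> 0) 0 (size (nseq n (@One A void))).
      rewrite size_nseq /env2; upd_ext.
    have {1}-> : (fun=> 0) = upd (fun=> 0) 0 0 by upd_ext.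
    apply: (@does_flush A OL OG true (inc A 0) (fun k => upd (fun=> 0) 0 k)) => [i|k w'].
      by rewrite size_nseq nth_nseq => ->.
    have -> : upd (fun=> 0) 0 k.+1 =
       upd (upd (fun=> 0) 0 k) 0 (upd (fun=> 0) 0 k 0).+1 by upd_ext.
    exact: does_inc.
  apply: (does_seq (s2 := Store (F 0) [::] [::])); first by apply: hT => // r; apply: e0.
  apply: (does_seq (s2 := Store (F t) [::] [::])).
    have F2 k : F k 2 = phiT (env2 n k) by rewrite /F /upd.
    apply: does_whilez => [k /F0 e||k kt]; first by rewrite F2.
      by rewrite F2 ET.
    have -> : F k = env2 n k by rewrite /F F0 // upd_id // e0.
    apply: (does_seq (s2 := Store (env2 n k.+1) [::] [::])).
      have -> : env2 n k.+1 = upd (env2 n k) 1 (env2 n k 1).+1.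
        by rewrite /env2; upd_ext.
      exact: does_inc.
    by apply: hT => // r; apply: e0.
  apply: (does_seq (s2 := Store (upd (F t) 3 q) [::] [::])).
    rewrite /q -ET; apply: hK => // r hr; rewrite /F /upd ifF; last by lia.
    by apply: e0; lia.
  set f1 := upd _ 3 q.
  apply: (does_seq (s2 := Store (upd f1 3 0) (nseq q One) [::])).
    rewrite -[nseq q One]cats0.
    exact: (@does_write_ones A OL OG true 3 f1 [::] [::]).
  apply: (does_seq (s2 := Store (upd f1 3 0) (Sep :: nseq q One) [::])).
    exact: (@does_push A OL OG true Sep _ _ [::]).
  set f2 := upd f1 3 0.
  apply: (does_seq (s2 := Store (upd f2 2 (f2 2).-1) (Sep :: nseq q One) [::])).
    exact: does_dec.
  set f3 := upd f2 2 _.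
  have <- : f3 2 = v by rewrite /f3 /f2 /f1 /F /upd /= ET.
  have -> : upd (upd (F t) 2 0) 3 0 = upd f3 2 0.
    by rewrite /f3 /f2 /f1; upd_ext.
  exact: (@does_write_ones A OL OG true 2 f3 (Sep :: nseq q One) [::]).
set P := compile (main tT tK) 0 ++ [:: @Stop A].
set K := cwidth (main tT tK).
have R := D P K [::] [:: @Stop A] erefl (leqnn _).
(* The first step places the zero marks of the counters and rewrites the symbols scanned on the two
   other tapes, which makes their blanks explicit. *)
pose t0 : {ffun 'I_K.+2 -> tape sym} :=
  [ffun j => if (j == ord0) || (j == ord_max) then
     Tape [::] (if j == ord0 then
                  (if n is n'.+1 then One :: behead (unary n) else [:: Blank])
                else [:: Blank]) else Tape [::] [:: Sep]].
have S0 : step OL OG (initial_configuration (search_machine tT tK) n) = (at_line P 0, t0).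
  rewrite /=; congr pair; apply/ffunP => j; rewrite !ffunE /=.
  by case: ifP => /=; rewrite ?ffunE; case: (j == ord0) => //=; case: (n).
have rep0 : represents (K := K) (Store (fun=> 0) (nseq n One) [::]) t0.
  case=> [||r] /= hK'; rewrite /t0 ffunE /=.
  - by case: (n) => [|n']; split=> -[|[]].
  - by rewrite eqxx; split=> -[|[]].
  - rewrite ifF; first by split.
    apply/negbTE; rewrite negb_or -!val_eqE /= inordK //; lia.
have [k [t1 [E1 rep1]]] := R _ rep0.
exists (k + 1); rewrite iterD -[iter 1 _ _]/(step OL OG _) S0 E1.
split.
  have sP : size P = (csize (main tT tK)).+1.
    by rewrite /P size_cat size_compile addn1.
  rewrite -[LHS]/(mode_at (at_line P (csize (main tT tK)))) /mode_at /at_line.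
  rewrite inordK; last by rewrite sP.
  by rewrite /P nth_cat size_compile ltnn subnn.
have [_ e] := rep1 Io isT.
exists (nseq v One ++ Sep :: nseq q One).
have q0 : 0 < q by apply: K0.
(* The tape is known only up to trailing blanks; as the output ends with [One], the list of cells
   must reach that far. *)
have sz : size (nseq v One ++ Sep :: nseq q One : seq sym) <= size (after (t1 ord0)).
  rewrite leqNgt; apply/negP => lt.
  have := e (v + q); rewrite /= nth_cat size_nseq ifF; last by lia.
  rewrite (_ : v + q - v = (q.-1).+1) /=; last by lia.
  rewrite nth_nseq ifT; last by lia.
  rewrite nth_default //; move: lt; rewrite size_cat /= !size_nseq.
  by rewrite addnS ltnS.
eexists; split; first by apply: nth_blank_cat sz; apply: e.
exists false, v, q.-1; split; first by rewrite prednK.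
by rewrite expr0 mul1r prednK.
Qed.

End Main.

(** * The integer tests and the machine that searches for them *)

Section EntropyMachine.
Variable A : eqType.

(* The number of words is only overestimated, by a factor [2 t + 2], by the
   total size of the answer. *)
Definition upper_test (OL : nat -> seq (seq A)) (k j t : nat) : bool :=
  total_size (OL t) * k ^ (j.+2 * (2 * t + 1)) <= k.+1 ^ (j.+2 * (2 * t + 1)).

(* [sum_(w <- OG t) (k / k.+1) ^ (j * size w) >= 1], cleared of denominators;
   the terms where [OG t] has no word number [i] vanish. *)
Definition lower_test (OG : nat -> seq (seq A)) (k j t : nat) : bool :=
  k.+1 ^ (j * total_size (OG t)) <=
  \sum_(i < t) (0 < size (nth [::] (OG t) i)) *
    (k ^ (j * size (nth [::] (OG t) i)) *
     k.+1 ^ (j * (total_size (OG t) - size (nth [::] (OG t) i)))).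

(** The scale k = B 2^n: an error of max(2, h) / k is below 2^-n once B exceeds max(2, h). *)
Definition t_denominator (B : nat) : nat -> cmd A :=
  t_mul (t_const A B) (t_exp (t_const A 2) (t_var A 0)).

Definition t_upper (B i : nat) : nat -> cmd A :=
  let e := t_mul (t_succ (t_succ (t_var A i)))
             (t_add (t_mul (t_const A 2) (t_var A 1)) (t_const A 1)) in
  t_leq (t_mul (t_total Language (t_var A 1)) (t_exp (t_denominator B) e))
        (t_exp (t_succ (t_denominator B)) e).

Definition t_lower (B j : nat) : nat -> cmd A :=
  let k := t_denominator B in
  let m := t_total Generators (t_var A 1) in
  t_leq (t_exp (t_succ k) (t_mul (t_var A j) m))
    (t_sum (t_var A 1) (fun i =>
       let w := t_word Generators (t_var A 1) (t_var A i) in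
       t_mul (t_leq (t_const A 1) w)
         (t_mul (t_exp k (t_mul (t_var A j) w))
                (t_exp (t_succ k) (t_mul (t_var A j) (t_sub m w)))))).

Definition t_test (B : nat) : nat -> cmd A :=
  t_search (t_succ (t_var A 1)) (fun j => t_mul (t_upper B j) (t_lower B j)).

Section Correctness.
Variables (OL OG : nat -> seq (seq A)) (B : nat).
Local Notation computes := (computes OL OG).

Lemma computes_denominator d0 : 0 < d0 ->
  computes d0 (t_denominator B) (fun f => B * 2 ^ f 0).
Proof.
move=> d; exact: computes_mul (computes_const _ _ _ _)
  (computes_exp (computes_const _ _ _ _) (computes_var _ _ d)).
Qed.

Lemma computes_upper d0 j : 1 < d0 -> j < d0 ->
  computes d0 (t_upper B j) (fun f => upper_test OL (B * 2 ^ f 0) (f j) (f 1) : nat).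
Proof.
move=> d jd; have k := computes_denominator (ltnW d).
have v1 := computes_var OL OG d; have vj := computes_var OL OG jd.
have e := computes_mul (computes_succ (computes_succ vj))
  (computes_add (computes_mul (computes_const OL OG d0 2) v1) (computes_const OL OG d0 1)).
exact: computes_leq (computes_mul (computes_total Language v1) (computes_exp k e))
  (computes_exp (computes_succ k) e).
Qed.

Lemma computes_lower d0 j : 1 < d0 -> j < d0 ->
  computes d0 (t_lower B j) (fun f => lower_test OG (B * 2 ^ f 0) (f j) (f 1) : nat).
Proof.
move=> d jd; have k := computes_denominator (ltnW d).
have v1 := computes_var OL OG d; have vj := computes_var OL OG jd.
have m := computes_total Generators v1.
apply: computes_leq (computes_exp (computes_succ k) (computes_mul vj m)) _.
apply: (@computes_sum _ _ _ _ _ _ _ (fun f i =>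
    (0 < size (nth [::] (OG (f 1)) i)) *
    ((B * 2 ^ f 0) ^ (f j * size (nth [::] (OG (f 1)) i)) *
     (B * 2 ^ f 0).+1 ^ (f j * (total_size (OG (f 1)) - size (nth [::] (OG (f 1)) i))))) v1).
  by move=> i f g fg; rewrite !fg //; lia.
move=> i di; have di2 : d0 <= i.+2 by lia.
have v1' := computes_widen di2 v1; have vj' := computes_widen di2 vj.
have k' := computes_widen di2 k; have m' := computes_widen di2 m.
have vi : computes i.+2 (t_var A i) (fun f => f i) by apply: computes_var; lia.
have w := computes_word Generators v1' vi.
exact: computes_mul (computes_leq (computes_const _ _ _ 1) w) (computes_mul
  (computes_exp k' (computes_mul vj' w))
  (computes_exp (computes_succ k') (computes_mul vj' (computes_sub m' w)))).
Qed.

Lemma computes_test : exists2 phi, computes 2 (t_test B) phi &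
  forall n t, (forall j, phi (env2 n t) = j.+1 ->
      upper_test OL (B * 2 ^ n) j t && lower_test OG (B * 2 ^ n) j t) /\
    ((exists2 j, j <= t & upper_test OL (B * 2 ^ n) j t && lower_test OG (B * 2 ^ n) j t)
      -> phi (env2 n t) != 0).
Proof.
pose psi f j := upper_test OL (B * 2 ^ f 0) j (f 1) && lower_test OG (B * 2 ^ f 0) j (f 1).
have [|||phi h1 h2] := @computes_search A OL OG 2 (t_succ (t_var A 1))
    (fun j => t_mul (t_upper B j) (t_lower B j)) (fun f => (f 1).+1) psi.
- by apply/computes_succ/computes_var.
- by move=> j f g fg; rewrite /psi !fg.
- move=> i di; have i1 : 1 < i.+2 by lia. have i2 : i < i.+2 by lia.
  have := computes_mul (computes_upper i1 i2) (computes_lower i1 i2).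
  by rewrite /psi; congr computes; apply/funext => f; rewrite mulnb.
by exists phi => // n t; apply: h2.
Qed.

End Correctness.

(** The success that the machine finds may differ from the one assumed; soundness of the tests will
    apply to any success. *)
Lemma test_machine (B : nat) : 0 < B -> exists M : oracle_machine A, forall OL OG n,
  (exists t, exists2 j, j <= t &
     upper_test OL (B * 2 ^ n) j t && lower_test OG (B * 2 ^ n) j t) ->
  exists j t, (upper_test OL (B * 2 ^ n) j t && lower_test OG (B * 2 ^ n) j t) /\
    outputs M OL OG n (j%:R / (B * 2 ^ n)%:R).
Proof.
move=> B0; exists (search_machine (t_test B) (t_denominator B)) => OL OG n [t ht].
have [phi h1 h2] := computes_test OL OG B.
have kp f : 0 < B * 2 ^ f 0 by rewrite muln_gt0 B0 expn_gt0.
have [|t' [j [e o]]] := search_machine_outputs (n := n) h1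
  (@computes_denominator OL OG B 3 isT) kp.
  by exists t; apply: (h2 n t).2.
by exists j, t'; split=> //; apply: (h2 n t').1.
Qed.

Lemma zero_machine : exists M : oracle_machine A, forall OL OG n, outputs M OL OG n 0.
Proof.
exists (search_machine (t_const A 1) (t_const A 1)) => OL OG n.
have [//||t [j [[<-]]]] := search_machine_outputs (n := n) (computes_const OL OG 2 1)
  (computes_const OL OG 3 1).
  by exists 0.
by rewrite mul0r.
Qed.

End EntropyMachine.

Local Open Scope classical_set_scope.
Local Open Scope ring_scope.

(** * Entropy of probability vectors *)

Section FiniteEntropy.
Variable R : realType.
Implicit Types (I J K : finType).

Definition shannon I (P : I -> R) : R := - \sum_i P i * ln (P i).

Definition push_vector I J (f : I -> J) (P : I -> R) (j : J) : R := \sum_(i | f i == j) P i.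

Definition prob_vector I (P : I -> R) : Prop := (forall i, 0 <= P i) /\ \sum_i P i = 1.

(** For p > 0 this is ln x <= x - 1 at x = q / p, multiplied by p. *)
Lemma mul_ln_gibbs (p q : R) : 0 <= p -> 0 <= q -> (0 < p -> 0 < q) ->
  p * ln q <= p * ln p + (q - p).
Proof.
rewrite le_eqVlt => /orP[/eqP <- q0 _|p0 _ /(_ p0) q0].
  by rewrite !mul0r add0r subr0.
have h : ln (q / p) <= q / p - 1.
  have := @le_ln1Dx R (q / p - 1); rewrite addrCA subrr addr0; apply.
  by rewrite ltrBrDl subrr divr_gt0.
rewrite ln_div ?posrE // in h.
have := ler_wpM2l (ltW p0) h.
rewrite !mulrBr mulr1 mulrCA divff ?gt_eqF // mulr1 => h'; lra.
Qed.

Lemma gibbs I (P Q : I -> R) : (forall i, 0 <= P i) -> (forall i, 0 <= Q i) ->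
  (forall i, 0 < P i -> 0 < Q i) -> \sum_i Q i <= \sum_i P i ->
  shannon P <= - \sum_i P i * ln (Q i).
Proof.
move=> P0 Q0 PQ s; rewrite /shannon lerN2.
apply: (@le_trans _ _ (\sum_i (P i * ln (P i) + (Q i - P i)))).
  by apply: ler_sum => i _; apply: mul_ln_gibbs => //; apply: PQ.
by rewrite big_split /= sumrB gerDl subr_le0.
Qed.

Lemma sum_push I J (f : I -> J) (P : I -> R) (F : J -> R) :
  \sum_i P i * F (f i) = \sum_j push_vector f P j * F j.
Proof.
rewrite (partition_big f predT) //=; apply: eq_bigr => j _.
by rewrite /push_vector mulr_suml; apply: eq_bigr => i /eqP ->.
Qed.

Lemma push_ge0 I J (f : I -> J) (P : I -> R) j : (forall i, 0 <= P i) -> 0 <= push_vector f P j.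
Proof. by move=> P0; apply: sumr_ge0. Qed.

Lemma sum_push1 I J (f : I -> J) (P : I -> R) : \sum_j push_vector f P j = \sum_i P i.
Proof. by rewrite [RHS](partition_big f predT). Qed.

Lemma prob_vector_push I J (f : I -> J) (P : I -> R) :
  prob_vector P -> prob_vector (push_vector f P).
Proof. by move=> [P0 P1]; split=> [j|]; [apply: push_ge0|rewrite sum_push1]. Qed.

Lemma le_push I J (f : I -> J) (P : I -> R) i :
  (forall i, 0 <= P i) -> P i <= push_vector f P (f i).
Proof.
by move=> P0; rewrite /push_vector (bigD1 i) //= lerDl sumr_ge0.
Qed.

Lemma prob_vector_le1 I (P : I -> R) i : prob_vector P -> P i <= 1.
Proof. by move=> [P0 <-]; rewrite (bigD1 i) //= lerDl sumr_ge0. Qed.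

Lemma shannon_ge0 I (P : I -> R) : prob_vector P -> 0 <= shannon P.
Proof.
move=> dP; rewrite /shannon -sumrN sumr_ge0 // => i _; rewrite -mulrN mulr_ge0 ?dP.1 //.
by rewrite oppr_ge0 ln_le0 // prob_vector_le1.
Qed.

Lemma push_comp I J K (f : I -> J) (g : J -> K) (P : I -> R) k :
  push_vector g (push_vector f P) k = push_vector (g \o f) P k.
Proof.
rewrite /push_vector (partition_big f (fun j => g j == k)) //=.
apply: eq_bigr => j /eqP gj; apply: eq_bigl => i.
by case: eqP => [->|]; rewrite ?gj ?eqxx ?andbF.
Qed.

Lemma shannon_push_le I J (f : I -> J) (P : I -> R) :
  (forall i, 0 <= P i) -> shannon (push_vector f P) <= shannon P.
Proof.
move=> P0; rewrite /shannon lerN2 -(sum_push f P (fun j => ln (push_vector f P j))).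
apply: ler_sum => i _; have := P0 i; rewrite le_eqVlt => /orP[/eqP <-|p0].
  by rewrite !mul0r.
by rewrite ler_pM2l // ler_ln ?posrE ?le_push //; apply: lt_le_trans (le_push _ _ _).
Qed.

Lemma sum_inj_le I J (h : I -> J) (F : J -> R) : injective h -> (forall j, 0 <= F j) ->
  \sum_i F (h i) <= \sum_j F j.
Proof.
move=> hi F0; rewrite -(big_imset F (h := h) (A := predT)) /=; last by move=> *; apply: hi.
by rewrite [leRHS](bigID (mem [set h x | x in predT]%SET)) /= lerDl sumr_ge0.
Qed.

(** Gibbs against the product of the two marginals; injectivity makes these weights sum to at most
    1. *)
Lemma shannon_joint_le I J K (f : I -> J) (g : I -> K) (P : I -> R) :
  prob_vector P -> injective (fun i => (f i, g i)) ->
  shannon P <= shannon (push_vector f P) + shannon (push_vector g P).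
Proof.
move=> dP inj; have P0 := dP.1.
pose Q i := push_vector f P (f i) * push_vector g P (g i).
have pf i : 0 < P i -> 0 < push_vector f P (f i) /\ 0 < push_vector g P (g i).
  by move=> p0; split; apply: lt_le_trans p0 (le_push _ _ _).
apply: (@le_trans _ _ (- \sum_i P i * ln (Q i))).
  apply: gibbs => // [i|i /pf [h1 h2]|]; rewrite ?mulr_ge0 ?push_ge0 //.
    by rewrite mulr_gt0.
  apply: (@le_trans _ _ (\sum_p push_vector f P p.1 * push_vector g P p.2)).
    apply: (sum_inj_le (F := fun p => push_vector f P p.1 * push_vector g P p.2) inj).
    by move=> p; rewrite mulr_ge0 ?push_ge0.
  rewrite -(pair_bigA _ (fun j k => push_vector f P j * push_vector g P k)) /=.
  under eq_bigr do rewrite -mulr_sumr (prob_vector_push g dP).2 mulr1.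
  by rewrite sum_push1.
rewrite /shannon -(sum_push f P (fun j => ln (push_vector f P j))).
rewrite -(sum_push g P (fun j => ln (push_vector g P j))) -opprD lerN2 -big_split /=.
apply: ler_sum => i _; have := P0 i; rewrite le_eqVlt => /orP[/eqP <-|p0].
  by rewrite !mul0r addr0.
by have [h1 h2] := pf _ p0; rewrite -mulrDr lnM.
Qed.

Definition tuple_left I m n (w : (m + n).-tuple I) : m.-tuple I :=
  [tuple tnth w (lshift n j) | j < m].

Definition tuple_right I m n (w : (m + n).-tuple I) : n.-tuple I :=
  [tuple tnth w (rshift m j) | j < n].

Lemma shannon_tuple_le I m n (P : (m + n).-tuple I -> R) : prob_vector P ->
  shannon P <= shannon (push_vector (@tuple_left I m n) P) +
               shannon (push_vector (@tuple_right I m n) P).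
Proof.
move=> /shannon_joint_le; apply=> w w' e; apply: eq_from_tnth => j.
case: (split_ordP j) => i ->.
  by have := congr1 (fun t => tnth t.1 i) e; rewrite !tnth_mktuple.
by have := congr1 (fun t => tnth t.2 i) e; rewrite !tnth_mktuple.
Qed.

(** Gibbs against the weights 1 / (2 C) on [S] and 1 / (2 |I|) elsewhere, of total at most 1: a code
    that spends one bit on telling the two cases apart. *)
Lemma shannon_le_count I (S : pred I) (P : I -> R) (C D delta : R) :
  prob_vector P -> 1 <= C -> #|S|%:R <= C -> \sum_(i | ~~ S i) P i <= delta ->
  ln #|I|%:R <= D -> 0 <= D -> shannon P <= ln 2 + ln C + delta * D.
Proof.
move=> dP C1 SC Pd ID D0; have P0 := dP.1.
have C0 : 0 < C by apply: lt_le_trans C1.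
have [i0 _|I0] := pickP (@predT I); last first.
  have := dP.2; rewrite big1; last by move=> i; have := I0 i.
  by move=> /eqP; rewrite eq_sym oner_eq0.
have In0 : 0 < #|I|%:R :> R by rewrite ltr0n; apply/card_gt0P; exists i0.
pose Q i := if S i then (2 * C)^-1 else (2 * #|I|%:R)^-1.
have Q0 i : 0 < Q i by rewrite /Q; case: ifP => _; rewrite invr_gt0 mulr_gt0.
apply: (@le_trans _ _ (- \sum_i P i * ln (Q i))).
  apply: gibbs => // [i|]; first exact: ltW.
  rewrite dP.2 (bigID S) /=.
  rewrite (eq_bigr (fun=> (2 * C)^-1)); last by rewrite /Q => i ->.
  rewrite [X in _ + X](eq_bigr (fun=> (2 * #|I|%:R)^-1)); last first.
    by rewrite /Q => i /negbTE ->.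
  rewrite !sumr_const -[_ *+ #|S|]mulr_natl -[X in _ + X]mulr_natl.
  rewrite [leRHS](_ : 1 = 2^-1 + 2^-1); last by lra.
  apply: lerD.
    by rewrite ler_pdivrMr ?mulr_gt0 // mulrA mulVf ?mul1r.
  rewrite ler_pdivrMr ?mulr_gt0 // mulrA mulVf ?mul1r //.
  by rewrite ler_nat max_card.
rewrite -sumrN (bigID S) /=.
have l2 : 0 <= ln 2 :> R by rewrite ln_ge0 // ler1n.
have lC : 0 <= ln C by rewrite ln_ge0.
have eS : \sum_(i | S i) - (P i * ln (Q i)) = (\sum_(i | S i) P i) * (ln 2 + ln C).
  rewrite mulr_suml; apply: eq_bigr => i Si.
  by rewrite /Q Si lnV ?posrE ?mulr_gt0 // lnM ?posrE // mulrN opprK.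
have eT : \sum_(i | ~~ S i) - (P i * ln (Q i)) =
    (\sum_(i | ~~ S i) P i) * (ln 2 + ln #|I|%:R).
  rewrite mulr_suml; apply: eq_bigr => i /negbTE Si.
  by rewrite /Q Si lnV ?posrE ?mulr_gt0 // lnM ?posrE // mulrN opprK.
rewrite eS eT; have := dP.2; rewrite (bigID S) /=.
have : 0 <= \sum_(i | ~~ S i) P i by apply: sumr_ge0.
have : 0 <= \sum_(i | S i) P i by apply: sumr_ge0.
set a := \sum_(i | S i) _; set b := \sum_(i | ~~ S i) _ in Pd * => a0 b0 ab.
have h1 : b * ln #|I|%:R <= delta * D.
  apply: (@le_trans _ _ (b * D)); first exact: ler_wpM2l.
  exact: ler_wpM2r.
have h2 : a * (ln 2 + ln C) + b * ln 2 <= ln 2 + ln C.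
  have -> : a = 1 - b by lra.
  have : 0 <= b * ln C by rewrite mulr_ge0.
  lra.
lra.
Qed.

Lemma shannon_le_card I (P : I -> R) : prob_vector P ->
  shannon P <= ln #|I|%:R.
Proof.
move=> dP; have P0 := dP.1.
have In0 : (0 < #|I|)%N.
  rewrite lt0n; apply/negP => /eqP/card0_eq I0; have := dP.2.
  by rewrite big1 => [/eqP|i]; [rewrite eq_sym oner_eq0|have := I0 i].
apply: (@le_trans _ _ (- \sum_i P i * ln ((#|I|%:R)^-1))).
  apply: gibbs => // [i _|]; first by rewrite invr_gt0 ltr0n.
  by rewrite sumr_const dP.2 -[_ *+ _]mulr_natl divff ?gt_eqF ?ltr0n.
by rewrite -mulr_suml dP.2 mul1r lnV ?opprK // posrE ltr0n.
Qed.

(** Concavity: Gibbs for each [P k] against the average. *)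
Lemma shannon_average I (K : finType) (t : K -> R) (P : K -> I -> R) :
  (forall k, 0 <= t k) -> (forall k, prob_vector (P k)) -> \sum_k t k = 1 ->
  \sum_k t k * shannon (P k) <= shannon (fun i => \sum_k t k * P k i).
Proof.
move=> t0 dP t1; pose Q i := \sum_k t k * P k i; rewrite -/Q.
have Q0 i : 0 <= Q i by apply: sumr_ge0 => k _; rewrite mulr_ge0 // (dP k).1.
have Q1 : \sum_i Q i = 1.
  rewrite /Q exchange_big /= -[RHS]t1; apply: eq_bigr => k _.
  by rewrite -mulr_sumr (dP k).2 mulr1.
have -> : shannon Q = \sum_k t k * - \sum_i P k i * ln (Q i).
  rewrite /shannon; under [in RHS]eq_bigr do rewrite mulrN mulr_sumr.
  rewrite sumrN exchange_big /=; congr (- _); apply: eq_bigr => i _.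
  by rewrite mulr_suml; apply: eq_bigr => k _; rewrite mulrA.
apply: ler_sum => k _; have := t0 k; rewrite le_eqVlt => /orP[/eqP <-|tk].
  by rewrite !mul0r.
rewrite ler_pM2l //; apply: gibbs => //; first by move=> i; apply: (dP k).1.
  move=> i pi; rewrite /Q (bigD1 k) //= ltr_pwDl ?mulr_gt0 //.
  by apply: sumr_ge0 => k' _; rewrite mulr_ge0 // (dP k').1.
by rewrite Q1 (dP k).2.
Qed.

(** Converse of concavity up to the binary entropy of [t], from ln (t p + q) >= ln t + ln p. After
    division by the block length it bounds the entropy rate of a mixture. *)
Lemma shannon_mix_le I (t : R) (P1 P2 : I -> R) : 0 < t -> t < 1 ->
  prob_vector P1 -> prob_vector P2 ->
  shannon (fun i => t * P1 i + (1 - t) * P2 i) <=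
  t * shannon P1 + (1 - t) * shannon P2 - (t * ln t + (1 - t) * ln (1 - t)).
Proof.
move=> t0 t1 d1 d2; have u0 : 0 < 1 - t by rewrite subr_gt0.
have key (s p q : R) : 0 < s -> 0 <= p -> 0 <= q ->
    s * p * (ln s + ln p) <= s * p * ln (s * p + q).
  move=> s0; rewrite le_eqVlt => /orP[/eqP <-|p0] q0.
    by rewrite mulr0 !mul0r.
  have sp : 0 < s * p by rewrite mulr_gt0.
  by rewrite ler_pM2l // -lnM ?posrE // ler_ln ?posrE ?lerDl // ltr_pwDl.
have e (s : R) (P : I -> R) : \sum_i P i = 1 ->
    \sum_i s * P i * (ln s + ln (P i)) = s * ln s + s * \sum_i P i * ln (P i) :> R.
  move=> sP; rewrite -[s * ln s]mul1r -sP mulr_suml mulr_sumr -big_split /=.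
  by apply: eq_bigr => i _; ring.
have := e t P1 d1.2; have := e (1 - t) P2 d2.2; rewrite /shannon.
set a := \sum_i _ * _ * _; set b := \sum_i _ * _ * _ => ea eb.
suff : b + a <= \sum_i (t * P1 i + (1 - t) * P2 i) * ln (t * P1 i + (1 - t) * P2 i).
  by rewrite ea eb; lra.
rewrite /a /b -big_split /=; apply: ler_sum => i _; rewrite [leRHS]mulrDl; apply: lerD.
  by apply: (key _ _ _ _ (d1.1 i)) => //; rewrite mulr_ge0 ?d2.1 // ltW.
by rewrite [t * _ + _]addrC; apply: (key _ _ _ _ (d2.1 i)) => //; rewrite mulr_ge0 ?d1.1 // ltW.
Qed.

Lemma continuous_xlnx : continuous (fun x : R => x * ln x).
Proof.
move=> x; suff : y * ln y @[y --> x] --> x * ln x by [].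
have [x0|x0|<-] := ltgtP 0 x.
- apply: cvgM; first exact: cvg_id.
  exact: continuous_ln.
- rewrite ln0 ?ltW // mulr0.
  apply: cvg_near_cst; near=> y.
  rewrite ln0 ?mulr0 //; apply: ltW; near: y; exact: lt_nbhsl.
- rewrite mul0r; apply/cvgrPdist_le => e e0.
  near=> y; rewrite sub0r normrN.
  have [y0|y0] := leP y 0; first by rewrite ln0 // mulr0 normr0 ltW.
  have y1 : y < 1 by near: y; apply: lt_nbhsl.
  have ye : y < (e / 2) ^+ 2.
    by near: y; apply: lt_nbhsl; rewrite exprn_gt0 // divr_gt0.
  (* With s = sqrt y, the bound ln (1/s) <= 1/s gives |y ln y| <= 2 s. *)
  set s := Num.sqrt y.
  have s0 : 0 < s by rewrite sqrtr_gt0.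
  have ey : y = s ^+ 2 by rewrite sqr_sqrtr // ltW.
  have se : s < e / 2.
    by rewrite -(ltr_pXn2r (n := 2)) ?nnegrE ?ltW ?divr_gt0 // -ey.
  have ls : ln y <= 0 by rewrite ln_le0 // ltW.
  rewrite normrM (ger0_norm (ltW y0)) (ler0_norm ls).
  have : ln (s^-1) <= s^-1 by rewrite ltW // ln_sublinear // invr_gt0.
  rewrite lnV ?posrE // {2}ey lnXn // => h.
  have h2 := ler_wpM2l (ltW y0) h.
  have : y * s^-1 = s by rewrite ey expr2 mulfK ?gt_eqF.
  rewrite -mulr_natl; nra.
Unshelve. all: by end_near. Qed.

(** x ln x is continuous and vanishes at 0 and at 1; [delta] is shared equally among the terms. *)
Lemma shannon_concentrated I (i0 : I) (delta : R) : 0 < delta ->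
  exists2 e : R, 0 < e & forall P : I -> R, prob_vector P -> 1 - e <= P i0 ->
    shannon P <= delta.
Proof.
move=> d0; have n0 : 0 < #|I|%:R :> R by rewrite ltr0n; apply/card_gt0P; exists i0.
have dn : 0 < delta / #|I|%:R by rewrite divr_gt0.
have h a : a * ln a = 0 :> R ->
    exists2 e : R, 0 < e & forall x, `|a - x| <= e -> `|x * ln x| <= delta / #|I|%:R.
  move=> ea; have : x * ln x @[x --> a] --> a * ln a by apply: continuous_xlnx.
  move=> /cvgrPdist_le /(_ _ dn).
  rewrite ea => /nbhs_ballP [e /= e0 he]; exists (e / 2); first by rewrite divr_gt0.
  move=> x xe; have : ball a e x by rewrite /ball /=; lra.
  by move/he; rewrite sub0r normrN.
have [|e1 e10 h1] := h 1; first by rewrite ln1 mulr0.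
have [|e2 e20 h2] := h 0; first by rewrite mul0r.
exists (Num.min e1 e2); first by rewrite lt_min e10.
move=> P dP Pi0.
apply: (@le_trans _ _ (\sum_(i : I) delta / #|I|%:R)); last first.
  by rewrite sumr_const -[_ *+ _]mulr_natr divfK // gt_eqF.
rewrite /shannon -sumrN; apply: ler_sum => i _.
apply: le_trans (ler_norm _) _; rewrite normrN.
have [->|ne] := eqVneq i i0.
  have : Num.min e1 e2 <= e1 by rewrite ge_min lexx.
  by move=> le1; apply: h1; rewrite ger0_norm ?subr_ge0 ?prob_vector_le1 //; lra.
apply: h2; rewrite sub0r normrN ger0_norm ?dP.1 //.
have : P i0 + P i <= 1.
  by rewrite -dP.2 (bigD1 i0) //= (bigD1 i) //= addrA lerDl sumr_ge0 // => *; apply: dP.1.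
have : Num.min e1 e2 <= e2 by rewrite ge_min lexx orbT.
lra.
Qed.

End FiniteEntropy.

(** * Subadditive sequences *)

Section Fekete.
Variable R : realType.

Lemma fekete (u : nat -> R) : (forall n, 0 <= u n) ->
  (forall m n, u (m + n)%N <= u m + u n) ->
  exists2 l : R, u n / n%:R @[n --> \oo] --> l & forall n, (0 < n)%N -> l <= u n / n%:R.
Proof.
move=> u0 us; pose E := [set x : R | exists2 n, (0 < n)%N & x = u n / n%:R].
have iE : has_inf E.
  split; first by exists (u 1%N / 1%:R), 1%N.
  by exists 0 => x [n _ ->]; rewrite divr_ge0.
have lE n : (0 < n)%N -> inf E <= u n / n%:R by move=> n0; apply: ge_inf; [exact: iE.2|exists n].
exists (inf E) => //; apply/cvgrPdist_le => e e0.
have e2 : 0 < e / 2 by rewrite divr_gt0.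
have [x [m m0 ->] xm] := inf_adherent e2 iE.
have mr : 0 < m%:R :> R by rewrite ltr0n.
have uq q : u (q * m)%N <= q%:R * u m + u 0%N.
  elim: q => [|q IH]; first by rewrite mul0n mul0r add0r.
  by rewrite mulSn mulrS mulrDl mul1r; apply: le_trans (us _ _) _; rewrite -addrA lerD.
have ur r : u r <= r%:R * u 1%N + u 0%N.
  elim: r => [|r IH]; first by rewrite mul0r add0r.
  by rewrite -add1n mulrS mulrDl mul1r; apply: le_trans (us _ _) _; rewrite -addrA lerD.
(* Bounds the contribution of the remainder of n modulo m; the two [u 0] come from the base cases of
   [uq] and [ur]. *)
pose C := m%:R * u 1%N + 2 * u 0%N.
have C0 : 0 <= C by rewrite addr_ge0 // mulr_ge0.
near=> n.
have n0 : (0 < n)%N by near: n; exact: nbhs_infty_gt.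
have nr : 0 < n%:R :> R by rewrite ltr0n.
have nC : C / (e / 2) <= n%:R by near: n; exact: nbhs_infty_ger.
rewrite ler0_norm ?subr_le0 ?lE // opprB lerBlDr ler_pdivrMr //.
rewrite ler_pdivrMr // in nC.
have un : u n <= (n %/ m)%N%:R * u m + C.
  rewrite {1}(divn_eq n m); apply: le_trans (us _ _) _.
  apply: le_trans (lerD (uq _) (ur _)) _.
  have : (n %% m)%N%:R * u 1%N <= m%:R * u 1%N.
    by apply: ler_wpM2r => //; rewrite ler_nat ltnW // ltn_mod.
  rewrite /C; lra.
have qn : (n %/ m)%N%:R * m%:R <= n%:R :> R.
  by rewrite -natrM ler_nat leq_divM.
have um : u m = (u m / m%:R) * m%:R by rewrite divfK // gt_eqF.
have um0 : 0 <= u m / m%:R by rewrite divr_ge0.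
set q := (n %/ m)%N%:R in un qn; set y := u m / m%:R in xm um um0.
have : q * u m <= n%:R * y by rewrite um mulrCA mulrC; apply: ler_wpM2r.
nra.
Unshelve. all: by end_near. Qed.

End Fekete.

(** * Concatenations of generators *)

Section Words.
Variable A : alphabetType.
Implicit Types (x : full_shift A).

Lemma size_subword x i n : size (subword x i n) = n.
Proof. by rewrite size_map size_iota. Qed.

Lemma nth_subword a x i n j : (j < n)%N -> nth a (subword x i n) j = x (i + Posz j).
Proof. by move=> jn; rewrite (nth_map 0%N) ?size_iota // nth_iota. Qed.

Lemma subword_cat x i m n :
  subword x i (m + n) = subword x i m ++ subword x (i + Posz m) n.
Proof.
apply: (@eq_from_nth _ point); first by rewrite size_cat !size_subword.
move=> j; rewrite size_subword => jmn; rewrite nth_subword // nth_cat size_subword.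
case: ltnP => jm; rewrite nth_subword //; last by lia.
by congr x; lia.
Qed.

Lemma subword_eqP x i y i' n :
  (subword x i n = subword y i' n) <->
  (forall j, (j < n)%N -> x (i + Posz j) = y (i' + Posz j)).
Proof.
split=> [e j jn|h]; first by rewrite -(nth_subword point x i jn) e nth_subword.
apply: (@eq_from_nth _ point); first by rewrite !size_subword.
by move=> j; rewrite size_subword => jn; rewrite !nth_subword // h.
Qed.

Lemma subwordP x i (w : seq A) : (subword x i (size w) = w) <->
  (forall j, (j < size w)%N -> x (i + Posz j) = nth point w j).
Proof.
split=> [e j jn|h]; first by rewrite -(nth_subword point x i jn) e.
apply: (@eq_from_nth _ point); first by rewrite size_subword.
by move=> j; rewrite size_subword => jn; rewrite nth_subword // h.
Qed.

Lemma subword_catP x i (u v : seq A) : (subword x i (size (u ++ v)) = u ++ v) <->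
  subword x i (size u) = u /\ subword x (i + Posz (size u)) (size v) = v.
Proof.
rewrite size_cat subword_cat; split=> [/eqP|[-> ->] //].
by rewrite eqseq_cat ?size_subword // => /andP[/eqP -> /eqP ->].
Qed.

Definition shift_by (m : int) x : full_shift A := fun i => x (i + m).

Lemma subword_shift_by m x i n : subword (shift_by m x) i n = subword x (i + m) n.
Proof. by apply: eq_map => j; rewrite /shift_by; congr x; lia. Qed.

Definition rcat (v : nat -> seq A) (n : nat) : seq A := flatten (mkseq v n).

Definition lcat (w : nat -> seq A) (n : nat) : seq A := flatten (rev (mkseq w n)).

Lemma rcatS v n : rcat v n.+1 = rcat v n ++ v n.
Proof. by rewrite /rcat mkseqS flatten_rcons. Qed.

Lemma lcatS w n : lcat w n.+1 = w n ++ lcat w n.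
Proof. by rewrite /lcat mkseqS rev_rcons. Qed.

Lemma rev_lcat w n : rev (lcat w n) = rcat (fun k => rev (w k)) n.
Proof. by elim: n => [//|n IH]; rewrite lcatS rcatS rev_cat IH. Qed.

Lemma rcatD v m n : rcat v (m + n) = rcat v m ++ rcat (fun k => v (m + k)%N) n.
Proof.
elim: n => [|n IH]; first by rewrite addn0 cats0.
by rewrite addnS !rcatS IH catA.
Qed.

Lemma leq_size_rcat v n : (forall k, v k <> [::]) -> (n <= size (rcat v n))%N.
Proof.
move=> v0; elim: n => // n IH; rewrite rcatS size_cat.
have := v0 n; case: (v n) => // a s _ /=; lia.
Qed.

Lemma leq_size_lcat v n : (forall k, v k <> [::]) -> (n <= size (lcat v n))%N.
Proof.
move=> v0; rewrite -size_rev rev_lcat; apply: leq_size_rcat => k.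
by have := v0 k; case: (v k) => // a s _ /(congr1 size); rewrite size_rev.
Qed.

Lemma nth_rcat a v m n j : (m <= n)%N -> (j < size (rcat v m))%N ->
  nth a (rcat v n) j = nth a (rcat v m) j.
Proof. by move=> /subnKC <- jm; rewrite rcatD nth_cat jm. Qed.

(* The words [v 0], [v 1], ... follow each other from coordinate 0 rightwards
   and [w 0], [w 1], ... leftwards. *)
Definition fits x (v w : nat -> seq A) : Prop := forall n,
  subword x 0 (size (rcat v n)) = rcat v n /\
  subword x (- Posz (size (lcat w n))) (size (lcat w n)) = lcat w n.

Definition word_at (v w : nat -> seq A) (i : int) : seq A :=
  match i with Posz n => v n | Negz n => w n end.

Definition cut_at (v w : nat -> seq A) (i : int) : int :=
  match i with
  | Posz n => Posz (size (rcat v n))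
  | Negz n => - Posz (size (lcat w n.+1))
  end.

Lemma fits_concatenation x v w : fits x v w -> concatenation (word_at v w) (cut_at v w) x.
Proof.
move=> fx [n|n] /=.
  have := (fx n.+1).1; rewrite rcatS => /subword_catP [_]; rewrite add0r => ->.
  by split=> //; rewrite -PoszD addn1 /= rcatS size_cat.
have := (fx n.+1).2; rewrite lcatS => /subword_catP [h _].
split; first by [].
case: n {h} => [|n] /=; first by rewrite /lcat /= cats0; lia.
rewrite subn1 /= size_cat; lia.
Qed.

Lemma concatenation_fits x u c : concatenation u c x -> c 0 = 0 ->
  fits x (fun n => u (Posz n)) (fun n => u (Negz n)).
Proof.
move=> cx c0; set v := fun n => u (Posz n); set w := fun n => u (Negz n).
have [cr cl] : (forall n, c (Posz n) = Posz (size (rcat v n))) /\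
               (forall n, c (Negz n) = - Posz (size (lcat w n.+1))).
  split; elim=> [|n IH] //.
  - have [_] := cx (Posz n); rewrite IH (_ : Posz n + 1 = Posz n.+1); last by lia.
    by move=> ->; rewrite rcatS size_cat PoszD.
  - have [_] := cx (Negz 0); rewrite (_ : Negz 0 + 1 = 0) // c0.
    by rewrite -[u _]/(w 0%N) lcatS /= cats0; lia.
  - have [_] := cx (Negz n.+1); rewrite (_ : Negz n.+1 + 1 = Negz n); last by lia.
    by rewrite -[u _]/(w n.+1) IH [lcat w n.+2]lcatS size_cat; lia.
elim=> [|n [IH1 IH2]]; first by [].
split.
  rewrite rcatS; apply/subword_catP; split=> //; rewrite add0r -cr; exact: (cx _).1.
rewrite [lcat w n.+1]lcatS; apply/subword_catP; split.
  by rewrite -lcatS -cl; apply: (cx _).1.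
by rewrite size_cat [_ + _](_ : _ = - Posz (size (lcat w n))) //; lia.
Qed.

Lemma fits_exists v w : (forall k, v k <> [::]) -> (forall k, w k <> [::]) ->
  exists x, fits x v w.
Proof.
move=> v0 w0; pose w' k := rev (w k).
have w'0 k : w' k <> [::].
  by have := w0 k; rewrite /w'; case: (w k) => // a s _ /(congr1 size); rewrite size_rev.
(* Words being nonempty, z + 1 of them cover the letter number z. Leftwards the words are reversed,
   to be read away from 0. *)
pose x : full_shift A := fun i => match i with
  | Posz z => nth point (rcat v z.+1) z | Negz z => nth point (rcat w' z.+1) z end.
have key f m j : (forall k, f k <> [::]) -> (j < size (rcat f m))%N ->
    nth (point : A) (rcat f j.+1) j = nth point (rcat f m) j.
  move=> f0 jm; have jj : (j < size (rcat f j.+1))%N by apply: leq_size_rcat.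
  have [le|le] := leqP m j.+1; first by rewrite (nth_rcat _ le).
  by rewrite [RHS](nth_rcat _ (ltnW le)).
exists x => n; split; apply/subwordP => j jn.
  by rewrite add0r /x (key _ n).
have [m em] : exists m, size (lcat w n) = (m + j.+1)%N.
  by exists (size (lcat w n) - j.+1)%N; rewrite subnK.
have -> : - Posz (size (lcat w n)) + Posz j = Negz m by rewrite em; lia.
rewrite /x (key _ n) //; last by rewrite -rev_lcat size_rev em; lia.
rewrite -rev_lcat nth_rev ?em; last by lia.
by congr nth; lia.
Qed.

Section Generators.
Variable G : set (seq A).
Hypothesis G_nonempty : forall w, G w -> w <> [::].

Definition boundary0 : set (full_shift A) := [set x | exists v w,
  (forall n, G (v n)) /\ (forall n, G (w n)) /\ fits x v w].

Lemma boundary0P x : boundary0 x <-> exists u c, written_as G x u c /\ c 0 = 0.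
Proof.
split=> [[v [w [Gv [Gw fx]]]]|[u [c [[Gu cx] c0]]]].
  exists (word_at v w), (cut_at v w); split=> //; split; last exact: fits_concatenation.
  by case.
exists (fun n => u (Posz n)), (fun n => u (Negz n)); do 2 split=> //.
exact: concatenation_fits cx c0.
Qed.

Lemma written_as_shift x u c m : written_as G x u c ->
  written_as G (shift_by m x) u (fun i => c i - m).
Proof.
move=> [Gu cx]; split=> // i; have [h1 h2] := cx i; split.
  by rewrite subword_shift_by subrK.
by rewrite h2; lia.
Qed.

Lemma written_as_renumber x u c k : written_as G x u c ->
  written_as G x (fun i => u (i + k)) (fun i => c (i + k)).
Proof.
move=> [Gu cx]; split=> // i; have [h1 h2] := cx (i + k); split=> //.
by rewrite -h2; congr c; lia.
Qed.

Lemma shift_concatenations m x :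
  concatenations G (shift_by m x) <-> concatenations G x.
Proof.
have h m' y : concatenations G y -> concatenations G (shift_by m' y).
  by move=> [u [c /(written_as_shift m') h]]; exists u, (fun i => c i - m').
split=> [/(h (- m))|]; last exact: h.
by congr concatenations; apply/funext => i; rewrite /shift_by; congr x; lia.
Qed.

Lemma boundary_at x u c i : written_as G x u c -> boundary0 (shift_by (c i) x).
Proof.
move=> h; apply/boundary0P; exists (fun j => u (j + i)), (fun j => c (j + i) - c i).
by split; [apply/written_as_shift/written_as_renumber|rewrite add0r subrr].
Qed.

Lemma boundary0_concatenations m x : boundary0 (shift_by m x) -> concatenations G x.
Proof.
move=> /boundary0P [u [c [h _]]]; apply/(shift_concatenations m); by exists u, c.
Qed.

Lemma written_as_lt x u c i : written_as G x u c -> c i < c (i + 1).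
Proof.
move=> [Gu /(_ i) [_ ->]]; have := G_nonempty (Gu i).
by case: (u i) => // a s _ /=; lia.
Qed.

Lemma written_as_ge x u c i n : written_as G x u c -> c i + Posz n <= c (i + Posz n).
Proof.
move=> h; elim: n => [|n IH]; first by rewrite !addr0.
have := written_as_lt (i + Posz n) h.
by rewrite (_ : i + Posz n + 1 = i + Posz n.+1); lia.
Qed.

Hypothesis G_unique : unique_representation G.

Lemma fits_unique x v w v' w' : (forall n, G (v n)) -> (forall n, G (w n)) ->
  (forall n, G (v' n)) -> (forall n, G (w' n)) ->
  fits x v w -> fits x v' w' -> v = v' /\ w = w'.
Proof.
move=> Gv Gw Gv' Gw' /fits_concatenation h /fits_concatenation h'.
have W : written_as G x (word_at v w) (cut_at v w) by split=> //; case.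
have W' : written_as G x (word_at v' w') (cut_at v' w') by split=> //; case.
have [k hk] := G_unique W W'.
(* Both ways of writing have their cut number 0 at coordinate 0 and cuts strictly increase, so the
   renumbering is trivial. *)
have k0 : k = 0.
  have [_] := hk 0; rewrite add0r; case: k {hk} => [n|n] /= e.
    by have := leq_size_rcat n (fun i => G_nonempty (Gv i)); case: e => <-; lia.
  by have := leq_size_lcat n.+1 (fun i => G_nonempty (Gw i)); lia.
split; apply/funext => n.
  by have [] := hk (Posz n); rewrite k0 addr0 /= => ->.
by have [] := hk (Negz n); rewrite k0 addr0 /= => ->.
Qed.

(* Completing both factorizations by the same word [g] on either side turns
   them into two ways of writing one point. *)
Lemma flatten_inj g (s t : seq (seq A)) : G g -> (forall w, w \in s -> G w) ->
  (forall w, w \in t -> G w) -> size s = size t -> flatten s = flatten t -> s = t.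
Proof.
move=> Gg Gs Gt st fst.
have Gn (r : seq (seq A)) : (forall w, w \in r -> G w) -> forall n, G (nth g r n).
  move=> Gr n; have [nr|nr] := ltnP n (size r); first by apply/Gr/mem_nth.
  by rewrite nth_default.
have [x fx] : exists x, fits x (nth g s) (fun=> g).
  by apply: fits_exists => k; apply: G_nonempty => //; apply: Gn.
have rc (r : seq (seq A)) n : size r = size s -> rcat (nth g r) (size s + n) =
    flatten r ++ rcat (fun=> g) n.
  move=> rs; rewrite rcatD /rcat -rs mkseq_nth; congr (_ ++ flatten _).
  by apply: eq_mkseq => k; rewrite nth_default // leq_addr.
have fx' : fits x (nth g t) (fun=> g).
  move=> n; split; last by have [] := fx n.
  have [] := fx (size s + n)%N; rewrite rc // fst -rc // => h _.
  have : (n <= size s + n)%N by lia.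
  move=> /subnKC e; rewrite -e rcatD in h.
  by have /subword_catP[] := h.
have [e _] := fits_unique (Gn _ Gs) (fun=> Gg) (Gn _ Gt) (fun=> Gg) fx fx'.
by apply: (@eq_from_nth _ g) => // i _; rewrite e.
Qed.

End Generators.

(** The list is completed by copies of [g] on both sides. *)
Lemma language_concatenations (G : set (seq A)) (g : seq A) (s : seq (seq A)) :
  (forall w, G w -> w <> [::]) -> G g -> (forall w, w \in s -> G w) ->
  language (concatenations G) (flatten s).
Proof.
move=> G0 Gg Gs.
have Gn n : G (nth g s n).
  have [nr|nr] := ltnP n (size s); first by apply/Gs/mem_nth.
  by rewrite nth_default.
have [x fx] : exists x, fits x (nth g s) (fun=> g).
  by apply: fits_exists => k; apply: G0.
exists x.
  apply: (@boundary0_concatenations _ 0); exists (nth g s), (fun=> g); do 2 split=> //.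
  by rewrite (_ : shift_by 0 x = x) //; apply/funext => i; rewrite /shift_by addr0.
exists 0; have [h _] := fx (size s); by move: h; rewrite /rcat mkseq_nth.
Qed.

Lemma nbhs_coordinate x i : nbhs x [set y : full_shift A | y i = x i].
Proof.
have h := @proj_continuous int (fun=> discrete_topology A) i x.
have := h [set a | a = x i]; apply.
by apply: open_nbhs_nbhs; split => //; apply: discrete_open.
Qed.

Lemma nbhs_subword x i n : nbhs x [set y : full_shift A | subword y i n = subword x i n].
Proof.
elim: n => [|n IH]; first by apply: filterS filterT => y _.
rewrite -addn1; apply: filterS (filterI IH (nbhs_coordinate x (i + Posz n))) => y [/= h1 h2].
by rewrite !subword_cat h1 /subword /= addr0 h2.
Qed.

(** An occurrence of a word at a given place is an open condition. *)
Lemma language_closure (S : set (full_shift A)) : language (closure S) = language S.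
Proof.
apply/seteqP; split=> w [x Sx [i e]].
  have [y [Sy /= e']] := Sx _ (nbhs_subword x i (size w)).
  by exists y => //; exists i; rewrite e' e.
by exists x; [apply: subset_closure|exists i].
Qed.

End Words.

(** * Kraft sums and word counts *)

Section Counting.
Variable A : alphabetType.
Implicit Types (P : set (seq A)).

Definition words (n : nat) : seq (seq A) := [seq tval t | t <- enum {: n.-tuple A}].

Lemma mem_words n w : (w \in words n) = (size w == n).
Proof.
apply/mapP/idP => [[t _ ->]|/eqP <-]; first by rewrite size_tuple.
by exists (in_tuple w) => //; rewrite mem_enum.
Qed.

Lemma words_uniq n : uniq (words n).
Proof. by rewrite map_inj_uniq ?enum_uniq //; apply: val_inj. Qed.

Definition wlist P n : seq (seq A) := [seq w <- words n | `[< P w >]].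

Lemma mem_wlist P n w : w \in wlist P n <-> size w = n /\ P w.
Proof.
rewrite mem_filter mem_words; split=> [/andP[/asboolP Pw /eqP sw] //|[-> Pw]].
by rewrite eqxx andbT; apply/asboolP.
Qed.

Lemma wlist_uniq P n : uniq (wlist P n).
Proof. exact/filter_uniq/words_uniq. Qed.

Lemma card_wlist P n : #|[pred w : n.-tuple A | `[< P w >]]| = size (wlist P n).
Proof.
rewrite cardE /wlist /words filter_map size_map {1}/enum_mem -enumT.
by congr size; apply: eq_filter.
Qed.

Definition star (G : set (seq A)) : set (seq A) :=
  [set w | exists2 s : seq (seq A), (forall u, u \in s -> G u) & flatten s = w].

Section Entropy.
Variable R : realType.

Section Growth.
Variable X : set (full_shift A).
Hypothesis X_nonempty : X !=set0.

Local Notation L := (wlist (language X)).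

Lemma language_count_gt0 n : (0 < size (L n))%N.
Proof.
have [x Xx] := X_nonempty.
have : subword x 0 n \in L n.
  apply/mem_wlist; rewrite size_subword; split=> //.
  by exists x => //; exists 0; rewrite size_subword.
by case: (L n).
Qed.

Lemma language_countD m n : (size (L (m + n)) <= size (L m) * size (L n))%N.
Proof.
rewrite -(size_allpairs cat); apply: uniq_leq_size (wlist_uniq _ _) _ => w.
move=> /mem_wlist [sw [x Xx [i e]]].
rewrite sw subword_cat in e; rewrite -e; apply: allpairs_f; apply/mem_wlist.
  rewrite size_subword; split=> //.
  by exists x => //; exists i; rewrite size_subword.
rewrite size_subword; split=> //.
by exists x => //; exists (i + Posz m); rewrite size_subword.
Qed.

(** By Fekete the limit is also a lower bound at every length, which lets the upper test conclude
    from a single length. *)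
Lemma topological_entropy_cvg :
  (ln (size (L n))%:R / n%:R : R) @[n --> \oo] --> (topological_entropy X : R) /\
  forall n, (0 < n)%N -> (topological_entropy X : R) <= ln (size (L n))%:R / n%:R.
Proof.
have c1 n : 1 <= (size (L n))%:R :> R by rewrite ler1n language_count_gt0.
have c0 n : 0 < (size (L n))%:R :> R by apply: lt_le_trans (c1 n).
have [||l hl lel] := @fekete R (fun n => ln (size (L n))%:R).
- by move=> n; apply: ln_ge0.
- move=> m n; rewrite -lnM ?posrE // ler_ln ?posrE ?mulr_gt0 //.
  by rewrite -natrM ler_nat language_countD.
suff -> : topological_entropy X = l :> R by [].
rewrite /topological_entropy.
by under eq_fun do rewrite card_wlist; apply/cvg_lim.
Qed.

Lemma language_count_le s : (topological_entropy X : R) < s ->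
  exists N, forall n, (N <= n)%N -> (size (L n))%:R <= expR (s * n%:R).
Proof.
move=> hs; have [h _] := topological_entropy_cvg.
have /cvgrPdist_lt /(_ (s - topological_entropy X)) := h.
rewrite subr_gt0 => /(_ hs) [N _ hN]; exists N.+1 => n Nn.
have n0 : 0 < n%:R :> R by rewrite ltr0n; lia.
have := hN n (ltnW Nn); rewrite /= distrC => /ltr_normlW.
rewrite ltrD2r ltr_pdivrMr // => /ltW.
by rewrite -ler_expR lnK // posrE ltr0n language_count_gt0.
Qed.

End Growth.

Lemma topological_entropy_set0 : topological_entropy (set0 : set (full_shift A)) = 0 :> R.
Proof.
rewrite /topological_entropy; apply/cvg_lim => //.
rewrite (_ : (fun n => _) = fun=> 0); first exact: cvg_cst.
apply/funext => n; rewrite card_wlist.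
have -> : wlist (language (set0 : set (full_shift A))) n = [::].
  case E : (wlist _ _) => [//|w r].
  have : w \in wlist (language (set0 : set (full_shift A))) n by rewrite E inE eqxx.
  by move=> /mem_wlist [_ []].
by rewrite ln0 ?mul0r.
Qed.

Variable G : set (seq A).
Hypothesis G_nonempty : forall w, G w -> w <> [::].

Definition kraft (s : R) (F : seq (seq A)) : R :=
  \sum_(g <- F) expR (- (s * (size g)%:R)).

Lemma coded_shift_nonempty g : G g -> coded_shift G !=set0.
Proof.
move=> Gg; have [|x cx _] := @language_concatenations A G g [::] G_nonempty Gg.
  by move=> w; rewrite in_nil.
by exists x; apply: subset_closure.
Qed.

(* The [k]-th power of a Kraft sum is a sum over the products of [k] generators,
   which are different words of the language. *)
Lemma kraft_le_entropy s F : unique_representation G -> uniq F ->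
  (forall g, g \in F -> G g) -> 1 <= kraft s F ->
  s <= topological_entropy (coded_shift G).
Proof.
move=> Gu uF FG K1; rewrite leNgt; apply/negP => hs.
have [g gF] : exists g, g \in F.
  case: F {uF FG} K1 => [|g F]; last by exists g; rewrite inE eqxx.
  by rewrite /kraft big_nil ler10.
(* A rate strictly between h and s: it still bounds the word counts, and the gap [a] to s gains a
   factor e^(a k). *)
set h := topological_entropy _ in hs; pose s' := (h + s) / 2.
have hs' : h < s' by rewrite /s'; lra.
pose a := s - s'; have a0 : 0 < a by rewrite /a /s'; lra.
have [N hN] := language_count_le (coded_shift_nonempty (FG _ gF)) hs'.
pose M := \max_(g <- F) size g.
have FM u : u \in F -> (size u <= M)%N by move=> uF'; apply: leq_bigmax_seq.
pose m := size F.
have Fn (j : 'I_m) : nth [::] F j \in F by apply: mem_nth.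
have key k : (N <= k)%N -> 1 <= expR (- (a * k%:R)) * ((k * M).+1%:R).
  move=> Nk.
  pose parts (f : {ffun 'I_k -> 'I_m}) := [seq nth [::] F (f i) | i <- enum 'I_k].
  pose word f := flatten (parts f).
  have pF f u : u \in parts f -> u \in F by move=> /mapP [i _ ->].
  have sw f : size (word f) = (\sum_i size (nth [::] F (f i)))%N.
    by rewrite size_flatten /shape -map_comp sumnE big_map big_enum.
  have swl f : (k <= size (word f))%N.
    rewrite sw; apply: (@leq_trans (\sum_(i < k) 1)%N).
      by rewrite sum1_card card_ord.
    by apply: leq_sum => i _; rewrite lt0n size_eq0; apply/eqP/G_nonempty/FG/Fn.
  have swu f : (size (word f) < (k * M).+1)%N.
    rewrite ltnS sw; apply: (@leq_trans (\sum_(i < k) M)%N).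
      by apply: leq_sum => i _; apply/FM/Fn.
    by rewrite sum_nat_const card_ord.
  have E : 1 <= \sum_(f : {ffun 'I_k -> 'I_m}) expR (- (s * (size (word f))%:R)).
    apply: le_trans (exprn_ege1 k K1) _.
    rewrite /kraft (big_nth [::]) big_mkord -[k in _ ^+ k]card_ord -prodr_const.
    rewrite bigA_distr_bigA /=; apply: ler_sum => f _.
    by rewrite sw -expR_sum sumrN natr_sum mulr_sumr.
  apply: le_trans E _.
  (* A product of k nonempty words has length l >= k, so e^(-s l) <= e^(-a k) e^(-s' l). *)
  apply: (@le_trans _ _ (\sum_(f : {ffun 'I_k -> 'I_m})
      expR (- (a * k%:R)) * expR (- (s' * (size (word f))%:R)))).
    apply: ler_sum => f _; rewrite -expRD ler_expR.
    have : a * k%:R <= a * (size (word f))%:R by rewrite ler_pM2l // ler_nat.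
    by rewrite /a; lra.
  rewrite -mulr_sumr ler_pM2l ?expR_gt0 //.
  (* Group by length: at most k M + 1 lengths occur, and each contributes at most 1. *)
  rewrite (partition_big (fun f => Ordinal (swu f)) predT) //=.
  apply: (@le_trans _ _ (\sum_(l < (k * M).+1) 1)); last first.
    by rewrite sumr_const card_ord.
  apply: ler_sum => l _.
  rewrite (eq_bigr (fun=> expR (- (s' * l%:R)))); last by move=> f /eqP <-.
  rewrite sumr_const -[_ *+ _]mulr_natl expRN ler_pdivrMr ?expR_gt0 // mul1r.
  have [lN|Nl] := ltnP l N.
    rewrite eq_card0 ?expR_ge0 // => f; rewrite !inE; apply/negbTE/eqP => /= e.
    by have := swl f; rewrite e leqNgt (leq_trans lN Nk).
  apply: le_trans (hN _ Nl); rewrite ler_nat cardE -(size_map word).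
  apply: uniq_leq_size => [|w /mapP [f]].
    rewrite map_inj_in_uniq ?enum_uniq // => f f' _ _ e.
    have : parts f = parts f'.
      apply: (flatten_inj G_nonempty Gu (FG _ gF)) => //; try by move=> u /pF /FG.
      by rewrite !size_map.
    move=> /eq_in_map e'; apply/ffunP => i; apply: val_inj.
    have /eqP := e' i (mem_enum _ _); rewrite nth_uniq //.
    by move=> /eqP.
  rewrite mem_enum unfold_in /= => /eqP <- ->; apply/mem_wlist; split=> //.
  rewrite /coded_shift language_closure.
  by apply: (language_concatenations G_nonempty (FG _ gF)) => u /pF /FG.
(* For such k the quadratic term (a k)^2 / 2 of e^(a k) already exceeds k M. *)
have [k Nk kM] : exists2 k, (N <= k)%N & 2 * M%:R < a ^+ 2 * k%:R.
  exists (maxn N (Num.truncn (2 * M%:R / a ^+ 2)).+1); first by rewrite leq_maxl.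
  rewrite -ltr_pdivrMl ?exprn_gt0 // mulrC.
  apply: lt_le_trans (truncnS_gt _) _.
  by rewrite ler_nat leq_maxr.
have k0 : 0 < k%:R :> R.
  rewrite ltr0n lt0n; apply/eqP => k0; move: kM; rewrite k0 mulr0.
  by apply/negP; rewrite -leNgt mulr_ge0.
have := key k Nk; rewrite expRN mulrC ler_pdivlMr ?expR_gt0 // mul1r.
rewrite -natr1 natrM => h2.
have := @expR_ge1Dxn R (a * k%:R) 1 (mulr_ge0 (ltW a0) (ler0n _ _)).
rewrite (_ : 2`! = 2)%N // exprMn => h1.
have : (a ^+ 2 * k%:R ^+ 2) / 2 <= k%:R * M%:R by lra.
rewrite ler_pdivrMr // expr2 mulrA -subr_ge0.
have : 0 < k%:R * (a ^+ 2 * k%:R - 2 * M%:R) by rewrite mulr_gt0 // subr_gt0.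
lra.
Qed.

Variable s : R.
Hypothesis s_ge0 : 0 <= s.
Hypothesis kraft_le1 : forall F, uniq F -> (forall g, g \in F -> G g) -> kraft s F <= 1.

(** Strong induction, stripping the first generator [g]: what is left has length n - |g|, and the
    bounds add up to e^(s n) times a Kraft sum. *)
Lemma star_count_le n : (size (wlist (star G) n))%:R <= expR (s * n%:R).
Proof.
elim/ltn_ind: n => -[|n] IH.
  rewrite mulr0 expR0 (ler_nat _ _ 1%N).
  apply: (@uniq_leq_size _ _ [:: [::]]) (wlist_uniq _ _) _ => w /mem_wlist [/size0nil -> _].
  by rewrite inE.
set L := n.+1.
pose F := undup [seq g <- flatten [seq words l | l <- iota 0 L.+1] | `[< G g >]].
have FG g : g \in F -> G g by rewrite mem_undup mem_filter => /andP[/asboolP].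
have GF g : G g -> (size g <= L)%N -> g \in F.
  move=> Gg gL; rewrite mem_undup mem_filter; apply/andP; split; first exact/asboolP.
  apply/flattenP; exists (words (size g)); last by rewrite mem_words.
  by apply: map_f; rewrite mem_iota.
pose T := [seq g ++ w | g <- F, w <- wlist (star G) (L - size g)].
apply: (@le_trans _ _ (size T)%:R).
  rewrite ler_nat; apply: uniq_leq_size (wlist_uniq _ _) _ => w /mem_wlist [sw [r]].
  case: r => [|g r] Gr e; first by move: sw; rewrite -e.
  have Gg : G g by apply: Gr; rewrite inE eqxx.
  rewrite -e /=; apply/allpairsPdep; exists g, (flatten r); split=> //.
    by apply: GF => //; rewrite -sw -e /= size_cat leq_addr.
  apply/mem_wlist; split; first by rewrite -sw -e /= size_cat addKn.
  by exists r => // u ur; apply: Gr; rewrite inE ur orbT.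
rewrite size_allpairs_dep sumnE big_map natr_sum.
apply: (@le_trans _ _ (\sum_(g <- F) expR (s * L%:R) * expR (- (s * (size g)%:R)))).
  rewrite big_seq [leRHS]big_seq; apply: ler_sum => g gF.
  have g0 : (0 < size g)%N by rewrite lt0n size_eq0; apply/eqP/G_nonempty/FG.
  apply: le_trans (IH _ _) _; first by rewrite -/L ltn_subrL g0.
  rewrite -expRD ler_expR.
  have [gL|Lg] := leqP (size g) L; first by rewrite natrB //; lra.
  exfalso; move: gF; rewrite mem_undup mem_filter => /andP[_ /flattenP [ws /mapP [l]]].
  by rewrite mem_iota => lL ->; rewrite mem_words => /eqP e; lia.
rewrite -mulr_sumr ler_piMr ?expR_ge0 //.
by apply: kraft_le1 => //; apply: undup_uniq.
Qed.

Definition near_star (N : nat) : set (seq A) := [set w | exists p z q,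
  [/\ (size p <= N)%N, (size q <= N)%N, star G z & w = p ++ z ++ q]].

(** The finitely many pairs of ends cost a constant factor; the middle is no longer than n, and s >=
    0. *)
Lemma near_star_count_le N : exists2 C : R, 1 <= C &
  forall n, (size (wlist (near_star N) n))%:R <= C * expR (s * n%:R).
Proof.
pose P := flatten [seq words l | l <- iota 0 N.+1].
have inP w : (size w <= N)%N -> w \in P.
  move=> wN; apply/flattenP; exists (words (size w)); last by rewrite mem_words.
  by apply: map_f; rewrite mem_iota.
have P1 : 1 <= (size P)%:R :> R.
  by rewrite ler1n; have := inP [::] isT; case: (P).
exists ((size P)%:R * (size P)%:R); first by rewrite mulr_ege1.
move=> n; pose Q (p : seq A) := [seq z ++ q | q <- P, z <- wlist (star G) (n - size p - size q)].
pose T := [seq p ++ w | p <- P, w <- Q p].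
apply: (@le_trans _ _ (size T)%:R).
  rewrite ler_nat; apply: uniq_leq_size (wlist_uniq _ _) _ => w.
  move=> /mem_wlist [sw [p [z [q [pN qN Gz ew]]]]].
  apply/allpairsPdep; exists p, (z ++ q); split=> //; first exact: inP.
  apply/allpairsPdep; exists q, z; split=> //; first exact: inP.
  by apply/mem_wlist; split=> //; rewrite -sw ew !size_cat; rewrite addKn addnK.
have QC p : (size (Q p))%:R <= (size P)%:R * expR (s * n%:R).
  rewrite size_allpairs_dep sumnE big_map natr_sum.
  apply: (@le_trans _ _ (\sum_(q <- P) expR (s * n%:R))); last first.
    by rewrite big_const_seq count_predT iter_addr_0 mulr_natl.
  apply: ler_sum => q _; apply: le_trans (star_count_le _) _.
  by rewrite ler_expR ler_wpM2l // ler_nat; lia.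
rewrite size_allpairs_dep sumnE big_map natr_sum.
apply: (@le_trans _ _ (\sum_(p <- P) (size P)%:R * expR (s * n%:R))).
  by apply: ler_sum => p _.
by rewrite big_const_seq count_predT iter_addr_0 -[_ *+ _]mulr_natl mulrA.
Qed.

End Entropy.
End Counting.

(** * Borel measurability of the set of concatenations *)

Lemma bigcup_unpickle (T : Type) (J : countType) (F : J -> set T) :
  \bigcup_i F i = \bigcup_k oapp F set0 (unpickle k).
Proof.
apply/seteqP; split=> x [i _ Fx]; first by exists (pickle i) => //; rewrite pickleK.
by case: (unpickle i) Fx => // j Fx; exists j.
Qed.

Section CountableUnions.
Context {d : measure_display} {T : measurableType d} {J : countType}.

Lemma countable_bigcup_measurable (F : J -> set T) :
  (forall i, measurable (F i)) -> measurable (\bigcup_i F i).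
Proof.
move=> mF; rewrite bigcup_unpickle; apply: bigcupT_measurable => k.
by case: (unpickle k) => [i|] /=; [exact: mF|exact: measurable0].
Qed.

Lemma countable_bigcap_measurable (F : J -> set T) :
  (forall i, measurable (F i)) -> measurable (\bigcap_i F i).
Proof.
move=> mF; rewrite -[X in measurable X]setCK setC_bigcap; apply: measurableC.
by apply: countable_bigcup_measurable => i; apply: measurableC.
Qed.

End CountableUnions.

(** * Separation and measurability of the image of the branches of a tree *)

Section LusinSouslin.
Context {d : measure_display} {T : measurableType d} {J : countType} (i0 : J).
Implicit Types (s : seq J) (b : nat -> J).

Definition separable (X Y : set T) : Prop :=
  exists2 B, measurable B & X `<=` B /\ Y `&` B = set0.

(** Take the union over i of the intersections over j of the given separators. *)
Lemma separable_bigcup (X Y : set T) (P Q : J -> set T) :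
  X `<=` \bigcup_i P i -> Y `<=` \bigcup_i Q i ->
  (forall i j, separable (P i) (Q j)) -> separable X Y.
Proof.
move=> XP YQ hF.
have /choice [B hB] : forall p : J * J, exists B, measurable B /\
    P p.1 `<=` B /\ Q p.2 `&` B = set0.
  by move=> [i j]; have [B mB h] := hF i j; exists B.
exists (\bigcup_i \bigcap_j B (i, j)).
  apply: countable_bigcup_measurable => i; apply: countable_bigcap_measurable => j.
  exact: (hB (i, j)).1.
split=> [x /XP [i _ Px]|].
  by exists i => // j _; apply: (hB (i, j)).2.1.
rewrite -subset0 => x [/YQ [j _ Qx] [i _ /(_ j I) Bx]].
by have [_ [_]] := hB (i, j); rewrite -subset0 => h; apply: (h x).
Qed.

(* [P s] is the image of the branches through the node [s] of a tree, and [C s]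
   a measurable set containing it. *)
Variables P C : seq J -> set T.
Hypothesis P_split : forall s, P s `<=` \bigcup_i P (rcons s i).
Hypothesis C_mono : forall s i, C (rcons s i) `<=` C s.
Hypothesis C_measurable : forall s, measurable (C s).
Hypothesis PC : forall s, P s `<=` C s.
Hypothesis C_separates : forall b b',
  (forall n, C (mkseq b n) `&` C (mkseq b' n) !=set0) -> b = b'.
Hypothesis C_closed : forall b x, (forall n, C (mkseq b n) x) -> P [::] x.

Lemma C_mono_mkseq b m n : (m <= n)%N -> C (mkseq b n) `<=` C (mkseq b m).
Proof.
move=> /subnK <-; elim: (n - m)%N => // k IH; rewrite addSn mkseqS.
exact: subset_trans (@C_mono _ _) IH.
Qed.

Lemma mkseq_branch (s : nat -> seq J) b : (forall n, size (s n) = n) ->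
  (forall n, s n.+1 = rcons (s n) (b n)) -> forall n, mkseq b n = s n.
Proof.
move=> ss sS; elim=> [|n IH]; first by have /size0nil -> := ss 0%N.
by rewrite mkseqS IH sS.
Qed.

(* A pair of nodes that is not separable has a pair of children that is not;
   following such children down produces two branches that [C] does not
   separate. *)
Lemma nodes_separable s s' : size s = size s' -> s <> s' -> separable (P s) (P s').
Proof.
move=> ss' ne; apply: contrapT => nsep.
pose N (p : seq J * seq J) := ~ separable (P p.1) (P p.2).
have next (p : seq J * seq J) : exists q : J * J, N p -> N (rcons p.1 q.1, rcons p.2 q.2).
  apply: contrapT => /forallNP h.
  have Np : N p by apply: contrapT => hp; apply: (h (i0, i0)).
  apply: Np; apply: (separable_bigcup (@P_split p.1) (@P_split p.2)) => i j.
  by apply: contrapT => hij; apply: (h (i, j)) => _.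
have [f hf] := choice next.
pose st k := iter k (fun p => (rcons p.1 (f p).1, rcons p.2 (f p).2)) (s, s').
have Nst k : N (st k) by elim: k => // k IH; apply: hf.
have [sz1 sz2] : (forall k, size (st k).1 = size s + k)%N /\
                 (forall k, size (st k).2 = size s + k)%N.
  by split; elim=> [|k IH]; rewrite ?addn0 //= size_rcons IH addnS.
pose b n := if (n < size s)%N then nth i0 s n else (f (st (n - size s)%N)).1.
pose b' n := if (n < size s)%N then nth i0 s' n else (f (st (n - size s)%N)).2.
have e0 : mkseq b (size s) = s.
  apply: (@eq_from_nth _ i0); rewrite size_mkseq // => i ni.
  by rewrite nth_mkseq // /b ni.
have e0' : mkseq b' (size s) = s'.
  apply: (@eq_from_nth _ i0); rewrite size_mkseq // => i ni.
  by rewrite nth_mkseq // /b' ni.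
have eb k : mkseq b (size s + k) = (st k).1 /\ mkseq b' (size s + k) = (st k).2.
  elim: k => [|k [IH1 IH2]]; first by rewrite addn0.
  rewrite addnS !mkseqS IH1 IH2 /b /b' ltnNge leq_addr /=.
  by rewrite addKn.
suff bb : b = b' by apply: ne; rewrite -e0 -e0' bb.
apply: C_separates => n; apply/set0P/negP => /eqP Cn.
have nn : (n <= size s + n)%N by rewrite leq_addl.
have [e1 e2] := eb n.
apply: (Nst n); exists (C (mkseq b n)) => //; split.
  by rewrite -e1; apply: (subset_trans (@PC _)); apply: C_mono_mkseq.
rewrite -subset0 -Cn => x [Px Cx]; split=> //.
by apply: (C_mono_mkseq nn); apply: PC; rewrite e2.
Qed.

(** Separators of nodes of equal length give disjoint measurable sets [D s] around the [P s]. A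
    point lying in one of these at every level follows a branch, and [C_closed] brings it back to [P
    [::]]. *)
Theorem branches_measurable : measurable (P [::]).
Proof.
have /choice [S hS] : forall p : seq J * seq J, exists B, measurable B /\
    (size p.1 = size p.2 -> p.1 <> p.2 -> P p.1 `<=` B /\ P p.2 `&` B = set0).
  move=> [s s'] /=; have [e|ne] := pselect (size s = size s' /\ s <> s').
    by have [B mB h] := nodes_separable e.1 e.2; exists B.
  by exists set0; split=> // e1 e2; case: ne.
(* [S (s, s')] contains [P s] and misses [P s']; removing [S (s', s)] as well makes the sets [D s]
   and [D s'] disjoint. *)
pose D s := C s `&` \bigcap_s' (if (size s == size s') && (s != s')
  then S (s, s') `\` S (s', s) else setT).
have mD s : measurable (D s).
  apply: measurableI => //; rewrite -[X in measurable X]setCK setC_bigcap.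
  apply: measurableC.
  pose F (s' : seq J) := ~` (if (size s == size s') && (s != s')
    then S (s, s') `\` S (s', s) else setT).
  apply: countable_bigcup_measurable => s'.
  rewrite /F; apply: measurableC; case: ifP => _; last exact: measurableT.
  by apply: measurableD; [case: (hS (s, s'))|case: (hS (s', s))].
have PD s : P s `<=` D s.
  move=> x Px; split; first exact: PC.
  move=> s' _; case: ifP => // /andP[/eqP e /eqP ne].
  split; first by apply: ((hS (s, s')).2 e ne).1.
  move=> Sx; have [_] := (hS (s', s)).2 (esym e) (nesym ne).
  by rewrite -subset0 => h; apply: (h x).
have Ddisj s s' x : size s = size s' -> D s x -> D s' x -> s = s'.
  move=> e [_ /(_ s' I) Dx] [_ /(_ s I) Dx']; apply: contrapT => /eqP ne.
  have ne' : s' != s by rewrite eq_sym.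
  by move: Dx Dx'; rewrite e eqxx ne ne' /= => -[_ h] [].
(* Prefixes are included so that the nodes found at different levels extend each other. *)
pose E s := \bigcap_(k in [set k | (k <= size s)%N]) D (take k s).
have mE s : measurable (E s) by apply: bigcap_measurable => //; exists 0%N.
pose U n := \bigcup_s (if size s == n then E s else set0).
have mU n : measurable (U n).
  apply: countable_bigcup_measurable => s.
  by case: ifP => _ //; apply: measurable0.
suff -> : P [::] = \bigcap_n U n by apply: bigcapT_measurable.
apply/seteqP; split=> x.
  move=> Px n _.
  have [s [ss hs]] : exists s, size s = n /\ forall k, (k <= n)%N -> P (take k s) x.
    elim: n => [|n [s [ss hs]]].
      by exists [::]; split=> // k; rewrite leqn0 => /eqP ->.
    have /P_split [i _ Pi] : P s x by rewrite -(take_size s) ss; apply: hs.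
    exists (rcons s i); rewrite size_rcons ss; split=> // k.
    rewrite leq_eqVlt => /orP[/eqP ->|kn]; first by rewrite take_oversize ?size_rcons ?ss.
    by rewrite -cats1 takel_cat ?ss //; apply: hs.
  by exists s => //; rewrite ss eqxx => k; rewrite /= ss => /hs/PD.
move=> Ux; have /choice [s hs] : forall n, exists s, size s = n /\ E s x.
  by move=> n; have [s _] := Ux n I; case: eqP => // ss Es; exists s.
have st n k : (k <= n)%N -> take k (s n) = s k.
  move=> kn; have [sk Ek] := hs k; have [sn En] := hs n.
  apply: (Ddisj _ _ x); first by rewrite size_takel ?sn // sk.
    by apply: En; rewrite /= sn.
  have := Ek k; rewrite /= sk => /(_ (leqnn k)).
  by rewrite take_oversize ?sk.
have sE := @mkseq_branch s (fun n => nth i0 (s n.+1) n) (fun n => (hs n).1).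
apply: (@C_closed (fun n => nth i0 (s n.+1) n)) => n; rewrite sE; last first.
  move=> m; rewrite -(st m.+1 m) // -take_nth; first by rewrite take_oversize ?(hs _).1.
  by rewrite (hs _).1.
have [sn /(_ n)] := hs n; rewrite /= sn take_oversize ?sn // => -[] //.
Qed.

End LusinSouslin.

(** * Cylinders and Borel sets of the full shift *)

Section ShiftSpace.
Variable A : alphabetType.
Implicit Types (x y : full_shift A).

Definition cylinder (i : int) (w : seq A) : set (full_shift A) :=
  [set x | subword x i (size w) = w].

Definition window (n : nat) x : seq A := subword x (- Posz n) (2 * n + 1).

Lemma window_le m n x y : (m <= n)%N -> window n x = window n y -> window m x = window m y.
Proof.
move=> mn /subword_eqP e; apply/subword_eqP => j jm.
by have := e (n - m + j)%N; rewrite (_ : - Posz n + _ = - Posz m + Posz j); [apply|]; lia.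
Qed.

(** The product topology is the supremum of those induced by the coordinates, and every coordinate
    lies in a large window: the sets [B n] generate a filter converging to [x]. *)
Lemma nbhs_window x (U : set (full_shift A)) : nbhs x U ->
  exists n, [set y | window n y = window n x] `<=` U.
Proof.
move=> Ux; pose B n := [set y | window n y = window n x].
pose F := filter_from [set: nat] B.
have FF : ProperFilter F.
  apply: filter_from_proper; last by move=> n _; exists x.
  apply: filter_from_filter; first by exists 0%N.
  move=> m n _ _; exists (maxn m n) => // y yx; split.
    by apply: window_le yx; rewrite leq_maxl.
  by apply: window_le yx; rewrite leq_maxr.
suff Fx : F --> (x : prod_topology (fun _ : int => discrete_topology A)).
  by have [n _ h] := Fx U Ux; exists n.
apply/cvg_sup => i V [W [[C oC <-] Cx] WV].
exists `|i|%N => // y yx; apply: WV; rewrite /preimage /=.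
suff -> : y i = x i by [].
have [j jn ej] : exists2 j, (j < 2 * `|i| + 1)%N & i = - Posz `|i|%N + Posz j.
  by case: (i) => n; [exists (n + n)%N|exists 0%N]; lia.
by move/subword_eqP: yx => /(_ j jn); rewrite -ej.
Qed.

Lemma measurable_open (U : set (full_shift A)) : open U -> measurable U.
Proof. exact: sub_sigma_algebra. Qed.

Lemma open_cylinder i w : open (cylinder i w).
Proof.
rewrite openE => x e; apply: filterS (nbhs_subword x i (size w)) => y /= ey.
by rewrite /cylinder /= ey.
Qed.

Lemma measurable_cylinder i w : measurable (cylinder i w).
Proof. by apply: measurable_open; apply: open_cylinder. Qed.

(** The union is over a countable type, so cylinders generate the Borel sets. *)
Lemma open_bigcup_cylinder (U : set (full_shift A)) : open U ->
  U = \bigcup_(p : nat * seq A) (if `[< size p.2 = 2 * p.1 + 1 /\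
    cylinder (- Posz p.1) p.2 `<=` U >]%N then cylinder (- Posz p.1) p.2 else set0).
Proof.
move=> oU; apply/seteqP; split=> x; last first.
  by move=> [[n w] _ /=]; case: asboolP => // -[_ h] /h.
rewrite openE in oU => /oU /nbhs_window [n hn].
exists (n, window n x) => //=; rewrite asboolT; last first.
  rewrite size_subword; split=> // y; rewrite /cylinder /= size_subword; exact: hn.
by rewrite /cylinder /= size_subword.
Qed.

Lemma borel_ind (D : set (set (full_shift A))) :
  D set0 -> (forall B, D B -> D (~` B)) -> (forall F : nat -> set (full_shift A),
    (forall n, D (F n)) -> D (\bigcup_n F n)) ->
  (forall n w, size w = (2 * n + 1)%N -> D (cylinder (- Posz n) w)) ->
  forall B, measurable B -> D B.
Proof.
move=> D0 DC DU Dc; apply: smallest_sub.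
  by split=> // B /DC; rewrite setTD.
move=> U /open_bigcup_cylinder ->.
rewrite bigcup_unpickle; apply: DU => k; case: (unpickle k) => // p /=.
by case: asboolP => // -[/Dc].
Qed.

Lemma shift_by_preimage_cylinder m i w :
  shift_by m @^-1` (cylinder i w) = cylinder (i + m) w.
Proof. by apply/seteqP; split=> x; rewrite /preimage /cylinder /= subword_shift_by. Qed.

Lemma measurable_shift_by m (B : set (full_shift A)) :
  measurable B -> measurable (shift_by m @^-1` B).
Proof.
apply: (@borel_ind (fun B => measurable (shift_by m @^-1` B))) => [|C mC|F mF|n w _].
- by rewrite preimage_set0; apply: measurable0.
- by rewrite preimage_setC; apply: measurableC.
- by rewrite preimage_bigcup; apply: bigcupT_measurable.
- by rewrite shift_by_preimage_cylinder; apply: measurable_cylinder.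
Qed.

Section Boundary.
Variable G : set (seq A).
Hypothesis G_nonempty : forall w, G w -> w <> [::].
Hypothesis G_unique : unique_representation G.

Let pairs := seq (seq A * seq A).

(** A node pairs the first words read rightwards from 0 with the first ones read leftwards; these
    are the points with a full factorization through it. *)
Definition partial_fit (s : pairs) : set (full_shift A) :=
  [set x | exists v w, [/\ (forall n, G (v n)), (forall n, G (w n)), fits x v w &
    s = mkseq (fun k => (v k, w k)) (size s)]].

(** Only the words of the node are read here. The value [set0] forces the branches to run through
    generators. *)
Definition partial_cylinder (s : pairs) : set (full_shift A) :=
  if `[< forall p, p \in s -> G p.1 /\ G p.2 >] then
    cylinder 0 (flatten (unzip1 s)) `&`
    cylinder (- Posz (size (flatten (rev (unzip2 s))))) (flatten (rev (unzip2 s)))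
  else set0.

Lemma partial_cylinder_mkseq (b : nat -> seq A * seq A) n x :
  partial_cylinder (mkseq b n) x <->
  (forall k, (k < n)%N -> G (b k).1 /\ G (b k).2) /\
  (subword x 0 (size (rcat (fst \o b) n)) = rcat (fst \o b) n /\
   subword x (- Posz (size (lcat (snd \o b) n))) (size (lcat (snd \o b) n)) =
     lcat (snd \o b) n).
Proof.
rewrite /partial_cylinder /unzip1 /unzip2 /mkseq -!map_comp -!/(mkseq _ n).
rewrite -/(rcat _ n) -/(lcat _ n); case: asboolP => h.
  split=> [[h1 h2]|[_ [h1 h2]] //]; split=> // k kn.
  by apply: h; apply/mapP; exists k => //; rewrite mem_iota.
split=> // -[h' _]; case: h => p /mapP [k]; rewrite mem_iota => /andP[_ kn] ->.
exact: h'.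
Qed.

(** A branch is a pair of sequences of generators. If the cylinders of two branches meet at every
    level, the point built from the first also reads the second, and uniqueness identifies them. *)
Lemma boundary0_measurable : measurable (boundary0 G).
Proof.
have -> : boundary0 G = partial_fit [::].
  apply/seteqP; split=> x [v [w]]; last by move=> [Gv Gw fx _]; exists v, w.
  by move=> [Gv [Gw fx]]; exists v, w.
apply: (@branches_measurable _ _ _ ([::], [::]) partial_fit partial_cylinder).
- move=> s x [v [w [Gv Gw fx es]]]; exists (v (size s), w (size s)) => //.
  by exists v, w; split=> //; rewrite size_rcons mkseqS -es.
- move=> s i x; rewrite /partial_cylinder; case: asboolP => // h [].
  rewrite /unzip1 /unzip2 !map_rcons rev_rcons flatten_rcons /= => /subword_catP [h1 _].
  move=> /subword_catP [_ h2]; rewrite asboolT; last first.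
    by move=> p ps; apply: h; rewrite mem_rcons inE ps orbT.
  split=> //; move: h2; rewrite /cylinder /= size_cat.
  by rewrite PoszD opprD addrAC addNr add0r.
- move=> s; rewrite /partial_cylinder; case: asboolP => _; last exact: measurable0.
  by apply: measurableI; apply: measurable_cylinder.
- move=> s x [v [w [Gv Gw fx]]]; move: (size s) => n ->.
  by apply/partial_cylinder_mkseq; split=> [k _|]; [split; [exact: Gv|exact: Gw]|exact: fx].
- move=> b b' h; have hG n : G (b n).1 /\ G (b n).2.
    by have [x [/partial_cylinder_mkseq [+ _] _]] := h n.+1; apply.
  have hG' n : G (b' n).1 /\ G (b' n).2.
    by have [x [_ /partial_cylinder_mkseq [+ _]]] := h n.+1; apply.
  have n1 k : (fst \o b) k <> [::] by apply: G_nonempty; apply: (hG k).1.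
  have n2 k : (snd \o b) k <> [::] by apply: G_nonempty; apply: (hG k).2.
  have [x fx] := fits_exists n1 n2.
  have fx' : fits x (fst \o b') (snd \o b').
    move=> n; set r := rcat _ n; set l := lcat _ n.
    (* The first [m] words of [b] on each side cover [-m, m[, which contains the first [n] words of
       [b'] on each side. *)
    pose m := maxn n (maxn (size r) (size l)).
    have [y [/partial_cylinder_mkseq [_ [y1 y2]] /partial_cylinder_mkseq [_ [y3 y4]]]] := h m.
    have [x1 x2] := fx m.
    have agree (i : int) : - Posz m <= i -> i < Posz m -> x i = y i.
      move=> mi im; have [i0|i0] := leP 0 i.
        have ir : (`|i| < size (rcat (fst \o b) m))%N.
          by apply: leq_trans (leq_size_rcat _ n1); lia.
        have /subword_eqP /(_ _ ir) := etrans x1 (esym y1).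
        by rewrite (_ : 0 + _ = i) //; lia.
      set L := size (lcat (snd \o b) m) in x2 y2.
      have mL : (m <= L)%N by apply: leq_size_lcat.
      have iL : (`|(Posz L + i)%R| < L)%N by lia.
      have /subword_eqP /(_ _ iL) := etrans x2 (esym y2).
      by rewrite (_ : - Posz L + _ = i) //; lia.
    have nm : (n <= m)%N by rewrite leq_maxl.
    have rm : (size r <= m)%N by rewrite /m; lia.
    have lm : (size l <= m)%N by rewrite /m; lia.
    split.
      transitivity (subword y 0 (size r)).
        by apply/subword_eqP => j jr; apply: agree; lia.
      by move: y3; rewrite -(subnKC nm) rcatD => /subword_catP [].
    transitivity (subword y (- Posz (size l)) (size l)).
      by apply/subword_eqP => j jr; apply: agree; lia.
    move: y4; have [z ez] : exists z, lcat (snd \o b') m = z ++ l.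
      rewrite -(subnK nm) /l; elim: (m - n)%N => [|k [z IH]]; first by exists [::].
      by exists ((snd \o b') (k + n)%N ++ z); rewrite addSn lcatS IH catA.
    rewrite ez => /subword_catP [_]; rewrite size_cat.
    by rewrite PoszD opprD addrAC addNr add0r.
  have [e1 e2] := fits_unique G_nonempty G_unique (fun n => (hG n).1)
    (fun n => (hG n).2) (fun n => (hG' n).1) (fun n => (hG' n).2) fx fx'.
  apply/funext => n; rewrite [b n]surjective_pairing [b' n]surjective_pairing.
  by congr pair; [have := congr1 (fun f => f n) e1|have := congr1 (fun f => f n) e2].
- move=> b x h; exists (fst \o b), (snd \o b); split=> //.
  + by move=> n; have /partial_cylinder_mkseq [/(_ n (ltnSn n)) []] := h n.+1.
  + by move=> n; have /partial_cylinder_mkseq [/(_ n (ltnSn n)) []] := h n.+1.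
  + by move=> n; have /partial_cylinder_mkseq [_] := h n.
Qed.

Definition boundary_in (N : nat) : set (full_shift A) :=
  \bigcup_(a in [set a | (a < N)%N]) shift_by (Posz a) @^-1` (boundary0 G).

Lemma boundary_in_measurable N : measurable (boundary_in N).
Proof.
rewrite /boundary_in bigcup_mkcond; apply: bigcupT_measurable => a.
case: ifP => _; last exact: measurable0.
by apply: measurable_shift_by; apply: boundary0_measurable.
Qed.

Lemma concatenations_bigcup : concatenations G = \bigcup_N boundary_in N.
Proof.
apply/seteqP; split=> x; last by move=> [N _ [a _]]; apply: boundary0_concatenations.
(* Cuts advance by at least 1, so the cut number |c 0| has a nonnegative coordinate. *)
move=> [u [c h]]; have := written_as_ge G_nonempty 0 `|c 0|%N h.
rewrite add0r; set i := Posz _ => ci; have ci0 : 0 <= c i.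
  by apply: le_trans ci; rewrite /i -lerBlDr sub0r abszE lerNl -normrN ler_norm.
exists (`|c i|%N).+1 => //; exists `|c i|%N => //=.
by rewrite /preimage /= gez0_abs //; apply: boundary_at h.
Qed.

Lemma concatenations_measurable : measurable (concatenations G).
Proof.
by rewrite concatenations_bigcup; apply: bigcupT_measurable => N; apply: boundary_in_measurable.
Qed.

End Boundary.

Lemma coded_shift_measurable (G : set (seq A)) : measurable (coded_shift G).
Proof.
rewrite -[coded_shift G]setCK; apply: measurableC; apply: measurable_open.
by apply: closed_openC; apply: closed_closure.
Qed.

(** The complement is open, hence contains all points sharing some window with [x]; were this window
    in the language, a point of X_seq could be shifted to show it at the centre. *)
Lemma not_coded_shift (G : set (seq A)) x : ~ coded_shift G x ->
  exists n, ~ language (coded_shift G) (window n x).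
Proof.
move=> nx; have o : open (~` coded_shift G) by apply/closed_openC/closed_closure.
rewrite openE in o; have /nbhs_window [n hn] := o x nx.
exists n; rewrite /coded_shift language_closure => -[y Gy [i e]].
have Gy' : concatenations G (shift_by (i + Posz n) y).
  by apply/shift_concatenations.
apply: (hn (shift_by (i + Posz n) y)); last exact: subset_closure.
rewrite /= -e size_subword /window subword_shift_by.
by congr subword; lia.
Qed.

End ShiftSpace.

(** * Metric entropy of measures carried by the concatenations *)

Section Laws.
Context {d : measure_display} {T : measurableType d} {R : realType}.
Variable mu : probability T R.
Implicit Types (I J : finType).

Definition measurable_fibers I (f : T -> I) : Prop :=
  forall i, measurable (f @^-1` [set i]).

Definition law I (f : T -> I) (i : I) : R := fine (mu (f @^-1` [set i])).

Definition entropy_of I (f : T -> I) : R := shannon (law f).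

Lemma measurable_fibers_preimage I (f : T -> I) (D : set I) :
  measurable_fibers f -> measurable (f @^-1` D).
Proof.
move=> mf; have -> : f @^-1` D = \bigcup_(i in D) f @^-1` [set i].
  apply/seteqP; split=> [x Dx|x [i Di /= e]]; first by exists (f x).
  by rewrite /preimage /= e.
rewrite bigcup_mkcond; apply: countable_bigcup_measurable => i.
by case: ifP => _ //; apply: measurable0.
Qed.

Lemma measurable_fibers_comp I J (f : T -> I) (g : I -> J) :
  measurable_fibers f -> measurable_fibers (g \o f).
Proof. by move=> mf j; rewrite comp_preimage; apply: measurable_fibers_preimage. Qed.

Lemma measurable_fibers_pair I J (f : T -> I) (g : T -> J) :
  measurable_fibers f -> measurable_fibers g -> measurable_fibers (fun x => (f x, g x)).
Proof.
move=> mf mg [i j]; have -> : (fun x => (f x, g x)) @^-1` [set (i, j)] =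
    f @^-1` [set i] `&` g @^-1` [set j].
  by apply/seteqP; split=> x /= [h1 h2]; rewrite ?h1 ?h2.
exact: measurableI.
Qed.

Lemma probability_fin B : measurable B -> mu B \is a fin_num.
Proof. by move=> mB; apply: fin_num_measure. Qed.

Lemma law_ge0 I (f : T -> I) i : 0 <= law f i.
Proof. by rewrite fine_ge0. Qed.

Lemma mu_preimage I (f : T -> I) (P : pred I) : measurable_fibers f ->
  mu (f @^-1` [set i | P i]) = (\sum_(i | P i) law f i)%:E.
Proof.
move=> mf; rewrite -big_filter /=.
have : uniq [seq i <- index_enum I | P i] by rewrite filter_uniq // index_enum_uniq.
have -> : [set i | P i] = [set i | i \in [seq i <- index_enum I | P i]].
  by apply/seteqP; split=> i /=; rewrite mem_filter mem_index_enum andbT.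
elim: [seq i <- index_enum I | P i] => [|i s IH] /= us.
  rewrite big_nil; have -> : f @^-1` [set i | i \in [::]] = set0.
    by apply/seteqP; split.
  by rewrite measure0.
move: us => /andP[nis us]; rewrite big_cons EFinD -IH // /law fineK ?probability_fin //.
have -> : f @^-1` [set j | j \in i :: s] = f @^-1` [set i] `|` f @^-1` [set j | j \in s].
  apply/seteqP; split=> x /=; rewrite inE; first by case/orP => [/eqP|]; [left|right].
  by case=> [->|->]; rewrite ?eqxx ?orbT.
rewrite measureU //; first exact: measurable_fibers_preimage.
by rewrite -subset0 => x [/= ->]; apply/negP.
Qed.

Lemma law_pmf I (f : T -> I) : measurable_fibers f -> prob_vector (law f).
Proof.
move=> mf; split=> [i|]; first exact: law_ge0.
apply: EFin_inj; rewrite -(mu_preimage predT mf).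
by rewrite (_ : f @^-1` _ = setT) ?probability_setT //; apply/seteqP; split.
Qed.

Lemma law_comp I J (f : T -> I) (g : I -> J) : measurable_fibers f ->
  law (g \o f) = push_vector g (law f).
Proof.
move=> mf; apply/funext => j; rewrite /law /push_vector.
have -> : (g \o f) @^-1` [set j] = f @^-1` [set i | g i == j].
  by apply/seteqP; split=> x /eqP.
by rewrite (mu_preimage (fun i => g i == j) mf).
Qed.

Lemma entropy_comp_le I J (f : T -> I) (g : I -> J) : measurable_fibers f ->
  entropy_of (g \o f) <= entropy_of f.
Proof.
by move=> mf; rewrite /entropy_of law_comp //; apply: shannon_push_le; apply: law_ge0.
Qed.

Lemma entropy_pair_le I J (f : T -> I) (g : T -> J) :
  measurable_fibers f -> measurable_fibers g ->
  entropy_of (fun x => (f x, g x)) <= entropy_of f + entropy_of g.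
Proof.
move=> mf mg; have mp := measurable_fibers_pair mf mg.
have := shannon_joint_le (f := fst) (g := snd) (law_pmf mp).
by rewrite -!law_comp //; apply; case=> a b [c d'].
Qed.

Lemma entropy_ge0 I (f : T -> I) : measurable_fibers f -> 0 <= entropy_of f.
Proof. by move=> mf; apply/shannon_ge0/law_pmf. Qed.

End Laws.

Section Itineraries.
Context {d : measure_display} {T : measurableType d} {R : realType}.
Variable mu : probability T R.
Variable f : T -> T.
Hypothesis f_measurable : forall B, measurable B -> measurable (f @^-1` B).
Hypothesis f_invariant : forall B, measurable B -> mu (f @^-1` B) = mu B.
Implicit Types (I J : finType).

(** [itinerary] for pieces named by any finite type, such as letters or whole windows. *)
Definition itin I (p : T -> I) n (x : T) : n.-tuple I := [tuple p (iter i f x) | i < n].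

Lemma iter_measurable n B : measurable B -> measurable (iter n f @^-1` B).
Proof.
elim: n B => [|n IH] B mB //.
have -> : iter n.+1 f @^-1` B = iter n f @^-1` (f @^-1` B) by [].
by apply/IH/f_measurable.
Qed.

Lemma iter_invariant n B : measurable B -> mu (iter n f @^-1` B) = mu B.
Proof.
elim: n B => [|n IH] B mB //.
have -> : iter n.+1 f @^-1` B = iter n f @^-1` (f @^-1` B) by [].
by rewrite IH ?f_invariant //; apply: f_measurable.
Qed.

Lemma measurable_fibers_iter I (p : T -> I) n : measurable_fibers p ->
  measurable_fibers (p \o iter n f).
Proof. by move=> mp i; rewrite comp_preimage; apply: iter_measurable. Qed.

Lemma entropy_iter I (p : T -> I) n : measurable_fibers p ->
  entropy_of mu (p \o iter n f) = entropy_of mu p.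
Proof.
move=> mp; congr shannon; apply/funext => i.
by rewrite /law comp_preimage iter_invariant.
Qed.

Lemma itin_measurable I (p : T -> I) n : measurable_fibers p ->
  measurable_fibers (itin p n).
Proof.
move=> mp w; have -> : itin p n @^-1` [set w] =
    \bigcap_(i : 'I_n) ((p \o iter i f) @^-1` [set tnth w i]).
  apply/seteqP; split=> x /=; first by move=> <- i _; rewrite /itin /= tnth_mktuple.
  by move=> h; apply/eq_from_tnth => i; rewrite tnth_mktuple; apply: h.
by apply: countable_bigcap_measurable => i; apply: measurable_fibers_iter.
Qed.

Arguments itin_measurable [I p] n _.

(** The last n pieces form the itinerary of the m-th iterate of the point, whose law is the same by
    invariance. *)
Lemma entropy_itinD I (p : T -> I) m n : measurable_fibers p ->
  entropy_of mu (itin p (m + n)) <= entropy_of mu (itin p m) + entropy_of mu (itin p n).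
Proof.
move=> mp; have mi := itin_measurable (m + n) mp.
have := shannon_tuple_le (law_pmf mu mi); rewrite -!law_comp //.
have -> : @tuple_left _ m n \o itin p (m + n) = itin p m.
  by apply/funext => x; apply: eq_from_tnth => i; rewrite !tnth_mktuple.
have -> : @tuple_right _ m n \o itin p (m + n) = itin p n \o iter m f.
  apply/funext => x; apply: eq_from_tnth => i; rewrite !tnth_mktuple /=.
  by rewrite addnC iterD.
by rewrite -!/(entropy_of _ _) entropy_iter //; apply: itin_measurable.
Qed.

Lemma entropy_itin_le I (p : T -> I) n : measurable_fibers p ->
  entropy_of mu (itin p n) <= n%:R * entropy_of mu p.
Proof.
move=> mp; elim: n => [|n IH].
  rewrite mul0r; apply: le_trans (shannon_le_card (law_pmf mu (itin_measurable 0 mp))) _.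
  by rewrite card_tuple expn0 ln1.
rewrite -add1n; apply: le_trans (entropy_itinD 1 n mp) _.
rewrite natrD mulrDl mul1r; apply: lerD => //.
have -> : itin p 1 = (fun i => [tuple of [:: i]]) \o p.
  by apply/funext => x; apply: eq_from_tnth => i; rewrite tnth_mktuple ord1.
exact: entropy_comp_le.
Qed.

Lemma itin_cvg I (p : T -> I) : measurable_fibers p ->
  exists2 l, entropy_of mu (itin p n) / n%:R @[n --> \oo] --> l &
    forall n, (0 < n)%N -> l <= entropy_of mu (itin p n) / n%:R.
Proof.
move=> mp; apply: fekete => [n|m n]; first exact/entropy_ge0/itin_measurable.
exact: entropy_itinD.
Qed.

(* [e] records the value of [p] where [p] differs from its approximation
   [h \o q], so that [q] and [e] together determine [p]. *)
Lemma entropy_itin_approx I J (p : T -> I) (q : T -> J) (h : J -> I) n :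
  measurable_fibers p -> measurable_fibers q ->
  let e x := if p x == h (q x) then None else Some (p x) in
  measurable_fibers e /\
  entropy_of mu (itin p n) <= entropy_of mu (itin q n) + n%:R * entropy_of mu e.
Proof.
move=> mp mq e.
have me : measurable_fibers e.
  have -> : e = (fun ij => if ij.1 == h ij.2 then None else Some ij.1) \o (fun x => (p x, q x)).
    by [].
  by apply: measurable_fibers_comp; apply: measurable_fibers_pair.
split=> //.
pose dec (t : n.-tuple J * n.-tuple (option I)) : n.-tuple I :=
  [tuple (if tnth t.2 i is Some a then a else h (tnth t.1 i)) | i < n].
have -> : itin p n = dec \o (fun x => (itin q n x, itin e n x)).
  apply/funext => x; apply: eq_from_tnth => i; rewrite /dec /itin /= !tnth_mktuple /= /e.
  by case: eqP.
have mqn := itin_measurable n mq; have men := itin_measurable n me.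
apply: le_trans (entropy_comp_le _ _ (measurable_fibers_pair mqn men)) _.
apply: le_trans (entropy_pair_le _ mqn men) _.
by rewrite lerD2l; apply: entropy_itin_le.
Qed.

End Itineraries.
Arguments itin_measurable {d T f} _ {I p} n _.

Section ContinuityFromBelow.
Context {d : measure_display} {T : measurableType d} {R : realType}.
Variable mu : probability T R.

Lemma fine_muS (B C : set T) : measurable B -> measurable C -> B `<=` C ->
  fine (mu B) <= fine (mu C).
Proof.
move=> mB mC BC; rewrite fine_le ?probability_fin //.
by apply: le_measure; rewrite ?inE.
Qed.

Lemma fine_muU_le (B C : set T) : measurable B -> measurable C ->
  fine (mu (B `|` C)) <= fine (mu B) + fine (mu C).
Proof.
move=> mB mC; rewrite -fineD ?probability_fin // fine_le ?probability_fin //.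
- exact: measurableU.
- by rewrite fin_numD !probability_fin.
- exact: measureU2.
Qed.

Lemma fine_muC (B : set T) : measurable B -> fine (mu (~` B)) = 1 - fine (mu B).
Proof. by move=> mB; rewrite probability_setC // fineB ?probability_fin. Qed.

Lemma mu_bigcup_near (F : nat -> set T) (e : R) : (forall n, measurable (F n)) ->
  nondecreasing_seq F -> 0 < e ->
  exists N, fine (mu (\bigcup_n F n)) - e < fine (mu (F N)).
Proof.
move=> mF ndF e0; have mU := bigcupT_measurable F mF.
have h := nondecreasing_cvg_mu (mu := mu) mF mU ndF.
have {h} : mu \o F @ \oo --> (fine (mu (\bigcup_n F n)))%:E.
  by rewrite fineK ?probability_fin.
move=> /fine_cvg /cvgrPdist_lt /(_ e e0).
move=> [N _ /(_ N (leqnn N)) /=] /ltr_normlW; rewrite /comp => h; exists N; lra.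
Qed.

End ContinuityFromBelow.

(** * Approximation by windows and the entropy bound on X_seq *)

Section ShiftMeasures.
Variables (R : realType) (A : alphabetType).
Variable mu : probability (full_shift A) R.
Local Notation shift := (@left_shift A).

Lemma iter_left_shift n x : iter n shift x = shift_by (Posz n) x.
Proof.
elim: n => [|n IH]; apply/funext => i; first by rewrite /= /shift_by addr0.
by rewrite iterS IH /left_shift /shift_by; congr x; lia.
Qed.

Lemma measurable_left_shift B : measurable B -> measurable (shift @^-1` B).
Proof. exact: (@measurable_shift_by _ 1). Qed.

Definition symbol0 (x : full_shift A) : A := x 0.

Lemma val_itin_symbol0 n x : tval (itin shift symbol0 n x) = subword x 0 n.
Proof.
apply: (@eq_from_nth _ point); first by rewrite size_tuple size_subword.
move=> i; rewrite size_tuple => ni; rewrite nth_subword //.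
rewrite (nth_map (Ordinal ni)) ?size_enum_ord // iter_left_shift.
by rewrite /symbol0 /shift_by nth_enum_ord.
Qed.

Lemma symbol0_measurable : measurable_fibers symbol0.
Proof.
move=> a; rewrite (_ : _ @^-1` _ = cylinder 0 [:: a]); first exact: measurable_cylinder.
apply/seteqP; split=> x; rewrite /cylinder /symbol0 /subword /= addr0.
  by move=> ->.
by case.
Qed.

Definition symdiff (B C : set (full_shift A)) := (B `\` C) `|` (C `\` B).

Lemma measurable_symdiff B C : measurable B -> measurable C -> measurable (symdiff B C).
Proof. by move=> mB mC; apply: measurableU; apply: measurableD. Qed.

Definition determined (m : nat) (C : set (full_shift A)) : Prop :=
  forall x y, window m x = window m y -> C x -> C y.

Lemma determined_measurable m C : determined m C -> measurable C.
Proof.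
move=> dC; have -> : C = \bigcup_w (if `[< exists2 x, C x & window m x = w >]
    then cylinder (- Posz m) w else set0).
  apply/seteqP; split=> x.
    move=> Cx; exists (window m x) => //; rewrite asboolT; last by exists x.
    by rewrite /cylinder /= size_subword.
  move=> [w _]; case: asboolP => // -[y Cy <-]; rewrite /cylinder /= size_subword => e.
  exact: dC Cy.
apply: countable_bigcup_measurable => w; case: asboolP => _; last exact: measurable0.
exact: measurable_cylinder.
Qed.

Definition approximable (B : set (full_shift A)) : Prop := measurable B /\
  forall e : R, 0 < e -> exists m C, determined m C /\ fine (mu (symdiff B C)) < e.

Lemma approximable_determined m C : determined m C -> approximable C.
Proof.
move=> dC; split=> [|e e0]; first exact: determined_measurable dC.
exists m, C; split=> //; rewrite (_ : symdiff C C = set0) ?measure0 //.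
by rewrite /symdiff setDv setU0.
Qed.

Lemma approximableU B B' : approximable B -> approximable B' -> approximable (B `|` B').
Proof.
move=> [mB aB] [mB' aB']; split=> [|e e0]; first exact: measurableU.
have e2 : 0 < e / 2 by rewrite divr_gt0.
have [m [C [dC hC]]] := aB _ e2; have [m' [C' [dC' hC']]] := aB' _ e2.
exists (maxn m m'), (C `|` C'); split.
  move=> x y xy [Cx|Cx]; [left; apply: dC Cx|right; apply: dC' Cx].
    by apply: window_le xy; rewrite leq_maxl.
  by apply: window_le xy; rewrite leq_maxr.
have mC := determined_measurable dC; have mC' := determined_measurable dC'.
have m1 := measurable_symdiff mB mC; have m2 := measurable_symdiff mB' mC'.
apply: (@le_lt_trans _ _ (fine (mu (symdiff B C `|` symdiff B' C')))).
  apply: fine_muS; [apply: measurable_symdiff; exact: measurableU|exact: measurableU|].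
  move=> x [[[Bx|Bx] nC]|[[Cx|Cx] nB]].
  - by left; left; split=> // Cx; apply: nC; left.
  - by right; left; split=> // Cx; apply: nC; right.
  - by left; right; split=> // Bx; apply: nB; left.
  - by right; right; split=> // Bx; apply: nB; right.
apply: le_lt_trans (fine_muU_le _ m1 m2) _; lra.
Qed.

(** The approximable sets form a sigma-algebra containing the cylinders: a countable union is first
    replaced by a finite one at the cost of e/2. *)
Lemma measurable_approximable B : measurable B -> approximable B.
Proof.
apply: borel_ind => [|C [mC aC]|F aF|n w sw].
- by apply: (@approximable_determined 0).
- split=> [|e e0]; first exact: measurableC.
  have [m [D [dD hD]]] := aC e e0; exists m, (~` D); split.
    by move=> x y xy nD Dy; apply: nD; apply: dD Dy.
  rewrite (_ : symdiff _ _ = symdiff C D) //.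
  by apply/seteqP; split=> x [[h1 h2]|[h1 h2]]; [right|left|right|left]; split=> //;
    apply: contrapT.
- have mF n : measurable (F n) by have [] := aF n.
  split=> [|e e0]; first exact: bigcupT_measurable.
  pose U n := \bigcup_(k in [set k | (k < n)%N]) F k.
  have aU n : approximable (U n).
    elim: n => [|n IH].
      rewrite (_ : U 0%N = set0); first by apply: (@approximable_determined 0).
      by apply/seteqP; split=> x // [].
    rewrite (_ : U n.+1 = U n `|` F n); first exact: approximableU.
    apply/seteqP; split=> x.
      move=> [k /=]; rewrite ltnS leq_eqVlt => /orP[/eqP ->|kn] Fx; first by right.
      by left; exists k.
    by move=> [[k /= kn Fx]|Fx]; [exists k => //=; apply: ltnW|exists n => /=].
  have eU : \bigcup_n U n = \bigcup_n F n.
    apply/seteqP; split=> x; first by move=> [n _ [k _ Fx]]; exists k.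
    by move=> [n _ Fx]; exists n.+1 => //; exists n => /=.
  have mU n : measurable (U n) by have [] := aU n.
  have e2 : 0 < e / 2 by rewrite divr_gt0.
  have [|N hN] := mu_bigcup_near mu mU _ e2.
    move=> m n mn; apply/subsetPset => x [k /= km Fx].
    by exists k => //=; apply: leq_trans mn.
  rewrite eU in hN.
  have [_ /(_ _ e2) [m [C [dC hC]]]] := aU N; exists m, C; split=> //.
  have mC := determined_measurable dC.
  have mUF : measurable (\bigcup_n F n) by apply: bigcupT_measurable.
  have UF : U N `<=` \bigcup_n F n by move=> x [k _ Fx]; exists k.
  have mD : measurable ((\bigcup_n F n) `\` U N) by apply: measurableD.
  have mS := measurable_symdiff (mU N) mC.
  apply: (@le_lt_trans _ _ (fine (mu (((\bigcup_n F n) `\` U N) `|` symdiff (U N) C)))).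
    apply: fine_muS; [exact: measurable_symdiff|exact: measurableU|].
    move=> x [[Fx nC]|[Cx nF]].
      by have [Ux|nU] := pselect (U N x); [right; left|left].
    by right; right; split=> // /UF.
  apply: le_lt_trans (fine_muU_le _ mD mS) _.
  suff : fine (mu ((\bigcup_n F n) `\` U N)) < e / 2 by lra.
  have := @measureD _ _ _ mu _ _ mUF (mU N); rewrite setIidr // => -> //.
    by rewrite fineB ?probability_fin //; lra.
  by rewrite ltey_eq probability_fin.
- by apply: (@approximable_determined n) => x y; rewrite /window /cylinder /= sw => ->.
Qed.

Hypothesis mu_invariant : forall B, measurable B -> mu (shift @^-1` B) = mu B.

Lemma mu_shift_by m B : measurable B -> mu (shift_by m @^-1` B) = mu B.
Proof.
have nn n C : measurable C -> mu (shift_by (Posz n) @^-1` C) = mu C.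
  move=> mC; rewrite -(iter_invariant measurable_left_shift mu_invariant n mC).
  rewrite (_ : iter n shift = shift_by (Posz n)) //.
  by apply/funext => x; exact: iter_left_shift.
case: m => n mB; first exact: nn.
rewrite -(nn n.+1 (shift_by (Negz n) @^-1` B)); last exact: measurable_shift_by.
rewrite -comp_preimage (_ : shift_by (Negz n) \o shift_by (Posz n.+1) = id) //.
by apply/funext => x; apply/funext => i; rewrite /shift_by /=; congr x; lia.
Qed.

Section UpperBound.
Variable G : set (seq A).
Hypothesis G_nonempty : forall w, G w -> w <> [::].
Hypothesis G_unique : unique_representation G.

(** By uniqueness the factorizations cut at [a] and at [b] are the same, so whole generators lie in
    between; the renumbering [k] is nonnegative as a <= b. *)
Lemma boundaries_star a b x : a <= b -> boundary0 G (shift_by a x) ->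
  boundary0 G (shift_by b x) -> star G (subword x a `|b - a|%N).
Proof.
move=> ab [v [w [Gv [Gw fx]]]] /boundary0P [u' [c' [W' c'0]]].
have W : written_as G (shift_by a x) (word_at v w) (cut_at v w).
  by split; [case|apply: fits_concatenation].
have := written_as_shift (a - b) W'.
rewrite (_ : shift_by _ (shift_by b x) = shift_by a x); last first.
  by apply/funext => i; rewrite /shift_by; congr x; lia.
move=> W''; have [k /(_ 0) [_]] := G_unique W W''.
rewrite c'0 !add0r opprB; case: k => n /= e.
  exists (mkseq v n) => [g /mapP [j _ ->] //|].
  have [+ _] := fx n; rewrite subword_shift_by add0r e => h.
  exact: esym h.
have := leq_size_lcat n.+1 (fun i => G_nonempty (Gw i)); lia.
Qed.

Variable s : R.
Hypothesis s_ge0 : 0 <= s.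
Hypothesis kraft_le1 : forall F, uniq F -> (forall g, g \in F -> G g) -> kraft s F <= 1.
Hypothesis mu_concatenations : mu (concatenations G) = 1%E.

(* A window with a cut near each of its ends is in [near_star], and the other
   windows have a small probability. *)
Lemma window_entropy_le (e : R) : 0 < e -> exists C, forall n,
  entropy_of mu (itin shift symbol0 n) <= n%:R * (s + e) + C.
Proof.
move=> e0; set L : R := ln #|A|%:R.
have cardA : (0 < #|A|)%N by apply/card_gt0P; exists point.
have L0 : 0 <= L by rewrite ln_ge0 // ler1n.
(* Bad windows will have probability at most 2 dl and cost at most n L, in total at most n e; the 1
   is there for L = 0. *)
pose dl := e / (2 * (L + 1)); have dl0 : 0 < dl by rewrite divr_gt0 // mulr_gt0 // ltr_wpDl.
have [||N hN] := @mu_bigcup_near _ _ _ mu (boundary_in G) dl _ _ dl0.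
- by move=> n; apply: boundary_in_measurable.
- move=> m n mn; apply/subsetPset => x [k /= km Fx].
  by exists k => //=; apply: leq_trans mn.
rewrite -concatenations_bigcup // mu_concatenations /= in hN.
have [C C1 hC] := near_star_count_le G_nonempty s_ge0 kraft_le1 N.
have lC : 0 <= ln C by rewrite ln_ge0.
have l2 : 0 <= ln 2 :> R by rewrite ln_ge0 // ler1n.
exists ((2 * N)%:R * L + ln 2 + ln C) => n.
have mi := itin_measurable measurable_left_shift n symbol0_measurable.
have dP := law_pmf mu mi.
have lcard : ln #|{: n.-tuple A}|%:R = n%:R * L.
  by rewrite card_tuple natrX lnXn ?ltr0n // mulr_natl.
have [nN|nN] := ltnP n (2 * N).
  apply: le_trans (shannon_le_card dP) _; rewrite lcard.
  have : n%:R * L <= (2 * N)%:R * L by rewrite ler_wpM2r // ler_nat ltnW.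
  have : 0 <= n%:R * (s + e) by rewrite mulr_ge0 // addr_ge0 // ltW.
  lra.
set BN := boundary_in G N in hN.
have mBN : measurable BN by apply: boundary_in_measurable.
pose good : pred (n.-tuple A) := fun w => `[< near_star G N w >].
have mS : measurable (shift_by (Posz (n - N)) @^-1` BN) by apply: measurable_shift_by.
(* A window is bad only if there is no cut in [0, N[ or none in [n - N, n[. *)
have bad : \sum_(w | ~~ good w) law mu (itin shift symbol0 n) w <= 2 * dl.
  have := mu_preimage mu (fun w => ~~ good w) mi => /(congr1 fine) /= <-.
  apply: (@le_trans _ _ (fine (mu (~` BN `|` ~` (shift_by (Posz (n - N)) @^-1` BN))))).
    apply: fine_muS; first exact: measurable_fibers_preimage.
      by apply: measurableU; apply: measurableC.
    move=> x /= /asboolP ng; apply: contrapT => /not_orP [].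
    move=> /contrapT [a /= aN ha] /contrapT [b /= bN hb]; apply: ng.
    rewrite val_itin_symbol0.
    set b' : nat := (n - N + b)%N.
    have hb' : boundary0 G (shift_by (Posz b') x).
      move: hb; rewrite /preimage /=; congr boundary0.
      by apply/funext => i; rewrite /shift_by; congr x; rewrite /b'; lia.
    have ab : Posz a <= Posz b' by rewrite /b'; lia.
    have := boundaries_star ab ha hb'.
    rewrite (_ : `|_|%N = (b' - a)%N); last by lia.
    exists (subword x 0 a), (subword x (Posz a) (b' - a)), (subword x (Posz b') (n - b')).
    rewrite !size_subword; split=> //; first by apply: ltnW.
      by rewrite /b'; lia.
    have en : n = (a + ((b' - a) + (n - b')))%N by rewrite /b'; lia.
    rewrite [in LHS]en !subword_cat add0r; congr (_ ++ (_ ++ _)).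
    by congr subword; rewrite /b'; lia.
  apply: le_trans (fine_muU_le _ _ _) _; [exact: measurableC|exact: measurableC|].
  by rewrite !fine_muC // mu_shift_by //; lra.
have C1' : 1 <= C * expR (s * n%:R).
  rewrite -[1]mulr1; apply: ler_pM => //.
  by rewrite -expR0 ler_expR mulr_ge0.
have cg : #|good|%:R <= C * expR (s * n%:R).
  by apply: le_trans (hC n); rewrite -card_wlist.
have := shannon_le_count dP C1' cg bad; rewrite lcard => /(_ _ (lexx _)).
have nL : 0 <= n%:R * L by rewrite mulr_ge0.
move=> /(_ nL) h; apply: le_trans h _.
rewrite lnM ?posrE ?expR_gt0 ?(lt_le_trans ltr01) // expRK.
have : 2 * dl * (n%:R * L) <= n%:R * e.
  rewrite mulrCA ler_wpM2l // /dl.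
  have -> : 2 * (e / (2 * (L + 1))) * L = e * (L / (L + 1)).
    by field; rewrite gt_eqF // ltr_wpDl.
  by rewrite ler_piMr ?(ltW e0) // ler_pdivrMr ?ltr_wpDl // mul1r lerDl.
have : 0 <= (2 * N)%:R * L by rewrite mulr_ge0.
lra.
Qed.

(** The supremum runs over all partitions, so [p] is approximated by a partition read off windows of
    radius m. The n-itinerary of the latter is a function of n + 2 m letters, and the error [ev]
    adds at most e per step. *)
Theorem metric_entropy_le : (metric_entropy shift mu <= s%:E)%E.
Proof.
apply: ub_ereal_sup => _ [k [p [mp ->]]]; rewrite lee_fin.
have [l cl lle] := itin_cvg measurable_left_shift mu_invariant mp.
have -> : lim ((partition_entropy shift mu p n / n%:R) @[n --> \oo]) = l.
  exact/cvg_lim.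
have p0 : 'I_k := p point.
suff key e : 0 < e -> l <= s + 3 * e.
  apply/ler_addgt0Pr => e e0; have := key (e / 3); rewrite mulrCA divff ?mulr1 //.
  by apply; rewrite divr_gt0.
move=> e0.
have [dl dl0 hdl] := shannon_concentrated (None : option 'I_k) e0.
have k0 : 0 < k%:R :> R by rewrite ltr0n; case: (k) p0 => // -[].
have dk : 0 < dl / k%:R by rewrite divr_gt0.
have /choice [a ha] : forall i, exists mC : nat * set (full_shift A),
    determined mC.1 mC.2 /\ fine (mu (symdiff (p @^-1` [set i]) mC.2)) < dl / k%:R.
  move=> i; have [_ /(_ _ dk) [m [C h]]] := measurable_approximable (mp i).
  by exists (m, C).
pose m := \max_(i < k) (a i).1.
pose D i := (a i).2.
have dD i x y : window m x = window m y -> D i x -> D i y.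
  move=> xy; apply: (ha i).1; apply: window_le xy.
  exact: (leq_bigmax i).
(* The [D i] need neither be disjoint nor cover the space; whatever [h] does there is charged to the
   exceptional set of [ev]. *)
pose h (x : full_shift A) : 'I_k := odflt p0 [pick i | `[< D i x >]].
have hw x y : window m x = window m y -> h x = h y.
  move=> xy; rewrite /h; congr odflt; apply: eq_pick => i.
  by apply: asbool_equiv_eq; split; apply: dD.
pose W (x : full_shift A) : (2 * m + 1).-tuple A :=
  itin shift symbol0 (2 * m + 1) (shift_by (- Posz m) x).
have tW x : tval (W x) = window m x by rewrite val_itin_symbol0 subword_shift_by add0r.
have /choice [h' hh'] : forall t : (2 * m + 1).-tuple A, exists i, forall x, W x = t -> h x = i.
  move=> t; have [[x xt]|nx] := pselect (exists x, W x = t); last first.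
    by exists p0 => x xt; case: nx; exists x.
  by exists (h x) => y yt; apply: hw; rewrite -!tW yt xt.
have hW x : h' (W x) = h x by rewrite (hh' (W x) x).
have mi := fun n => itin_measurable measurable_left_shift n symbol0_measurable.
have mW : measurable_fibers W.
  move=> t; rewrite -[W]/(itin shift symbol0 (2 * m + 1) \o shift_by (- Posz m)).
  by rewrite comp_preimage; apply: measurable_shift_by; apply: mi.
pose ev x : option 'I_k := if p x == h' (W x) then None else Some (p x).
have [me _] := entropy_itin_approx measurable_left_shift mu_invariant h' 0 mp mW.
have ev_small : entropy_of mu ev <= e.
  apply: hdl; first exact: law_pmf.
  pose S (i : 'I_k) := symdiff (p @^-1` [set i]) (D i).
  have mS i : measurable (S i).
    by apply: measurable_symdiff => //; apply: determined_measurable (ha i).1.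
  have [mE muE] : measurable (\big[setU/set0]_(i < k) S i) /\
      fine (mu (\big[setU/set0]_(i < k) S i)) <= \sum_(i < k) dl / k%:R.
    elim/big_ind2 : _ => [|B x C y [mB hB] [mC hC]|i _].
    - by rewrite measure0.
    - split; first exact: measurableU.
      by apply: le_trans (fine_muU_le _ mB mC) (lerD hB hC).
    - by split=> //; apply: ltW; apply: (ha i).2.
  rewrite sumr_const card_ord -[_ *+ _]mulr_natr divfK ?gt_eqF // in muE.
  apply: (@le_trans _ _ (1 - fine (mu (\big[setU/set0]_(i < k) S i)))).
    by rewrite lerD2l lerN2.
  rewrite -fine_muC //; apply: fine_muS; [exact: measurableC|exact: me|].
  move=> x nE; rewrite /preimage /= /ev; case: eqP => // ne; exfalso; apply: nE.
  rewrite hW /h in ne; case: pickP ne => [j /asboolP Dj|nD] /= ne.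
    rewrite (bigD1 j) //=; left; right; split=> //.
  rewrite (bigD1 (p x)) //=; left; left; split=> // Dp.
  by have /asboolP := nD (p x).
have [C hC] := window_entropy_le e0.
have lb n : (0 < n)%N -> n%:R * l <= (n + 2 * m)%:R * (s + e) + C + n%:R * e.
  move=> n0; have nr : 0 < n%:R :> R by rewrite ltr0n.
  have := lle n n0; rewrite ler_pdivlMr // mulrC => hl; apply: le_trans hl _.
  have [_ h1] := entropy_itin_approx measurable_left_shift mu_invariant h' n mp mW.
  apply: le_trans h1 _; apply: lerD; last by rewrite ler_pM2l.
  apply: le_trans (hC (n + 2 * m)%N).
  pose V := itin shift symbol0 (n + 2 * m) \o shift_by (- Posz m).
  have mV : measurable_fibers V.
    by move=> t; rewrite /V comp_preimage; apply: measurable_shift_by; apply: mi.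
  have <- : entropy_of mu V = entropy_of mu (itin shift symbol0 (n + 2 * m)).
    congr shannon; apply/funext => t; rewrite /law /V comp_preimage mu_shift_by //.
    exact: mi.
  pose g (t : (n + 2 * m).-tuple A) : n.-tuple ((2 * m + 1).-tuple A) :=
    [tuple [tuple nth point t (i + j) | j < 2 * m + 1] | i < n].
  have -> : itin shift W n = g \o V; last exact: entropy_comp_le.
  apply/funext => x; apply: eq_from_tnth => i; rewrite /g /itin /= !tnth_mktuple.
  apply: eq_from_tnth => j; rewrite tnth_mktuple /V /= val_itin_symbol0.
  rewrite nth_subword; last by have := ltn_ord i; have := ltn_ord j; lia.
  rewrite (tnth_nth point) tW iter_left_shift /window nth_subword //.
  by rewrite /shift_by; congr x; lia.
(* For the [n] below, the constant terms cost less than e per step; this is the third [e] of the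
   bound. *)
pose K := (2 * m)%:R * (s + e) + C.
pose n := (Num.truncn (K / e)).+1.
have Kn : K < n%:R * e by rewrite -ltr_pdivrMr //; apply: truncnS_gt.
have n0 : 0 < n%:R :> R by rewrite ltr0n.
rewrite -(ler_pM2l n0); have := lb n isT; rewrite /K natrD in Kn *; lra.
Qed.

End UpperBound.
End ShiftMeasures.

(** * An invariant measure of maximal entropy *)

Section BlockEntropy.
Variables (R : realType) (A : alphabetType) (K N : nat).
Variable word : 'I_K -> seq A.
Hypothesis K_gt0 : (0 < K)%N.
Hypothesis word_inj : injective word.
Hypothesis size_word : forall k, size (word k) = N.

Definition uniform (k : 'I_K) : R := K%:R^-1.

Lemma uniform_prob : prob_vector uniform.
Proof.
split=> [k|]; first by rewrite invr_ge0.
by rewrite sumr_const card_ord -[_ *+ _]mulr_natr mulVf // pnatr_eq0 -lt0n.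
Qed.

Lemma shannon_uniform : shannon uniform = ln K%:R.
Proof.
rewrite /shannon (eq_bigr (fun k => uniform k * ln K%:R^-1)) // -mulr_suml.
by rewrite uniform_prob.2 mul1r lnV ?opprK // posrE ltr0n.
Qed.

Definition block (i n : nat) (k : 'I_K) : n.-tuple A :=
  [tuple nth point (word k) (i + j) | j < n].

Definition block_entropy i n : R := shannon (push_vector (block i n) uniform).

Definition letters : R := ln #|A|%:R.

Lemma letters_ge0 : 0 <= letters.
Proof. by rewrite ln_ge0 // ler1n; apply/card_gt0P; exists point. Qed.

Lemma block_entropy_le i n : block_entropy i n <= n%:R * letters.
Proof.
apply: le_trans (shannon_le_card (prob_vector_push _ uniform_prob)) _.
rewrite card_tuple natrX lnXn ?mulr_natl //.
by rewrite ltr0n; apply/card_gt0P; exists point.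
Qed.

Lemma block_entropy_ge0 i n : 0 <= block_entropy i n.
Proof. by apply: shannon_ge0; apply: prob_vector_push uniform_prob. Qed.

Lemma block_entropyD i m n :
  block_entropy i (m + n) <= block_entropy i m + block_entropy (i + m) n.
Proof.
have := shannon_tuple_le (prob_vector_push (block i (m + n)) uniform_prob).
have comp (J : finType) (g : (m + n).-tuple A -> J) :
    push_vector g (push_vector (block i (m + n)) uniform) =
    push_vector (g \o block i (m + n)) uniform by apply/funext => t; apply: push_comp.
rewrite !comp (_ : _ \o _ = block i m); last first.
  by apply/funext => k; apply: eq_from_tnth => j; rewrite !tnth_mktuple.
rewrite (_ : _ \o _ = block (i + m) n) //.
by apply/funext => k; apply: eq_from_tnth => j; rewrite !tnth_mktuple /= addnA.
Qed.

Lemma block_entropy_full : ln K%:R <= block_entropy 0 N.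
Proof.
pose k0 := Ordinal K_gt0.
pose dec (t : N.-tuple A) : 'I_K := odflt k0 [pick k | block 0 N k == t].
have decK k : dec (block 0 N k) = k.
  rewrite /dec; case: pickP => [k' /eqP e|/(_ k)]; last by rewrite eqxx.
  apply: word_inj; apply: (@eq_from_nth _ point) => [|j]; rewrite !size_word // => jN.
  have := congr1 (fun t => tnth t (Ordinal jN)) e.
  by rewrite !tnth_mktuple /= add0n.
rewrite -shannon_uniform.
have -> : uniform = push_vector dec (push_vector (block 0 N) uniform).
  apply/funext => k; rewrite push_comp /push_vector (eq_bigl (pred1 k)) ?big_pred1_eq //.
  by move=> k' /=; rewrite decK.
apply: shannon_push_le => t; exact: (prob_vector_push _ uniform_prob).1.
Qed.

Lemma block_entropy_blocks r n J :
  block_entropy r (J * n) <= \sum_(j < J) block_entropy (r + j * n) n.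
Proof.
elim: J => [|J IH].
  rewrite mul0n big_ord0; apply: le_trans (block_entropy_le _ _) _; by rewrite mul0r.
rewrite mulSn addnC big_ord_recr /=; apply: le_trans (block_entropyD _ _ _) _.
by rewrite lerD2r.
Qed.

Lemma sum_blocks (F : nat -> R) n J :
  \sum_(r < n) \sum_(j < J) F (r + j * n)%N = \sum_(i < J * n) F i.
Proof.
rewrite exchange_big /=; elim: J => [|J IH]; first by rewrite !big_ord0.
rewrite big_ord_recr /= IH mulSn addnC big_split_ord /=.
by congr (_ + _); apply: eq_bigr => r _; rewrite addnC.
Qed.

(* Every offset [r < n] cuts the word into blocks of length [n], up to at most
   [2 n] letters. *)
Lemma block_entropy_sum n : (0 < n)%N ->
  n%:R * ln K%:R - 2 * n%:R ^+ 2 * letters <= \sum_(i < N) block_entropy i n.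
Proof.
move=> n0; have l0 := letters_ge0.
(* One block fewer than fits, to leave room for any offset r < n. *)
pose J := (N %/ n).-1.
have JN : (J * n <= N)%N.
  by apply: leq_trans (leq_divM N n); rewrite leq_mul2r leq_pred orbT.
have NJ : (N < J * n + 2 * n)%N.
  have := ltn_ceil N n0; rewrite /J; case: (N %/ n)%N => [|q] /=; nia.
have key (r : 'I_n) : ln K%:R <=
    \sum_(j < J) block_entropy (r + j * n) n + 2 * n%:R * letters.
  apply: le_trans block_entropy_full _.
  have rn := ltn_ord r.
  have [JnN|JnN] := leqP (r + J * n) N; last first.
    have J0 : J = 0%N.
      have := leq_divM N n; rewrite /J; rewrite /J in JnN.
      case: (N %/ n)%N JnN => [|q] //= JnN; nia.
    apply: le_trans (block_entropy_le _ _) _; rewrite J0 big_ord0 add0r.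
    rewrite ler_wpM2r // -natrM ler_nat; rewrite J0 in NJ; lia.
  have -> : N = (r + (J * n + (N - (r + J * n))))%N by lia.
  apply: le_trans (block_entropyD _ _ _) _.
  rewrite add0n; apply: le_trans (lerD (block_entropy_le _ _) (block_entropyD _ _ _)) _.
  rewrite addrCA; apply: lerD (block_entropy_blocks _ _ _) _.
  apply: le_trans (lerD (lexx _) (block_entropy_le _ _)) _.
  rewrite -mulrDl ler_wpM2r // -natrD -natrM ler_nat; lia.
have : \sum_(r < n) ln K%:R <= \sum_(r < n)
    (\sum_(j < J) block_entropy (r + j * n) n + 2 * n%:R * letters).
  by apply: ler_sum => r _; apply: key.
rewrite big_split /= (sum_blocks (block_entropy^~ n)) !sumr_const !card_ord => h.
have : \sum_(i < J * n) block_entropy i n <= \sum_(i < N) block_entropy i n.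
  rewrite -(subnKC JN) big_split_ord /= lerDl sumr_ge0 // => i _.
  exact: block_entropy_ge0.
move: h; rewrite -[ln _ *+ _]mulr_natl -[(2 * _ * _) *+ _]mulr_natl expr2.
set x := \sum_(i < J * n) _; set y := \sum_(i < N) _; lra.
Qed.

Definition hits (i : nat) (w : seq A) : R :=
  \sum_(k | [seq nth point (word k) (i + j)%N | j <- iota 0 (size w)] == w) uniform k.

(** All N starting positions count, those that overrun a word reading [point]. Stationarity then
    fails by at most 1/N, and membership in the language by |w|/N. *)
Definition frequency (w : seq A) : R := N%:R^-1 * \sum_(i < N) hits i w.

Lemma hits_ge0 i w : 0 <= hits i w.
Proof. by apply: sumr_ge0 => k _; apply: uniform_prob.1. Qed.

Lemma hits_le1 i w : hits i w <= 1.
Proof.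
rewrite -uniform_prob.2 [leRHS](bigID (fun k =>
  [seq nth point (word k) (i + j)%N | j <- iota 0 (size w)] == w)) /=.
by rewrite lerDl sumr_ge0 // => k _; apply: uniform_prob.1.
Qed.

Lemma hits_block i n (t : n.-tuple A) : hits i t = push_vector (block i n) uniform t.
Proof.
rewrite /hits /push_vector; apply: eq_bigl => k; rewrite size_tuple.
apply/eqP/eqP => [e|<-].
  by apply: val_inj; rewrite /= -[RHS]e -val_enum_ord -map_comp.
by rewrite /= -val_enum_ord -map_comp.
Qed.

(** Concavity over the N positions turns the sum of the block entropies into a bound for their
    average law. *)
Lemma frequency_shannon n : (0 < n)%N -> (0 < N)%N ->
  N%:R^-1 * (n%:R * ln K%:R - 2 * n%:R ^+ 2 * letters) <=
  shannon (fun t : n.-tuple A => frequency t).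
Proof.
move=> n0 N0; have Nr : 0 < N%:R :> R by rewrite ltr0n.
apply: (@le_trans _ _ (\sum_(i < N) N%:R^-1 * block_entropy i n)).
  by rewrite -mulr_sumr ler_pM2l ?invr_gt0 // block_entropy_sum.
have := @shannon_average R _ 'I_N (fun=> N%:R^-1) (fun i => push_vector (block i n) uniform).
rewrite (_ : (fun t : n.-tuple A => frequency t) =
    (fun t : n.-tuple A => \sum_(i < N) N%:R^-1 * push_vector (block i n) uniform t)); last first.
  apply/funext => t; rewrite /frequency mulr_sumr.
  by apply: eq_bigr => i _; rewrite hits_block.
apply=> [i|i|]; first by rewrite invr_ge0.
  exact: prob_vector_push uniform_prob.
by rewrite sumr_const card_ord -[_ *+ _]mulr_natr mulVf // gt_eqF.
Qed.

Lemma hits_rcons i w : hits i w = \sum_a hits i (rcons w a).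
Proof.
rewrite /hits (partition_big (fun k => nth point (word k) (i + size w)) predT) //=.
apply: eq_bigr => a _; apply: eq_bigl => k.
rewrite size_rcons -addn1 iotaD map_cat /= add0n cats1 eqseq_rcons.
by rewrite andbC.
Qed.

Lemma hits_cons i w : hits i.+1 w = \sum_a hits i (a :: w).
Proof.
rewrite /hits (partition_big (fun k => nth point (word k) i) predT) //=.
apply: eq_bigr => a _; apply: eq_bigl => k.
rewrite /= addn0 eqseq_cons andbC -[1%N]/(1 + 0)%N iotaDl -map_comp.
by congr (_ && (_ == _)); apply: eq_map => j /=; rewrite addSn addnS.
Qed.

Lemma frequency_ge0 w : 0 <= frequency w.
Proof. by rewrite mulr_ge0 ?invr_ge0 // sumr_ge0 // => i _; apply: hits_ge0. Qed.

Lemma frequency_le1 w : frequency w <= 1.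
Proof.
have [N0|N0] := posnP N.
  by rewrite /frequency N0 big_ord0 mulr0.
rewrite /frequency ler_pdivrMl ?ltr0n // mulr1.
apply: (@le_trans _ _ (\sum_(i < N) 1)); last by rewrite sumr_const card_ord.
by apply: ler_sum => i _; apply: hits_le1.
Qed.

Lemma frequency_nil : (0 < N)%N -> frequency [::] = 1.
Proof.
move=> N0; rewrite /frequency (eq_bigr (fun=> 1)).
  by rewrite sumr_const card_ord mulVf // pnatr_eq0 -lt0n.
by move=> i _; rewrite /hits /= -uniform_prob.2; apply: eq_bigl.
Qed.

Lemma frequency_rcons w : frequency w = \sum_a frequency (rcons w a).
Proof.
rewrite /frequency -mulr_sumr exchange_big /=; congr (_ * _).
by apply: eq_bigr => i _; apply: hits_rcons.
Qed.

(** Prefixing a letter moves the position by one, so the difference telescopes to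
    [hits 0 w - hits N w]. *)
Lemma frequency_cons w : `|frequency w - \sum_a frequency (a :: w)| <= N%:R^-1.
Proof.
have -> : \sum_a frequency (a :: w) = N%:R^-1 * \sum_(i < N) hits i.+1 w.
  rewrite /frequency -mulr_sumr exchange_big /=; congr (_ * _).
  by apply: eq_bigr => i _; rewrite hits_cons.
rewrite /frequency -mulrBr -sumrB.
have -> : \sum_(i < N) (hits i w - hits i.+1 w) = hits 0 w - hits N w.
  elim: (N) => [|k IH]; first by rewrite big_ord0 subrr.
  rewrite big_ord_recr /= IH; ring.
rewrite normrM ger0_norm ?invr_ge0 // ler_piMr ?invr_ge0 //.
have := hits_le1 0 w; have := hits_le1 N w; have := hits_ge0 0 w.
by have := hits_ge0 N w; rewrite ler_norml; lra.
Qed.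

(** Only starting positions with an overrun can show a word outside [L], and there are at most |w|
    of them. *)
Lemma frequency_le w (L : set (seq A)) :
  (forall k i n, (i + n <= N)%N ->
     L [seq nth point (word k) (i + j)%N | j <- iota 0 n]) ->
  ~ L w -> frequency w <= (size w)%:R / N%:R.
Proof.
move=> hL nLw; rewrite /frequency mulrC ler_wpM2r ?invr_ge0 //.
have h0 i : (i + size w <= N)%N -> hits i w = 0.
  move=> iN; rewrite /hits big1 // => k /eqP e; case: nLw.
  by rewrite -e; apply: hL.
apply: (@le_trans _ _ (\sum_(i < N) (N < i + size w)%:R)).
  apply: ler_sum => i _; case: ltnP => [_|/h0 ->] //; exact: hits_le1.
rewrite -natr_sum ler_nat.
have [wN|Nw] := leqP (size w) N; last first.
  apply: (@leq_trans (\sum_(i < N) 1)%N); last by rewrite sum1_card card_ord ltnW.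
  by apply: leq_sum => i _; case: ltnP.
suff aux M : (\sum_(i < M + size w) (M + size w < i + size w) <= size w)%N.
  by have := aux (N - size w)%N; rewrite subnK.
rewrite big_split_ord /= big1 => [|i _]; last first.
  by have := ltn_ord i; case: ltnP => //=; lia.
rewrite add0n; apply: (@leq_trans (\sum_(i < size w) 1)%N).
  by apply: leq_sum => i _; case: ltnP.
by rewrite sum1_card card_ord.
Qed.

End BlockEntropy.

(** * Limits of empirical frequencies *)

Section LimitFrequencies.
Variables (R : realType) (A : alphabetType) (X : set (full_shift A)).
Hypothesis X_nonempty : X !=set0.

Local Notation L := (language X).
Local Notation h := (topological_entropy X : R).

Definition language_word N (k : 'I_(size (wlist L N))) : seq A :=
  nth [::] (wlist L N) k.

Lemma language_word_mem N (k : 'I_(size (wlist L N))) :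
  language_word k \in wlist L N.
Proof. exact: mem_nth. Qed.

Lemma language_word_inj N : injective (@language_word N).
Proof.
move=> k k' /eqP; rewrite /language_word nth_uniq ?wlist_uniq // => /eqP e.
exact: val_inj.
Qed.

Lemma size_language_word N (k : 'I_(size (wlist L N))) : size (language_word k) = N.
Proof. by have /mem_wlist [] := language_word_mem k. Qed.

Definition language_frequency (N : nat) (w : seq A) : R :=
  frequency R N (@language_word N) w.

Lemma language_frequency_out N w : ~ L w -> language_frequency N w <= (size w)%:R / N%:R.
Proof.
move=> nL; rewrite /language_frequency.
apply: (@frequency_le R A _ N (@language_word N) (language_count_gt0 X_nonempty N)
  _ _ _ nL) => k i n iN.
have /mem_wlist [_ [x Xx [a e]]] := language_word_mem k.
exists x => //; exists (a + Posz i); rewrite size_map size_iota -e size_language_word.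
apply: (@eq_from_nth _ point); first by rewrite size_subword size_map size_iota.
move=> j; rewrite size_subword => jn; rewrite nth_subword // (nth_map 0%N) ?size_iota //.
rewrite nth_iota // nth_subword; last by lia.
by congr x; lia.
Qed.

Lemma cvg_finite_sum (T I : Type) (U : set_system T) (r : seq I)
    (f : I -> T -> R) (a : I -> R) : Filter U ->
  (forall i, f i x @[x --> U] --> a i) ->
  \sum_(i <- r) f i x @[x --> U] --> \sum_(i <- r) a i.
Proof.
move=> FU fa; elim: r => [|i r IH].
  rewrite big_nil; under eq_fun do rewrite big_nil; exact: cvg_cst.
rewrite big_cons; under eq_fun do rewrite big_cons.
exact: cvgD.
Qed.

Theorem limit_frequencies : exists m : seq A -> R,
  [/\ forall w, 0 <= m w, m [::] = 1,
      forall w, m w = \sum_a m (rcons w a) /\ m w = \sum_a m (a :: w),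
      forall w, ~ L w -> m w = 0 &
      forall n, (0 < n)%N -> n%:R * h <= shannon (fun t : n.-tuple A => m t)].
Proof.
pose F := language_frequency @ \oo : set_system (seq A -> R).
have cK : @compact (prod_topology (fun _ : seq A => R : topologicalType))
    [set f | forall w, `[0, 1]%classic (f w)].
  by apply: (tychonoff (fun _ : seq A => @segment_compact R 0 1)).
have FK : F [set f | forall w, `[0, 1]%classic (f w)].
  exists 0%N => // N _ w /=; rewrite in_itv /=; apply/andP; split.
    by apply: frequency_ge0; apply: language_count_gt0.
  by apply: frequency_le1; apply: language_count_gt0.
have [m [mK]] := cK F _ FK.
(* A cluster point is the limit along a finer filter [U], which plays the role of a subsequence. *)
rewrite cluster_cvgE => -[U PU [Um FU]].
have ev w : f w @[f --> U] --> m w.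
  have pc := @proj_continuous (seq A) (fun=> R) w m.
  by move=> V /pc /Um.
have evS (I : finType) (W : I -> seq A) : \sum_i f (W i) @[f --> U] --> \sum_i m (W i).
  by apply: cvg_finite_sum => i; apply: ev.
have lim_le (D : (seq A -> R) -> R) d c : D f @[f --> U] --> d ->
    (forall e, 0 < e -> exists N0, forall N, (N0 <= N)%N ->
       D (language_frequency N) <= c + e) -> d <= c.
  move=> Dd Dc; apply/ler_addgt0Pr => e e0.
  have e2 : 0 < e / 2 by rewrite divr_gt0.
  have /cvgrPdist_le /(_ _ e2) U1 := Dd.
  have U2 : U [set f | D f <= c + e / 2].
    have [N0 hN0] := Dc _ e2; apply: FU; exists N0 => // N /= NN; exact: hN0.
  have [f [/= f1 f2]] := filter_ex (filterI U1 U2).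
  move: f1 => /ler_normlW; lra.
have inv_small (a e : R) : 0 < e -> exists N0, forall N, (N0 <= N)%N -> a / N%:R <= e.
  move=> e0; exists (Num.truncn (`|a| / e)).+1 => N NN.
  have N0 : 0 < N%:R :> R by rewrite ltr0n; apply: leq_ltn_trans NN.
  rewrite ler_pdivrMr //; apply: le_trans (ler_norm _) _.
  rewrite mulrC -ler_pdivrMr //; apply: le_trans (ltW (truncnS_gt _)) _.
  by rewrite ler_nat.
have fr_eq N w : language_frequency N w = \sum_a language_frequency N (rcons w a).
  exact: frequency_rcons.
exists m; split.
- by move=> w; have := mK w; rewrite /= in_itv /= => /andP[].
- apply/eqP; rewrite eq_le; apply/andP; split.
    by have := mK [::]; rewrite /= in_itv /= => /andP[].
  rewrite -lerN2; apply: (lim_le (fun f => - f [::])); first by apply: cvgN; apply: ev.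
  move=> e e0; exists 1%N => N N0.
  rewrite /language_frequency frequency_nil //; first by lra.
  exact: language_count_gt0.
- move=> w.
  have D1 : f w - \sum_a f (rcons w a) @[f --> U] --> m w - \sum_a m (rcons w a).
    by apply: cvgB; [apply: ev|apply: evS].
  have D2 : f w - \sum_a f (a :: w) @[f --> U] --> m w - \sum_a m (a :: w).
    by apply: cvgB; [apply: ev|apply: (evS A (cons^~ w))].
  have D1' : - (f w - \sum_a f (rcons w a)) @[f --> U] --> - (m w - \sum_a m (rcons w a)).
    exact: cvgN.
  have D2' : - (f w - \sum_a f (a :: w)) @[f --> U] --> - (m w - \sum_a m (a :: w)).
    exact: cvgN.
  split; apply/eqP; rewrite -subr_eq0 eq_le; apply/andP; split.
  + apply: (lim_le _ _ 0 D1) => e e0; exists 0%N => N _.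
    by rewrite -fr_eq subrr add0r ltW.
  + rewrite -oppr_le0; apply: (lim_le _ _ 0 D1') => e e0; exists 0%N => N _.
    by rewrite -fr_eq subrr oppr0 add0r ltW.
  + apply: (lim_le _ _ 0 D2) => e e0; have [N0 hN0] := inv_small 1 e e0.
    exists N0 => N /hN0; rewrite div1r add0r; apply: le_trans.
    have := @frequency_cons R A _ N (@language_word N) (language_count_gt0 X_nonempty N) w.
    by move=> /ler_normlW.
  + rewrite -oppr_le0; apply: (lim_le _ _ 0 D2') => e e0.
    have [N0 hN0] := inv_small 1 e e0.
    exists N0 => N /hN0; rewrite div1r add0r; apply: le_trans.
    have := @frequency_cons R A _ N (@language_word N) (language_count_gt0 X_nonempty N) w.
    by rewrite -normrN => /ler_normlW.
- move=> w nL; apply/eqP; rewrite eq_le; apply/andP; split; last first.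
    by have := mK w; rewrite /= in_itv /= => /andP[].
  apply: (lim_le _ _ _ (ev w)) => e e0; have [N0 hN0] := inv_small (size w)%:R e e0.
  by exists N0 => N /hN0; rewrite add0r; apply: le_trans; apply: language_frequency_out.
- move=> n n0; rewrite -lerN2.
  apply: (lim_le (fun f => - shannon (fun t : n.-tuple A => f t))).
    apply: cvgN; rewrite /shannon; apply: cvgN; apply: cvg_finite_sum => t.
    have : x * ln x @[x --> m t] --> m t * ln (m t) by apply: continuous_xlnx.
    by move=> hx; apply: cvg_comp (ev t) hx.
  move=> e e0; have [N0 hN0] := inv_small (2 * n%:R ^+ 2 * letters R A) e e0.
  exists N0.+1 => N NN; have Np : (0 < N)%N by apply: leq_ltn_trans NN.
  have Nr : 0 < N%:R :> R by rewrite ltr0n.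
  have h1 := @frequency_shannon R A _ N _ (language_count_gt0 X_nonempty N)
    (@language_word_inj N) (@size_language_word N) _ n0 Np.
  have [_ /(_ N Np) h2] := topological_entropy_cvg R X_nonempty.
  have h3 := hN0 N (ltnW NN).
  rewrite mulrBr mulrCA ![N%:R^-1 * _]mulrC in h1.
  have h4 := ler_wpM2l (ler0n R n) h2.
  rewrite -lerN2 !opprK opprD opprK; apply: le_trans h1; lra.
Qed.

End LimitFrequencies.

Lemma probability_exists d (T : measurableType d) (R : realType) (f : set T -> \bar R) :
  f set0 = 0%E -> (forall B, 0 <= f B)%E -> semi_sigma_additive f -> f setT = 1%E ->
  exists P : probability T R, forall B, P B = f B.
Proof.
move=> f0 fge0 fs f1.
pose nu : {measure set T -> \bar R} := HB.pack f (isMeasure.Build d T R f f0 fge0 fs).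
pose P : probability T R := HB.pack_for (probability T R) f
  (isMeasure.Build d T R f f0 fge0 fs)
  (Measure_isProbability.Build d T R nu f1).
by exists P.
Qed.

(** * A measure with prescribed cylinder masses *)

Section NestedIntervals.
Variables (R : realType) (A : alphabetType).

(** The endpoints that cut a segment into pieces of lengths [w b], in the order of [enum_rank]. *)
Definition cumul (w : A -> R) (k : nat) : R := \sum_(b : A | (enum_rank b < k)%N) w b.

Lemma cumulS w a : cumul w (enum_rank a).+1 = cumul w (enum_rank a) + w a.
Proof.
rewrite /cumul (bigD1 a) //= addrC; congr (_ + _); apply: eq_bigl => b.
rewrite ltnS [in RHS]ltn_neqAle andbC; congr (_ && _).
by rewrite (inj_eq val_inj) (inj_eq enum_rank_inj).
Qed.

Lemma cumul_full w k : (#|A| <= k)%N -> cumul w k = \sum_b w b.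
Proof.
by move=> Ak; apply: eq_bigl => b; apply: leq_trans Ak.
Qed.

Lemma cumul_le w k l : (forall b, 0 <= w b) -> (k <= l)%N -> cumul w k <= cumul w l.
Proof.
move=> w0 kl; rewrite /cumul [leRHS](bigID (fun b => enum_rank b < k)%N) /=.
set x := \sum_(b | (_ < k)%N) w b; rewrite (_ : \sum_(b | _ && (_ < k)%N) w b = x).
  by rewrite lerDl sumr_ge0.
by apply: eq_bigl => b; apply: andb_idl => h; apply: leq_trans kl.
Qed.

Lemma cumul_pick w u : (forall b, 0 <= w b) -> 0 <= u -> u < \sum_b w b ->
  exists a : A, cumul w (enum_rank a) <= u < cumul w (enum_rank a).+1.
Proof.
move=> w0 u0 uw; have exk : exists k, u < cumul w k.+1.
  by exists #|A|; rewrite cumul_full.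
case: (ex_minnP exk) => k uk kmin.
have ku : cumul w k <= u.
  case: k kmin {uk} => [|k] kmin; first by rewrite /cumul big_pred0.
  by rewrite leNgt; apply/negP => /kmin; rewrite ltnn.
have kA : (k < #|A|)%N.
  rewrite ltnNge; apply/negP => Ak; move: ku uk.
  by rewrite !cumul_full ?(leqW Ak) // leNgt uw.
by exists (enum_val (Ordinal kA)); rewrite enum_valK ku.
Qed.

Variable m : seq A -> R.
Hypothesis m_ge0 : forall w, 0 <= m w.
Hypothesis m_nil : m [::] = 1.
Hypothesis m_rcons : forall w, m w = \sum_a m (rcons w a).
Hypothesis m_cons : forall w, m w = \sum_a m (a :: w).

(* The letters of a point are enumerated at the coordinates 0, -1, 1, -2, 2, ...
   A node of the tree of cylinders is the list of the first letters in this
   order, the last one first; [spread] puts them back in their places. *)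
Fixpoint spread (r : seq A) : seq A :=
  if r is a :: r' then
    if odd (size r') then a :: spread r' else rcons (spread r') a
  else [::].

Lemma size_spread r : size (spread r) = size r.
Proof. by elim: r => //= a r IH; case: ifP => _; rewrite /= ?size_rcons IH. Qed.

Lemma spread_inj r r' : size r = size r' -> spread r = spread r' -> r = r'.
Proof.
elim: r r' => [|a r IH] [|a' r'] //= [e]; rewrite e; case: ifP => _.
  by move=> [-> /IH ->].
by move=> /rcons_inj [/IH -> // ->].
Qed.

Lemma spread_surj w : exists2 r, size r = size w & spread r = w.
Proof.
have [n sw] : exists n, size w = n by exists (size w).
elim: n w sw => [|n IH] w sw; first by exists [::]; rewrite (size0nil sw).
case on : (odd n).
  case: w sw => // a w [sw]; have [r rw <-] := IH w sw.
  by exists (a :: r); rewrite /= ?size_spread // rw sw on.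
case/lastP: w sw => // w a; rewrite size_rcons => -[sw]; have [r rw <-] := IH w sw.
by exists (a :: r); rewrite /= ?size_rcons ?size_spread // rw sw on.
Qed.

Lemma m_spread r : m (spread r) = \sum_a m (spread (a :: r)).
Proof. by rewrite /=; case: odd; [apply: m_cons|apply: m_rcons]. Qed.

(** The interval of a node is cut according to the masses of its one-letter extensions, which fill
    it by [m_spread]. *)
Fixpoint left_end (r : seq A) : R :=
  if r is a :: r' then
    left_end r' + cumul (fun b => m (spread (b :: r'))) (enum_rank a)
  else 0.

Definition node_itv (r : seq A) : set R :=
  [set t | left_end r <= t < left_end r + m (spread r)].

Lemma node_itv_nil : node_itv [::] = `[0, 1[%classic.
Proof. by apply/seteqP; split=> t; rewrite /node_itv /= m_nil add0r in_itv. Qed.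

Lemma node_itv_consE a r t : node_itv (a :: r) t <->
  left_end r + cumul (fun b => m (spread (b :: r))) (enum_rank a) <= t <
  left_end r + cumul (fun b => m (spread (b :: r))) (enum_rank a).+1.
Proof. by rewrite /node_itv [left_end _]/= cumulS addrA. Qed.

Lemma node_itv_cons a r : node_itv (a :: r) `<=` node_itv r.
Proof.
move=> t /node_itv_consE /andP[h1 h2]; apply/andP; split.
  apply: le_trans h1; rewrite lerDl; apply: sumr_ge0 => b _; exact: m_ge0.
apply: lt_le_trans h2 _; rewrite lerD2l m_spread -(cumul_full _ (leqnn #|A|)).
by apply: cumul_le.
Qed.

Lemma node_itv_split r t : node_itv r t -> exists a, node_itv (a :: r) t.
Proof.
move=> /andP[h1 h2].
have [|||a /andP[a1 a2]] := @cumul_pick (fun b => m (spread (b :: r))) (t - left_end r).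
- by move=> b; apply: m_ge0.
- by rewrite subr_ge0.
- by rewrite -m_spread ltrBlDl.
by exists a; apply/node_itv_consE; rewrite -lerBrDl a1 -ltrBlDl a2.
Qed.

Lemma node_itv_disjoint a b r t : node_itv (a :: r) t -> node_itv (b :: r) t -> a = b.
Proof.
have key c e : (enum_rank c < enum_rank e)%N -> node_itv (c :: r) t ->
    node_itv (e :: r) t -> False.
  move=> ce /node_itv_consE /andP[_ h1] /node_itv_consE /andP[h2 _].
  have := le_lt_trans h2 h1; rewrite ltrD2l ltNge.
  by rewrite cumul_le // => w; apply: m_ge0.
move=> ha hb; have [ab|ba|/val_inj/enum_rank_inj //] := ltngtP (enum_rank a) (enum_rank b).
  by case: (key _ _ ab ha hb).
by case: (key _ _ ba hb ha).
Qed.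

Lemma measurable_node_itv r : measurable (node_itv r : set (measurableTypeR R)).
Proof.
rewrite (_ : node_itv r = `[left_end r, left_end r + m (spread r)[%classic).
  exact: measurable_itv.
by apply/seteqP; split=> t; rewrite /node_itv /= in_itv.
Qed.

Lemma lebesgue_node_itv r : lebesgue_measure (node_itv r) = (m (spread r))%:E.
Proof.
rewrite (_ : node_itv r = `[left_end r, left_end r + m (spread r)[%classic).
  rewrite lebesgue_measure_itv /= lte_fin ltrDl; case: ifPn => [_|].
    by rewrite -EFinD addrAC subrr add0r.
  by rewrite -leNgt => h; congr EFin; apply/eqP; rewrite eq_le h m_ge0.
by apply/seteqP; split=> t; rewrite /node_itv /= in_itv.
Qed.

(** The address of [t] in the tree; the default of [xget] is met only outside [0, 1[. *)
Fixpoint node (n : nat) (t : R) : seq A :=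
  if n is n'.+1 then
    xget point [set a | node_itv (a :: node n' t) t] :: node n' t
  else [::].

Lemma size_node n t : size (node n t) = n.
Proof. by elim: n => //= n ->. Qed.

Lemma node_itv_node n t : node_itv [::] t -> node_itv (node n t) t.
Proof.
move=> t01; elim: n => // n IH.
have [a ha] := node_itv_split IH.
exact: (xgetPex point (ex_intro [set b | node_itv (b :: node n t) t] a ha)).
Qed.

Lemma node_itvP r t : node_itv r t <-> node_itv [::] t /\ node (size r) t = r.
Proof.
split=> [h|[t01 <-]]; last exact: node_itv_node.
have t01 : node_itv [::] t.
  by elim: r h => // a r IH /node_itv_cons /IH.
split=> //; elim: r h => // a r IH h; have IHr := IH (node_itv_cons h).
have hn := node_itv_node (size r).+1 t01.
rewrite [node _ _]/= IHr in hn *; congr (_ :: _).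
exact: node_itv_disjoint hn h.
Qed.

(** Counting from 0, the letter number 2k of the address goes to [Posz k] and the letter number 2k +
    1 to [Negz k]. *)
Definition point_of (t : R) : full_shift A := fun i =>
  match i with
  | Posz k => head point (node (2 * k).+1 t)
  | Negz k => head point (node (2 * k).+2 t)
  end.

Lemma subword_point_of n t :
  subword (point_of t) (- Posz n./2) n = spread (node n t).
Proof.
have sub1 x i : subword x i 1 = [:: x i] :> seq A by rewrite /subword /= addr0.
elim: n => [|n IH] //; rewrite [spread _]/= size_node -IH.
rewrite -[xget _ _]/(head point (node n.+1 t)) -[n.+1./2]/(uphalf n) uphalf_half.
have := odd_double_half n; case: (odd n) => en.
  rewrite -[n.+1]add1n subword_cat sub1 add1n (_ : - Posz (n./2).+1 = Negz n./2) //.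
  rewrite -[point_of t _]/(head point (node (2 * n./2).+2 t)).
  rewrite (_ : (2 * n./2).+2 = n.+1); last by lia.
  by rewrite (_ : Negz n./2 + Posz 1 = - Posz n./2) //; lia.
rewrite add0n -[n.+1 in LHS]addn1 subword_cat sub1 cats1; congr rcons.
rewrite (_ : - Posz n./2 + Posz n = Posz n./2); last by lia.
rewrite -[point_of t _]/(head point (node (2 * n./2).+1 t)).
by rewrite (_ : (2 * n./2).+1 = n.+1) //; lia.
Qed.

Lemma preimage_cylinder_point_of n r : size r = n ->
  `[0, 1[%classic `&` point_of @^-1` (cylinder (- Posz n./2) (spread r)) = node_itv r.
Proof.
move=> sr; rewrite -node_itv_nil; apply/seteqP; split=> t.
  move=> [t01]; rewrite /preimage /cylinder /= size_spread sr subword_point_of => e.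
  by apply/node_itvP; split=> //; apply: spread_inj; rewrite sr ?size_node.
move=> /node_itvP [t01 e]; split=> //.
by rewrite /preimage /cylinder /= size_spread sr subword_point_of -sr e.
Qed.

Definition unit_preimage (B : set (full_shift A)) : set (measurableTypeR R) :=
  `[0, 1[%classic `&` point_of @^-1` B.

Lemma measurable_unit_preimage B : measurable B -> measurable (unit_preimage B).
Proof.
have m01 : measurable (`[0, 1[%classic : set (measurableTypeR R)) by apply: measurable_itv.
apply: (@borel_ind _ (fun B => measurable (unit_preimage B))) => [|C mC|F mF|n w sw].
- by rewrite /unit_preimage preimage_set0 setI0; apply: measurable0.
- rewrite (_ : unit_preimage (~` C) = `[0, 1[%classic `\` unit_preimage C).
    exact: measurableD.
  apply/seteqP; split=> t [t01 h]; first by split=> // -[].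
  by split=> // Ct; apply: h.
- by rewrite /unit_preimage preimage_bigcup setI_bigcupr; apply: bigcupT_measurable.
- have [r sr <-] := spread_surj w; rewrite sw in sr.
  have := preimage_cylinder_point_of sr; rewrite (_ : (2 * n + 1)./2 = n); last by lia.
  by rewrite /unit_preimage => ->; apply: measurable_node_itv.
Qed.

(** The image of Lebesgue measure on [0, 1[ under [point_of]. A centred cylinder pulls back to one
    interval; any other lies within a centred window, and its mass follows by summing over the added
    letters. *)
Theorem probability_of_cylinders : exists mu : probability (full_shift A) R,
  forall i w, mu (cylinder i w) = (m w)%:E.
Proof.
have [||||mu hmu] := @probability_exists _ (full_shift A) R
    (fun B => lebesgue_measure (unit_preimage B)).
- by rewrite /unit_preimage preimage_set0 setI0 measure0.
- by move=> B; apply: measure_ge0.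
- move=> F mF tF mU; rewrite /unit_preimage preimage_bigcup setI_bigcupr.
  apply: (@measure_semi_sigma_additive _ _ _ lebesgue_measure
    (fun n => unit_preimage (F n))) => [n||].
  + exact: measurable_unit_preimage.
  + apply/trivIsetP => a b _ _ ab; move/trivIsetP: tF => /(_ a b Logic.I Logic.I ab) Fab.
    rewrite -subset0 => t [[_ h1] [_ h2]].
    by have : (F a `&` F b) (point_of t) by []; rewrite Fab.
  + by apply: bigcupT_measurable => n; apply: measurable_unit_preimage.
- by rewrite /unit_preimage preimage_setT setIT -node_itv_nil lebesgue_node_itv m_nil.
exists mu.
have centered n w : size w = n -> mu (cylinder (- Posz n./2) w) = (m w)%:E.
  move=> sw; have [r sr <-] := spread_surj w.
  by rewrite hmu /unit_preimage preimage_cylinder_point_of ?lebesgue_node_itv // sr.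
have split_sum (B : set (full_shift A)) (C : A -> set (full_shift A)) (f : A -> R) :
    (forall a, measurable (C a)) -> (forall a, mu (C a) = (f a)%:E) ->
    (forall x, B x <-> exists a, C a x) -> (forall a b x, C a x -> C b x -> a = b) ->
    mu B = (\sum_a f a)%:E.
  move=> mC fC BC dC; have -> : B = \big[setU/set0]_(i < #|A|) C (enum_val i).
    apply/seteqP; split=> x; rewrite -bigcup_seq.
      move=> /BC [a Ca]; exists (enum_rank a); first by rewrite /= mem_index_enum.
      by rewrite enum_rankK.
    by move=> [k _ Ck]; apply/BC; exists (enum_val k).
  rewrite measure_bigsetU_ord //; last first.
    apply/trivIsetP => k l _ _ /eqP kl; rewrite -subset0 => x [Ck Cl].
    by apply: kl; apply: enum_val_inj; apply: dC Ck Cl.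
  rewrite -sumEFin [RHS](reindex (@enum_val A predT)); last exact/onW_bij/enum_val_bij.
  apply: eq_bigr => k _; exact: fC.
have shrink i n : (forall w, size w = n.+1 -> mu (cylinder i w) = (m w)%:E) ->
    (forall w, size w = n -> mu (cylinder i w) = (m w)%:E) /\
    (forall w, size w = n -> mu (cylinder (i + 1) w) = (m w)%:E).
  move=> h; split=> w sw.
    rewrite m_rcons; apply: (split_sum _ (fun a => cylinder i (rcons w a))).
    - by move=> a; apply: measurable_cylinder.
    - by move=> a; apply: h; rewrite size_rcons sw.
    - move=> x; rewrite /cylinder /=; split=> [e|[a]].
        exists (x (i + Posz (size w))).
        by rewrite -cats1; apply/subword_catP; rewrite e /subword /= addr0.
      by rewrite -cats1 => /subword_catP [].
    - move=> a b x; rewrite /cylinder /= !size_rcons => -> /rcons_inj [] //.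
  rewrite m_cons; apply: (split_sum _ (fun a => cylinder i (a :: w))).
  - by move=> a; apply: measurable_cylinder.
  - by move=> a; apply: h; rewrite /= sw.
  - move=> x; rewrite /cylinder /=; split=> [e|[a]].
      by exists (x i); apply/(subword_catP x i [:: x i]); rewrite e /subword /= addr0.
    by rewrite -[a :: w]cat1s => /(subword_catP x i [:: a]) [].
  - by move=> a b x; rewrite /cylinder /= => -> [].
have shrink_right i n k : (forall w, size w = (n + k)%N -> mu (cylinder i w) = (m w)%:E) ->
    forall w, size w = n -> mu (cylinder i w) = (m w)%:E.
  elim: k => [|k IH]; first by rewrite addn0.
  by rewrite addnS => /shrink [/IH].
have shrink_left i n k : (forall w, size w = (n + k)%N -> mu (cylinder i w) = (m w)%:E) ->
    forall w, size w = n -> mu (cylinder (i + Posz k) w) = (m w)%:E.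
  elim: k i => [|k IH] i; first by rewrite addn0 addr0.
  rewrite addnS => /shrink [_ /IH]; rewrite (_ : i + 1 + Posz k = i + Posz k.+1) //; lia.
move=> i w; pose N := (`|i| + size w)%N.
have [k ik] : exists k, i = - Posz N + Posz k.
  by rewrite /N; case: (i) => n; [exists (n + n + size w)%N|exists (size w)]; lia.
have kw : (k + size w <= 2 * N)%N by move: ik; rewrite /N; lia.
rewrite ik; apply: (@shrink_left _ (size w) k) => // w1 sw1.
apply: (@shrink_right _ (size w + k)%N (2 * N - (size w + k))%N) => // w2 sw2.
have := @centered (2 * N)%N w2; rewrite mul2n doubleK; apply.
by rewrite sw2 subnKC -?mul2n //; lia.
Qed.

End NestedIntervals.

(** * Uniqueness, invariance and conditioning of measures *)

Section InvariantMeasures.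
Variables (R : realType) (A : alphabetType).
Local Notation shift := (@left_shift A).

Lemma left_shift_preimage_cylinder i w :
  shift @^-1` (cylinder i w) = cylinder (i + 1) w.
Proof. exact: (shift_by_preimage_cylinder 1). Qed.

(** Two centred cylinders are nested or disjoint, so with [set0] the family is closed under
    intersection. *)
Definition centered_cylinders : set (set (full_shift A)) :=
  [set B | B = set0 \/ exists n w, size w = (2 * n + 1)%N /\ B = cylinder (- Posz n) w].

Lemma centered_cylinders_setI : setI_closed centered_cylinders.
Proof.
move=> B C [->|[n [w [sw ->]]]]; first by left; rewrite set0I.
move=> [->|[n' [w' [sw' ->]]]]; first by left; rewrite setI0.
wlog nn' : n n' w w' sw sw' / (n <= n')%N.
  move=> h; have [/h|/ltnW /h] := leqP n n'; first exact.
  by rewrite setIC; apply.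
have dn : determined n (cylinder (- Posz n) w).
  by move=> x y; rewrite /cylinder /= sw /window => ->.
have [h|h] := pselect (exists x, (cylinder (- Posz n) w `&` cylinder (- Posz n') w') x).
  right; exists n', w'; split=> //; apply/seteqP; split=> x; first by case.
  move=> Cx; split=> //; case: h => y [Cy Cy']; apply: dn Cy.
  by apply: (window_le nn'); move: Cx Cy'; rewrite /cylinder /= sw' /window => -> ->.
by left; rewrite -subset0 => x Bx; apply: h; exists x.
Qed.

Lemma centered_cylinders_measurable B : centered_cylinders B -> measurable B.
Proof.
by move=> [->|[n [w [_ ->]]]]; [apply: measurable0|apply: measurable_cylinder].
Qed.

Lemma centered_cylinders_generate :
  @measurable _ (full_shift A) = <<s centered_cylinders >>.
Proof.
apply/seteqP; split=> B; last first.
  apply: smallest_sub; last by move=> C; apply: centered_cylinders_measurable.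
  split; [exact: measurable0|by move=> C mC; rewrite setTD; apply: measurableC|].
  by move=> F mF; apply: bigcupT_measurable.
have [s0 sC sU] := @smallest_sigma_algebra _ setT centered_cylinders.
apply: borel_ind => // [C GC|n w sw]; first by rewrite -setTD; apply: sC.
by apply: (@sub_sigma_algebra _ setT centered_cylinders); right; exists n, w.
Qed.

Lemma probability_unique (mu nu : probability (full_shift A) R) :
  (forall i w, mu (cylinder i w) = nu (cylinder i w)) ->
  forall B, measurable B -> mu B = nu B.
Proof.
move=> h; apply: (@measure_unique _ _ _ centered_cylinders
  (fun k => oapp (fun a => cylinder 0 [:: a]) set0 (unpickle k))).
- exact: centered_cylinders_generate.
- exact: centered_cylinders_setI.
- move=> k; case: (unpickle k) => [a|]; last by left.
  by right; exists 0%N, [:: a]; rewrite oppr0.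
- by rewrite -bigcup_unpickle; apply/seteqP; split=> // x _; exists (x 0).
- move=> B [->|[n [w [_ ->]]]]; [by rewrite !measure0|exact: h].
- by move=> k; case: (unpickle k) => [a|]; rewrite ?measure0 // ltey_eq probability_fin //;
    apply: measurable_cylinder.
Qed.

(** The image of [mu] under the shift is a probability that agrees with [mu] on cylinders. *)
Lemma cylinder_invariant (mu : probability (full_shift A) R) :
  (forall i w, mu (cylinder (i + 1) w) = mu (cylinder i w)) ->
  forall B, measurable B -> mu (shift @^-1` B) = mu B.
Proof.
move=> h.
have [||||nu hnu] := @probability_exists _ (full_shift A) R (fun B => mu (shift @^-1` B)).
- by rewrite preimage_set0 measure0.
- by move=> B; apply: measure_ge0.
- move=> F mF tF mU; rewrite preimage_bigcup.
  apply: (@measure_semi_sigma_additive _ _ _ mu (fun n => shift @^-1` (F n))) => [n||].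
  + exact: measurable_left_shift.
  + apply/trivIsetP => a b _ _ ab; move/trivIsetP: tF => /(_ a b Logic.I Logic.I ab) Fab.
    by rewrite -preimage_setI Fab preimage_set0.
  + by apply: bigcupT_measurable => n; apply: measurable_left_shift.
- by rewrite preimage_setT probability_setT.
move=> B mB; rewrite -hnu; apply: probability_unique B mB => i w.
by rewrite hnu left_shift_preimage_cylinder h.
Qed.

Lemma probability_conditioned (mu : probability (full_shift A) R) (D : set (full_shift A)) t :
  measurable D -> mu D = t%:E -> 0 < t -> exists nu : probability (full_shift A) R,
    forall B, nu B = ((t^-1)%:E * mu (B `&` D))%E.
Proof.
move=> mD muD t0; have t0' : 0 <= t^-1 by rewrite invr_ge0 ltW.
apply: probability_exists.
- by rewrite set0I measure0 mule0.
- by move=> B; rewrite mule_ge0.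
- move=> F mF tF mU; rewrite setI_bigcupl.
  rewrite [X in X @ _ --> _](_ : _ = fun n : nat =>
    ((t^-1)%:E * \sum_(0 <= i < n) mu (F i `&` D))%E); last first.
    apply/funext => n; rewrite ge0_sume_distrr // => i _; exact: measure_ge0.
  apply: cvgeZl => //.
  apply: (@measure_semi_sigma_additive _ _ _ mu (fun n => F n `&` D)) => [n||].
  + exact: measurableI.
  + apply/trivIsetP => a b _ _ ab; move/trivIsetP: tF => /(_ a b Logic.I Logic.I ab) Fab.
    by rewrite setIACA Fab set0I.
  + by rewrite -setI_bigcupl; apply: measurableI.
- by rewrite setTI muD -EFinM mulVf // gt_eqF.
Qed.

End InvariantMeasures.

(** * Kraft sums below the entropy *)

Section EntropyOfMeasures.
Variables (R : realType) (A : alphabetType).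
Local Notation shift := (@left_shift A).
Local Notation block_entropy mu n := (entropy_of mu (itin shift (@symbol0 A) n)).

Definition invariant (mu : probability (full_shift A) R) :=
  forall B, measurable B -> mu (shift @^-1` B) = mu B.

Lemma itin_symbol0_preimage n (t : n.-tuple A) :
  itin shift (@symbol0 A) n @^-1` [set t] = cylinder 0 t.
Proof.
apply/seteqP; split=> x; rewrite /preimage /cylinder /= size_tuple.
  by move=> <-; rewrite val_itin_symbol0.
by move=> e; apply/val_inj; rewrite /= val_itin_symbol0.
Qed.

Lemma entropy_rate_le (mu : probability (full_shift A) R) (l : R) : invariant mu ->
  block_entropy mu n / n%:R @[n --> \oo] --> l ->
  (l%:E <= metric_entropy shift mu)%E.
Proof.
move=> imu cl; pose p (x : full_shift A) := enum_rank (symbol0 x).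
have ms := @symbol0_measurable A.
have mp : measurable_fibers p by apply: (measurable_fibers_comp enum_rank ms).
apply: ereal_sup_ubound; exists #|A|, p; split=> //; congr EFin.
apply/esym/cvg_lim => //.
rewrite [X in X @ _ --> _](_ : _ = fun n : nat => block_entropy mu n / n%:R) //.
apply/funext => n; congr (_ / _).
have -> : partition_entropy shift mu p n = entropy_of mu (itin shift p n) by [].
apply/eqP; rewrite eq_le; apply/andP; split.
  rewrite (_ : itin shift p n = (fun t => [tuple enum_rank (tnth t i) | i < n]) \o
    itin shift (@symbol0 A) n).
    by apply: entropy_comp_le; apply: (itin_measurable (@measurable_left_shift A)).
  by apply/funext => x; apply: eq_from_tnth => i; rewrite !tnth_mktuple.
rewrite (_ : itin shift (@symbol0 A) n = (fun t => [tuple enum_val (tnth t i) | i < n]) \o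
  itin shift p n).
  by apply: entropy_comp_le; apply: (itin_measurable (@measurable_left_shift A)).
by apply/funext => x; apply: eq_from_tnth => i; rewrite !tnth_mktuple enum_rankK.
Qed.

(** The complement of X is covered by countably many cylinders over words outside the language. *)
Lemma mu_coded_shift (G : set (seq A)) (mu : probability (full_shift A) R) :
  (forall i w, ~ language (coded_shift G) w -> mu (cylinder i w) = 0%E) ->
  mu (coded_shift G) = 1%E.
Proof.
move=> h; have mX := coded_shift_measurable G.
suff : mu (~` coded_shift G) = 0%E.
  rewrite probability_setC // -[mu _]fineK ?probability_fin // => -[/eqP].
  by rewrite subr_eq0 => /eqP <-.
apply/measure_negligible; first exact: measurableC.
pose F w n : set (full_shift A) := if `[< ~ language (coded_shift G) w >]
  then cylinder (- Posz n) w else set0.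
apply: (@negligibleS _ _ _ _ (\bigcup_w \bigcup_n F w n)).
  move=> x /not_coded_shift [n hn]; exists (window n x) => //; exists n => //.
  by rewrite /F asboolT // /cylinder /= size_subword.
rewrite bigcup_unpickle; apply: negligible_bigcup => k.
case: (unpickle k) => [w|]; last exact: negligible_set0.
apply: negligible_bigcup => n; rewrite /F.
case: asboolP => nw; last exact: negligible_set0.
by apply/negligibleP; [apply: measurable_cylinder|apply: h].
Qed.

Lemma probability_conditioned_invariant (mu : probability (full_shift A) R) D t :
  invariant mu -> measurable D -> shift @^-1` D = D -> mu D = t%:E -> 0 < t ->
  exists2 nu : probability (full_shift A) R, invariant nu &
    forall B, nu B = ((t^-1)%:E * mu (B `&` D))%E.
Proof.
move=> imu mD iD muD t0; have [nu hnu] := probability_conditioned mD muD t0.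
exists nu => // B mB; rewrite !hnu -[in LHS]iD -preimage_setI imu //.
exact: measurableI.
Qed.

Lemma block_entropy_cvg (mu : probability (full_shift A) R) : invariant mu ->
  exists2 l, block_entropy mu n / n%:R @[n --> \oo] --> l &
    forall n, (0 < n)%N -> l <= block_entropy mu n / n%:R.
Proof.
move=> imu.
exact: (itin_cvg (@measurable_left_shift A) imu (@symbol0_measurable A)).
Qed.

Lemma concatenations_shift_invariant G :
  shift @^-1` (concatenations G) = concatenations G.
Proof.
by apply/seteqP; split=> x h; [exact: (iffLR (shift_concatenations G 1 x))|
  exact: (iffRL (shift_concatenations G 1 x))].
Qed.

Lemma language_measure (X : set (full_shift A)) : X !=set0 ->
  exists mu : probability (full_shift A) R, [/\ invariant mu,
    forall i w, ~ language X w -> mu (cylinder i w) = 0%E &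
    forall n, (0 < n)%N -> n%:R * topological_entropy X <= block_entropy mu n].
Proof.
move=> X0; have [m [m0 m1 mS mL mh]] := limit_frequencies R X0.
have [mu hmu] := probability_of_cylinders m0 m1 (fun w => (mS w).1) (fun w => (mS w).2).
exists mu; split.
- by apply: cylinder_invariant => i w; rewrite !hmu.
- by move=> i w /mL e; rewrite hmu e.
move=> n n0; apply: le_trans (mh n n0) _.
rewrite le_eqVlt; apply/orP; left; apply/eqP; congr shannon; apply/funext => t.
by rewrite /law itin_symbol0_preimage hmu.
Qed.

Section Decomposition.
Variable G : set (seq A).
Hypothesis G_nonempty : forall w, G w -> w <> [::].
Hypothesis G_unique : unique_representation G.
Variable s : R.
Hypothesis s_ge0 : 0 <= s.
Hypothesis kraft_le1 : forall F, uniq F -> (forall g, g \in F -> G g) -> kraft s F <= 1.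
Local Notation Xseq := (concatenations G).
Local Notation X := (coded_shift G).

Lemma setI_split (mu : probability (full_shift A) R) D B : measurable D -> measurable B ->
  fine (mu B) = fine (mu (B `&` D)) + fine (mu (B `&` ~` D)).
Proof.
move=> mD mB; have m1 := measurableI _ _ mB mD.
have m2 := measurableI _ _ mB (measurableC mD).
rewrite -fineD ?probability_fin // -measureU //; first by rewrite -setIUr setUv setIT.
by rewrite setIACA setICr setI0.
Qed.

(** Let t be the mass of X_seq. The case t = 1 would give h <= s; the case t = 0 is treated apart
    because conditioning on X_seq divides by t. *)
Theorem entropy_outside_concatenations : s < topological_entropy X ->
  exists b (nu : probability (full_shift A) R),
    [/\ s < b, invariant_measures X nu, nu (X `\` Xseq) = 1%E &
      (b%:E <= metric_entropy shift nu)%E].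
Proof.
move=> sh.
have X0 : X !=set0.
  apply/set0P/eqP => e; move: sh; rewrite e topological_entropy_set0.
  by rewrite ltNge s_ge0.
have [mu [imu muL muh]] := language_measure X0.
have muX := mu_coded_shift muL.
have mX := coded_shift_measurable G.
have mS : measurable Xseq by apply: concatenations_measurable.
have SX : Xseq `<=` X by apply: subset_closure.
have le_s (nu : probability (full_shift A) R) (r : R) : invariant nu -> nu Xseq = 1%E ->
    block_entropy nu n / n%:R @[n --> \oo] --> r -> r <= s.
  move=> inu nu1 cr; rewrite -lee_fin; apply: le_trans (entropy_rate_le inu cr) _.
  exact: (metric_entropy_le inu G_nonempty G_unique s_ge0 kraft_le1 nu1).
have mC := measurableC mS.
have iC : shift @^-1` (~` Xseq) = ~` Xseq.
  exact: (congr1 setC (concatenations_shift_invariant G)).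
pose t := fine (mu Xseq).
have muS : mu Xseq = t%:E by rewrite /t fineK // probability_fin.
have muC : mu (~` Xseq) = (1 - t)%:E by rewrite probability_setC // muS.
have t0 : 0 <= t by rewrite fine_ge0.
have t1 : t <= 1 by rewrite -subr_ge0 -lee_fin -muC.
have [t1'|] := eqVneq t 1.
  have [l cl _] := block_entropy_cvg imu.
  have : l <= s by apply: (le_s mu l imu _ cl); rewrite muS t1'.
  suff : topological_entropy X <= l by lra.
  apply: (cvgr_to_ge cl); near=> n.
  have n0 : (0 < n)%N by near: n; exists 1%N.
  by rewrite ler_pdivlMr ?ltr0n // mulrC muh.
move=> /negPf t1'; have {}t1' : t < 1 by rewrite lt_neqAle t1' t1.
have muXC : mu (X `&` ~` Xseq) = (1 - t)%:E.
  rewrite -muC -[RHS]mul1e.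
  have e := @setI_split mu X (~` Xseq) mX mC.
  have z : fine (mu (~` Xseq `&` ~` X)) = 0.
    apply/eqP; rewrite eq_le fine_ge0 // andbT.
    apply: le_trans (fine_muS _ _ _ (@subIsetr _ _ _)) _ => //.
    - by apply: measurableI => //; apply: measurableC.
    - exact: measurableC.
    by rewrite fine_muC // muX /= subrr.
  rewrite mul1e setIC -[LHS]fineK ?probability_fin //; last exact: measurableI.
  by rewrite -[RHS]fineK ?probability_fin // e z addr0.
have u0 : 0 < 1 - t by rewrite subr_gt0.
have [nu inu hnu] := probability_conditioned_invariant imu mC iC muC u0.
have nuX : nu (X `\` Xseq) = 1%E.
  by rewrite hnu setDE -setIA setIid muXC -EFinM mulVf // gt_eqF.
have nuX1 : nu X = 1%E.
  by rewrite hnu muXC -EFinM mulVf // gt_eqF.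
have [b cb _] := block_entropy_cvg inu.
exists b, nu; split=> //; last exact: entropy_rate_le.
have [t0'|] := eqVneq t 0.
  suff e n : block_entropy nu n = block_entropy mu n.
    apply: (lt_le_trans sh); apply: (cvgr_to_ge cb); near=> n.
    have n0 : (0 < n)%N by near: n; exists 1%N.
    by rewrite e ler_pdivlMr ?ltr0n // mulrC muh.
  congr shannon; apply/funext => w; rewrite /law hnu.
  set B := _ @^-1` _; have mB : measurable B.
    by apply: (itin_measurable (@measurable_left_shift A)); apply: symbol0_measurable.
  rewrite t0' subr0 invr1 mul1e; rewrite (setI_split mu mC mB) setCK.
  rewrite -[LHS]addr0; congr (_ + _); apply/eqP; rewrite eq_le fine_ge0 //=.
  apply: le_trans (fine_muS _ _ _ (@subIsetr _ _ _)) _ => //; first exact: measurableI.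
  by rewrite -t0'.
move=> tn0; have {}t0 : 0 < t by rewrite lt_neqAle eq_sym tn0.
have [nu' inu' hnu'] :=
  probability_conditioned_invariant imu mS (concatenations_shift_invariant G) muS t0.
have nu'1 : nu' Xseq = 1%E by rewrite hnu' setIid muS -EFinM mulVf // gt_eqF.
have [a ca _] := block_entropy_cvg inu'.
have as_ : a <= s by apply: le_s nu'1 ca.
have mix n : block_entropy mu n <= t * block_entropy nu' n + (1 - t) * block_entropy nu n
    - (t * ln t + (1 - t) * ln (1 - t)).
  have mi := itin_measurable (@measurable_left_shift A) n (@symbol0_measurable A).
  apply: le_trans (shannon_mix_le t0 t1' (law_pmf nu' mi) (law_pmf nu mi)).
  rewrite le_eqVlt; apply/orP; left; apply/eqP; congr shannon; apply/funext => w.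
  have mB := mi w; rewrite /law hnu hnu' (setI_split mu mS mB).
  rewrite !fineM ?probability_fin //; try exact: measurableI.
  by rewrite /= !mulrA !divff ?mul1r // gt_eqF.
(* The mixing inequality divided by n, in the limit; the factor 0 is the limit of 1/n. Then a <= s <
   h forces b > s. *)
have : topological_entropy X <= t * a + (1 - t) * b - (t * ln t + (1 - t) * ln (1 - t)) * 0.
  have cn : (n%:R^-1 : R) @[n --> \oo] --> (0 : R).
    apply/gtr0_cvgV0; last exact: cvgr_idn.
    by exists 1%N => // n; rewrite /= ltr0n.
  apply: (cvgr_to_ge (cvgB (cvgD (cvgMr ca) (cvgMr cb)) (cvgMr cn))).
  near=> n.
  have n0 : (0 < n)%N by near: n; exists 1%N.
  have n0' : 0 < n%:R :> R by rewrite ltr0n.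
  rewrite -(ler_pM2l n0'); apply: le_trans (muh n n0) _; apply: le_trans (mix n) _.
  rewrite /= le_eqVlt; apply/orP; left; apply/eqP; rewrite !fctE; field; exact: lt0r_neq0.
rewrite mulr0 subr0 => hab; rewrite -(ltr_pM2l u0).
have : t * a <= t * s by rewrite ler_pM2l.
lra.
Unshelve. all: by end_near.
Qed.
End Decomposition.
End EntropyOfMeasures.

(** * Integrals of potentials and pressure *)

Section NonmeasurableIntegrands.
Context {d : measure_display} {T : measurableType d} {R : realType}.

(** The integral of a nonnegative function is a supremum over the simple functions below it, hence
    monotone for arbitrary functions; potentials are controlled on X only. *)
Lemma ge0_integral_le (mu : {measure set T -> \bar R}) (D : set T) (f g : T -> \bar R) :
  (forall x, D x -> 0 <= f x)%E -> (forall x, D x -> f x <= g x)%E ->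
  (\int[mu]_(x in D) f x <= \int[mu]_(x in D) g x)%E.
Proof.
move=> f0 fg; rewrite !ge0_integralE //; last first.
  by move=> x Dx; apply: le_trans (fg x Dx); apply: f0.
apply: le_ereal_sup => _ [h /= hf <-]; exists h => //= x; apply: le_trans (hf x) _.
by rewrite /patch; case: ifPn => //; rewrite inE => /fg.
Qed.

Lemma integral_bounded (mu : probability T R) (D : set T) (f : T -> R) (r : R) :
  measurable D -> mu D = 1%E -> (forall x, D x -> `|f x| <= r) ->
  ((- r)%:E <= \int[mu]_(x in D) (f x)%:E <= r%:E)%E.
Proof.
move=> mD muD fr.
have cst : (\int[mu]_(x in D) r%:E = r%:E)%E.
  exact: etrans (integral_cst mu mD r%:E) (etrans (congr1 (mule r%:E) muD) (mule1 _)).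
rewrite integralE.
set p := (X in (_ <= X - _ <= _)%E); set n := (X in (_ <= p - X <= _)%E).
have p0 : (0 <= p)%E by apply: integral_ge0 => x _; rewrite funepos_ge0.
have n0 : (0 <= n)%E by apply: integral_ge0 => x _; rewrite funeneg_ge0.
have pr : (p <= r%:E)%E.
  rewrite -cst; apply: ge0_integral_le => x Dx; first by rewrite funepos_ge0.
  rewrite funeposE ge_max !lee_fin; have := fr x Dx; rewrite ler_norml => /andP[h1 h2].
  by apply/andP; split; lra.
have nr : (n <= r%:E)%E.
  rewrite -cst; apply: ge0_integral_le => x Dx; first by rewrite funeneg_ge0.
  rewrite funenegE ge_max -EFinN !lee_fin; have := fr x Dx; rewrite ler_norml => /andP[h1 h2].
  by apply/andP; split; lra.
case: p n p0 n0 pr nr => [p| |] [n| |] //=; rewrite ?leye_eq //.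
by rewrite -EFinB !lee_fin; lra.
Qed.

End NonmeasurableIntegrands.

Section Pressure.
Variables (R : realType) (A : alphabetType) (G : set (seq A)).
Hypothesis G_nonempty : forall w, G w -> w <> [::].
Hypothesis G_unique : unique_representation G.
Hypothesis zero_FSSP : FSSP G (fun _ : full_shift A => 0 : R).
Local Notation shift := (@left_shift A).
Local Notation Xseq := (concatenations G).
Local Notation X := (coded_shift G).

Lemma small_strict_potential (e : R) : 0 < e -> exists psi : full_shift A -> R,
  strict_full_sequential_pressure G psi /\ forall x, X x -> `|psi x| <= e.
Proof.
move=> e0; have [_ clo] := zero_FSSP.
pose U : set (full_shift A -> R) := [set psi | forall x, X x -> `|psi x| <= e].
have [|psi [[_ spsi] Upsi]] := clo U; last by exists psi.
apply/uniform_nbhs; exists [set p | ball p.1 e p.2]; split.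
  exact: (entourage_ball _ (PosNum e0)).
by move=> psi h x /h; rewrite /= /ball /= sub0r normrN => /ltW.
Qed.

Theorem entropy_le_of_kraft_le1 (s : R) : 0 <= s ->
  (forall F, uniq F -> (forall g, g \in F -> G g) -> kraft s F <= 1) ->
  topological_entropy X <= s.
Proof.
move=> s0 kr; rewrite leNgt; apply/negP => sh.
have [b [nu [sb inu nuX hb]]] :=
  entropy_outside_concatenations G_nonempty G_unique s0 kr sh.
have e0 : 0 < (b - s) / 2 by rewrite divr_gt0 // subr_gt0.
have [psi [strict bpsi]] := small_strict_potential e0.
have mX := coded_shift_measurable G.
have bd (mu : probability (full_shift A) R) : mu X = 1%E ->
    ((- ((b - s) / 2))%:E <= \int[mu]_(x in X) (psi x)%:E <= ((b - s) / 2)%:E)%E.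
  by move=> mu1; apply: integral_bounded.
move: strict; rewrite /strict_full_sequential_pressure /= ltNge => /negP; apply.
(* Both suprema are compared with the midpoint of s and b. *)
apply: (@le_trans _ _ (s%:E + ((b - s) / 2)%:E)%E).
  apply: ub_ereal_sup => _ [mu [[muX imu] mu1] <-]; apply: leeD.
    exact: (metric_entropy_le imu G_nonempty G_unique s0 kr mu1).
  by have /andP[] := bd mu muX.
apply: (@le_trans _ _ (b%:E + (- ((b - s) / 2))%:E)%E).
  by rewrite -!EFinD lee_fin; lra.
apply: le_trans (ereal_sup_ubound _); last by exists nu.
by apply: leeD => //; have /andP[] := bd nu inu.1.
Qed.

Lemma kraft_gt1 (s : R) : 0 <= s -> s < topological_entropy X ->
  exists2 F, uniq F & (forall g, g \in F -> G g) /\ 1 < kraft s F.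
Proof.
move=> s0 sh; apply: contrapT => nF; move: sh; apply/negP; rewrite -leNgt.
apply: entropy_le_of_kraft_le1 => // F uF FG; rewrite leNgt; apply/negP => F1.
by apply: nF; exists F.
Qed.

End Pressure.

(** * Computation of the entropy *)

Section Tests.
Variables (R : realType) (A : alphabetType) (k : nat).
Hypothesis k_gt0 : (0 < k)%N.
Let delta : R := ln (k.+1%:R / k%:R).

Lemma expR_delta : expR delta = k.+1%:R / k%:R.
Proof. by rewrite lnK // posrE divr_gt0 // ltr0n. Qed.

(** The bridge from the integers of the tests to exponentials of rate [delta]. *)
Lemma natr_expS p : (k.+1 ^ p)%:R = (k ^ p)%:R * expR (delta * p%:R) :> R.
Proof.
rewrite !natrX mulrC expRM_natr expR_delta expr_div_n divfK //.
by rewrite expf_neq0 // pnatr_eq0 -lt0n.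
Qed.

Lemma delta_le : delta <= k%:R^-1.
Proof.
have k0 : 0 < k%:R :> R by rewrite ltr0n.
rewrite -ler_expR expR_delta; apply: le_trans (expR_ge1Dx _).
by rewrite -natr1 mulrDl divff ?gt_eqF // mul1r.
Qed.

Lemma delta_ge : k.+1%:R^-1 <= delta.
Proof.
have k0 : 0 < k%:R :> R by rewrite ltr0n.
have k1 : 0 < k.+1%:R :> R by rewrite ltr0n.
rewrite -lerN2 -ler_expR expRN expR_delta invf_div.
apply: le_trans (expR_ge1Dx _).
rewrite -[leLHS](addrNK 1) addrC lerD2l -natr1.
rewrite (_ : _ - 1 = - (k%:R + 1)^-1) //; field; rewrite natr1; exact: lt0r_neq0.
Qed.

Lemma upper_testE OL (X : set (full_shift A)) j t : language_oracle X OL ->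
  upper_test OL k j t = ((size (wlist (language X) (2 * t + 1)) * (2 * t).+2)%:R <=
    expR (j.+2%:R * delta * (2 * t + 1)%:R)).
Proof.
move=> hOL; have [uOL mOL] := hOL t.
have sz : size (OL t) = size (wlist (language X) (2 * t + 1)).
  apply/perm_size/uniq_perm => // [|w]; first exact: wlist_uniq.
  by apply/idP/idP => [/mOL|/mem_wlist] h; [apply/mem_wlist|apply/mOL].
have tot : total_size (OL t) = (size (OL t) * (2 * t).+2)%N.
  rewrite /total_size (eq_in_map _ (fun=> (2 * t).+2) (OL t)).1.
    by elim: (OL t) => //= w s ->; rewrite mulSn.
  by move=> w /mOL [-> _]; rewrite addn1.
rewrite /upper_test tot sz -(ler_nat R) natrM natr_expS mulrC ler_pM2l; last first.
  by rewrite ltr0n expn_gt0 k_gt0.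
by rewrite [in X in _ <= X]natrM mulrCA mulrA.
Qed.

Lemma sum_nth_seq (I : Type) (x0 : I) (F : I -> nat) (s : seq I) t :
  F x0 = 0%N -> (size s <= t)%N -> (\sum_(i < t) F (nth x0 s i) = \sum_(x <- s) F x)%N.
Proof.
move=> F0; elim: s t => [|x s IH] [|t] //=.
- by rewrite big_nil big_ord0.
- by move=> _; rewrite big_nil big1 // => i _; rewrite nth_nil.
by rewrite ltnS => /IH e; rewrite big_ord_recl big_cons /= -e.
Qed.

Lemma lower_testE OG (G : set (seq A)) j t : (forall w, G w -> w <> [::]) ->
  generator_oracle G OG -> lower_test OG k j t = (1 <= kraft (j%:R * delta) (OG t)).
Proof.
move=> G0 [uOG tOG mOG].
have st : (size (OG t) <= t)%N by rewrite (tOG t t) // size_take; case: ltnP.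
set T := total_size (OG t); set K : R := (k.+1 ^ (j * T))%:R.
have K0 : 0 < K by rewrite ltr0n expn_gt0.
rewrite /lower_test (@sum_nth_seq _ [::] (fun w => (0 < size w) * (k ^ (j * size w) *
     k.+1 ^ (j * (total_size (OG t) - size w))))%N) //.
rewrite -(ler_nat R) natr_sum -/T -/K.
rewrite (_ : \sum_(w <- OG t) _ = K * kraft (j%:R * delta) (OG t)).
  by rewrite -[X in X <= _]mulr1 ler_pM2l.
rewrite /kraft mulr_sumr [LHS]big_seq [RHS]big_seq; apply: eq_bigr => w wG.
have -> : (0 < size w)%N.
  by rewrite lt0n size_eq0; apply/eqP/G0/mOG; exists t.
have wT : (size w <= T)%N.
  rewrite /T /total_size; elim: (OG t) wG => //= v s IH; rewrite inE => /orP[/eqP ->|/IH]; lia.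
rewrite mul1n /K -[in RHS](subnKC wT) mulnDr expnD !natrM natr_expS.
rewrite -[RHS]mulrA [RHS]mulrAC -[RHS]mulrA [_%:R * expR _]mulrC.
rewrite -!mulrA; congr (_ * _); rewrite [RHS]mulrC -mulrA -expRD.
by rewrite (_ : _ + _ = 0) ?expR0 ?mulr1 // natrM; ring.
Qed.

End Tests.

Lemma kraft_sub (R : realType) (A : alphabetType) (s : R) (F H : seq (seq A)) :
  uniq F -> uniq H -> {subset F <= H} -> kraft s F <= kraft s H.
Proof.
move=> uF uH FH; rewrite /kraft (perm_big [seq w <- H | w \in F]); last first.
  apply: uniq_perm => // [|w]; first exact: filter_uniq.
  by rewrite mem_filter; apply/idP/andP => [wF|[]] //; split=> //; apply: FH.
rewrite big_filter big_mkcond; apply: ler_sum => w _; case: ifP => // _; exact: expR_ge0.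
Qed.

Lemma generator_oracle_covers (A : alphabetType) (G : set (seq A)) OG (F : seq (seq A)) :
  generator_oracle G OG -> (forall g, g \in F -> G g) ->
  exists t0, forall t, (t0 <= t)%N -> {subset F <= OG t}.
Proof.
move=> [uOG tOG mOG]; elim: F => [|g F IH] FG; first by exists 0%N.
have [t0 h0] := IH (fun w wF => FG w (mem_behead (s := g :: F) wF)).
have [t1 h1] := (mOG g).1 (FG g (mem_head _ _)).
exists (maxn t0 t1) => t; rewrite geq_max => /andP[t0t t1t] w.
rewrite inE => /orP[/eqP ->|]; last exact: h0.
by move: h1; rewrite (tOG t1 t) // => /mem_take.
Qed.

(** Absorbs the factor 2 t + 2 of the upper test. With x = c n / 2, e^(2 x) >= (1 + x)^2, whose
    quadratic term exceeds n. *)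
Lemma linear_le_expR (R : realType) (c : R) : 0 < c ->
  exists N, forall n, (N <= n)%N -> n.+1%:R <= expR (c * n%:R).
Proof.
move=> c0; exists (Num.truncn (4 / c ^+ 2)).+1 => n nN.
have c20 : 0 < c ^+ 2 by rewrite exprn_gt0.
have : 4 < n%:R * c ^+ 2.
  rewrite -ltr_pdivrMr //; apply: lt_le_trans (truncnS_gt _) _.
  by rewrite ler_nat.
have n0 : 0 < n%:R :> R by rewrite ltr0n (leq_trans _ nN).
move=> h; have -> : c * n%:R = c * n%:R / 2 + c * n%:R / 2 by field.
have x0 : 0 <= c * n%:R / 2 by rewrite divr_ge0 // mulr_ge0 // ltW.
rewrite expRD -natr1; set x := c * _ / 2 in x0 *.
have h1 : 1 + x <= expR x by apply: expR_ge1Dx.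
have : (1 + x) * (1 + x) <= expR x * expR x by apply: ler_pM => //; lra.
apply: le_trans; rewrite (_ : _ * _ = 1 + 2 * x + x ^+ 2); last by ring.
have : x ^+ 2 = n%:R * (n%:R * c ^+ 2) / 4 by rewrite /x; field.
have : n%:R * 4 < n%:R * (n%:R * c ^+ 2) by rewrite ltr_pM2l.
lra.
Qed.

Section Computation.
Variables (R : realType) (A : alphabetType) (G : set (seq A)).
Hypothesis G_nonempty : forall w, G w -> w <> [::].
Hypothesis G_unique : unique_representation G.
Local Notation X := (coded_shift G).
Local Notation h := (topological_entropy X : R).

Lemma topological_entropy_ge0 : 0 <= h.
Proof.
have [->|/set0P X0] := eqVneq X set0; first by rewrite topological_entropy_set0.
have [ch _] := topological_entropy_cvg R X0; apply: (cvgr_to_ge ch).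
by near=> n; rewrite divr_ge0 // ln_ge0 // ler1n language_count_gt0.
Unshelve. all: by end_near.
Qed.

Variables (OL OG : nat -> seq (seq A)).
Hypothesis OL_language : language_oracle X OL.
Hypothesis OG_generators : generator_oracle G OG.
Hypothesis h_gt0 : 0 < h.

Lemma coded_shift_neq0 : X !=set0.
Proof.
by apply/set0P/eqP => e; move: h_gt0; rewrite e topological_entropy_set0 ltxx.
Qed.

(** The tests give j d <= h <= (j + 2) d with 1/(k + 1) <= d <= 1/k. Hence j <= h (k + 1) and h k <=
    j + 2: an error of h/k on one side and 2/k on the other. *)
Lemma tests_sound k j t : (0 < k)%N -> upper_test OL k j t -> lower_test OG k j t ->
  `|j%:R / k%:R - h| <= Num.max 2 h / k%:R.
Proof.
move=> k0; rewrite (upper_testE R k0 j t OL_language).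
rewrite (lower_testE R k0 j t G_nonempty OG_generators) => up low.
set d : R := ln _ in up low.
have d1 : d <= k%:R^-1 := delta_le R k0.
have d2 : k.+1%:R^-1 <= d := delta_ge R k0.
have [uOG _ mOG] := OG_generators.
have lo : j%:R * d <= h.
  by apply: kraft_le_entropy low => // g gG; apply/mOG; exists t.
have N0 := language_count_gt0 coded_shift_neq0 (2 * t + 1).
have hi : h <= j.+2%:R * d.
  have [_ /(_ (2 * t + 1)%N)] := topological_entropy_cvg R coded_shift_neq0.
  rewrite addn1 => /(_ isT) /le_trans; apply; rewrite -addn1.
  rewrite ler_pdivrMr ?ltr0n ?addn1 // -addn1 -ler_expR lnK ?posrE ?ltr0n //.
  by apply: le_trans up; rewrite ler_nat leq_pmulr.
have kp : 0 < k%:R :> R by rewrite ltr0n.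
have k1p : 0 < k.+1%:R :> R by rewrite ltr0n.
have hi' : h <= (j%:R + 2) / k%:R.
  apply: le_trans hi _; rewrite -natr1 -natr1 -addrA -[1 + 1]/2.
  by apply: ler_wpM2l => //; rewrite addr_ge0.
have lo' : j%:R <= h * (k%:R + 1).
  rewrite natr1 -ler_pdivrMr //; apply: le_trans lo.
  by apply: ler_wpM2l.
rewrite ler_distlC; apply/andP; split; last first.
  apply: le_trans hi' _; rewrite mulrDl lerD2l ler_pM2r ?invr_gt0 //.
  by rewrite le_max lexx.
rewrite -mulrBl ler_pdivrMr // lerBlDr; apply: le_trans lo' _.
by rewrite mulrDr mulr1 lerD2l le_max lexx orbT.
Qed.

Hypothesis zero_FSSP : FSSP G (fun _ : full_shift A => 0 : R).

Lemma tests_complete k : (0 < k)%N -> exists t, exists2 j, (j <= t)%N &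
  upper_test OL k j t && lower_test OG k j t.
Proof.
move=> k0; pose d : R := ln (k.+1%:R / k%:R).
have d0 : 0 < d by apply: lt_le_trans (delta_ge R k0); rewrite invr_gt0.
have exm : exists m, h <= m%:R * d.
  exists (Num.truncn (h / d)).+1; rewrite -ler_pdivrMr //.
  exact/ltW/truncnS_gt.
(* j + 1 is the least number of steps that reaches h, and it is positive because h > 0. *)
case: (ex_minnP exm) => -[|j]; first by rewrite mul0r leNgt h_gt0.
move=> hj minj; have jh : j%:R * d < h.
  by rewrite ltNge; apply/negP => /minj; rewrite ltnn.
have jd0 : 0 <= j%:R * d by rewrite mulr_ge0 // ltW.
have [F uF [FG F1]] := kraft_gt1 G_nonempty G_unique zero_FSSP jd0 jh.
have [t0 ht0] := generator_oracle_covers OG_generators FG.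
(* Halfway between j + 1 and j + 2 steps: one half step for the convergence of the word counts, the
   other for the factor 2 t + 2. *)
have hs : h < (j%:R + 3 / 2) * d.
  by apply: le_lt_trans hj _; rewrite ltr_pM2r // -natr1 ltrD2l; lra.
have [N1 hN1] := language_count_le coded_shift_neq0 hs.
have d20 : 0 < d / 2 by rewrite divr_gt0.
have [N2 hN2] := linear_le_expR d20.
pose t := (t0 + N1 + N2 + j)%N.
exists t, j; first by rewrite /t; lia.
apply/andP; split.
  rewrite (upper_testE R k0 j t OL_language) natrM.
  have -> : j.+2%:R * ln (k.+1%:R / k%:R) * (2 * t + 1)%:R =
      (j%:R + 3 / 2) * d * (2 * t + 1)%:R + d / 2 * (2 * t + 1)%:R.
    by rewrite -/d -natr1 -natr1; field.
  rewrite expRD; apply: ler_pM => //; first by apply: hN1; rewrite /t; lia.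
  by rewrite -[(2 * t).+1]addn1; apply: hN2; rewrite /t; lia.
rewrite (lower_testE R k0 j t G_nonempty OG_generators).
have [uOG _ _] := OG_generators.
apply: le_trans (ltW F1) _; apply: kraft_sub => //.
by apply: ht0; rewrite /t; lia.
Qed.

End Computation.

Theorem corollary4 (R : realType) (A : alphabetType) (G : set (seq A))
    (G_nonempty : forall w, G w -> w <> [::])
    (G_unique : unique_representation G)
    (zero_FSSP : FSSP G (fun _ : full_shift A => 0 : R)) :
  exists M : oracle_machine A,
    forall OL OG : nat -> seq (seq A),
      language_oracle (coded_shift G) OL ->
      generator_oracle G OG ->
      computes_real M OL OG (topological_entropy (coded_shift G) : R).
Proof.
set h : R := topological_entropy _.
have [h0|h0] := leP h 0.
  have -> : h = 0 by apply/eqP; rewrite eq_le h0 topological_entropy_ge0.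
  have [M hM] := zero_machine A; exists M => OL OG _ _ n; exists 0; split=> //.
  by rewrite rmorph0 subrr normr0 invr_gt0 exprn_gt0.
pose B := (Num.truncn h).+3.
have hB : Num.max 2 h < B%:R.
  rewrite gt_max ltr_nat /=; apply: lt_trans (truncnS_gt _) _.
  by rewrite ltr_nat.
have [M hM] := @test_machine A B isT; exists M => OL OG hOL hOG n.
have k0 : (0 < B * 2 ^ n)%N by rewrite muln_gt0 expn_gt0.
have [j [t [/andP[up low] out]]] := hM OL OG n
  (tests_complete G_nonempty G_unique hOL hOG h0 zero_FSSP k0).
exists (j%:R / (B * 2 ^ n)%:R); split=> //.
rewrite fmorph_div /= !ratr_nat.
apply: le_lt_trans (tests_sound G_nonempty G_unique hOL hOG h0 k0 up low) _.
rewrite natrM natrX invfM mulrA -[ltRHS]mul1r ltr_pM2r ?invr_gt0 ?exprn_gt0 //.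
by rewrite ltr_pdivrMr ?ltr0n // mul1r.
Qed.
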